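(* An arbitrary element of the semigroup $SK$ corresponds to a singular knot if and only if this element is central, i.e. it commutes with every element of $SK$.
   Context: Singular knots. We work in the PL category. A singular knot is an immersion of finitely many circles into $\mathbb R^3$ (image a finite polygonal set; the empty one is allowed) whose only self-intersections are finitely many double points (singular points) in general position; two branches pass transversally through each singular point. Singular knots are non-oriented and possibly non-connected. An ambient PL-isotopy between two of them is a continuous family of PL-homeomorphisms $\phi_t:\mathbb R^3\to\mathbb R^3$, $t\in[0,1]$, with $\phi_0=\mathrm{id}$ and $\phi_1$ sending the first to the second; for singular knots the isotopy is required to respect the rigidity (template) of every singular point, i.e. a small neighbourhood of each singular point in the knot stays planar during the isotopy. Three-page embeddings. Let $\alpha$ be an oriented line (the $x$-axis of $\mathbb R^3$, oriented left to right) and $P_0=\{z=0,y\ge0\}$, $P_1=\{y=0,z\ge0\}$, $P_2=\{z=0,y\le0\}$ three half-planes (pages) with common boundary $\alpha$; the book is $\mathbb Y=P_0\cup P_1\cup P_2$. Indices $i$ lie in $\mathbb Z_3=\{0,1,2\}$. A singular knot $K\subset\mathbb Y$ is three-page embedded if: (1) all singular points lie on $\alpha$; (2) $K\cap\alpha$ is finite; (3) at every non-singular point of $K\cap\alpha$ the two arcs of $K$ issuing from it lie in different pages; (4) a neighbourhood of each singular point lies in $P_{i-1}\cup P_{i+1}$ for some $i$, with one arc going left and one arc going right in each of these two pages; (5) for each $i$ the orthogonal projection to $\alpha\approx\mathbb R$ is monotone on every connected component of $K\cap P_i$. Encoding. Let $\mathbb A=\{a_i,b_i,c_i,d_i,x_i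 \mid i\in\mathbb Z_3\}$. Reading the points of $K\cap\alpha$ along $\alpha$, write for each point a letter: $a_i$ if the two arcs at the point both go right, in $P_{i-1}$ and $P_{i+1}$; $c_i$ if they both go left, in $P_{i-1}$ and $P_{i+1}$; $b_i$ if one goes left in $P_{i-1}$ and one right in $P_{i+1}$; $d_i$ if one goes left in $P_{i+1}$ and one right in $P_{i-1}$; $x_i$ if the point is singular with neighbourhood in $P_{i-1}\cup P_{i+1}$. The resulting word (possibly empty) encodes the three-page embedding. The semigroup $SK$ (with unit $1$, the empty word) is generated by the 15 letters of $\mathbb A$ with relations, for all $i\in\mathbb Z_3$: (1) $a_i=a_{i+1}d_{i-1}$, $b_i=a_{i-1}c_{i+1}$, $c_i=b_{i-1}c_{i+1}$, $d_i=a_{i+1}c_{i-1}$; (2) $x_i=d_{i+1}x_{i-1}b_{i+1}$; (3) $d_0d_1d_2=1$; (4) $b_id_i=d_ib_i=1$; (5) $d_ix_id_i=a_i(d_ix_id_i)c_i$, $b_ix_ib_i=a_i(b_ix_ib_i)c_i$; (6) $x_i(d_{i+1}d_id_{i-1})=(d_{i+1}d_id_{i-1})x_i$; (7) $(d_ic_i)w=w(d_ic_i)$ for $w\in\{c_{i+1},x_{i+1},b_id_{i+1}d_i\}$; (8) $(a_ib_i)w=w(a_ib_i)$ for $w\in\{a_{i+1},b_{i+1},c_{i+1},x_{i+1},b_id_{i+1}d_i\}$; (9) $t_iw=wt_i$, where $t_i=b_{i+1}d_{i-1}d_{i+1}b_{i-1}$, for $w\in\{a_i,b_i,c_i,x_i,b_{i-1}d_id_{i-1}\}$;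 (10) $(d_ix_ib_i)w=w(d_ix_ib_i)$ for $w\in\{a_{i+1},b_{i+1},c_{i+1},x_{i+1},b_id_{i+1}d_i\}$. An element of $SK$ corresponds to a singular knot $K$ if it is the class of a word encoding a three-page embedding of a singular knot ambiently isotopic to $K$. *)

(* Defs.v *)
From HB Require Import structures.
From mathcomp Require Import all_boot all_order all_algebra.
From mathcomp Require Import all_classical all_reals all_analysis.
Set Implicit Arguments.
Unset Strict Implicit.
Unset Printing Implicit Defensive.
Import Order.TTheory GRing.Theory Num.Theory.
Import numFieldTopology.Exports numFieldNormedType.Exports.
Local Open Scope classical_set_scope.
Local Open Scope ring_scope.

Section PL.
Variable R : realType.

Definition conv_hull (V : lmodType R) (s : seq V) : set V :=
  [set x | exists c : 'I_(size s) -> R,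
    [/\ forall k, 0 <= c k, \sum_k c k = 1 & x = \sum_k c k *: s`_k]].

Definition affine_on (V W : lmodType R) (A : set V) (f : V -> W) : Prop :=
  forall x y l, A x -> A y -> 0 <= l <= 1 ->
    f (l *: x + (1 - l) *: y) = l *: f x + (1 - l) *: f y.

(* Every point has a neighbourhood covered by finitely many compact convex
   polytopes on each of which f is affine. *)
Definition PL (V W : normedModType R) (f : V -> W) : Prop :=
  forall x : V, exists ss : seq (seq V),
    nbhs x (\bigcup_(s in [set` ss]) conv_hull s) /\
    forall s, s \in ss -> affine_on (conv_hull s) f.

Definition PL_homeo (V W : normedModType R) (f : V -> W) : Prop :=
  PL f /\ exists g : W -> V, [/\ PL g, cancel f g & cancel g f].

End PL.

Section Knots.
Variable R : realType.

(* R^3, a point being ((x, y), z). *)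
Definition pt : Type := (R * R * R)%type.
Definition xco (p : pt) : R := p.1.1.
Definition yco (p : pt) : R := p.1.2.
Definition zco (p : pt) : R := p.2.

(* Finitely many parametrised closed curves; the circle is R / Z, so that the
   strands of a knot are required to be 1-periodic. *)
Record curves := Curves {
  ncomp : nat;
  strand : 'I_ncomp -> R -> pt
}.

Definition image_of (K : curves) : set pt :=
  [set p | exists j t, @strand K j t = p].

(* The preimages of a point, with R / Z represented by [0, 1[. *)
Definition fiber (K : curves) (p : pt) : set ('I_(ncomp K) * R) :=
  [set z | 0 <= z.2 < 1 /\ strand z.1 z.2 = p].

Arguments fiber : clear implicits.

Definition singular_point (K : curves) (p : pt) : Prop :=
  exists z1 z2, [/\ fiber K p z1, fiber K p z2 & z1 <> z2].

(* The plane bent along the line spanned by u: the union of the half-planes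
   R u + R_{>=0} v and R u + R_{>=0} w.  The flat planes are obtained for
   w = - v; a bend has to be allowed, because the "planes" formed by two pages
   of the book are bent. *)
Definition bent_chart (u v w : pt) (a : R * R) : pt :=
  a.1 *: u + (if 0 <= a.2 then a.2 *: v else (- a.2) *: w).

Definition bent_frame (u v w : pt) : Prop := injective (bent_chart u v w).

Definition bent_plane (u v w q : pt) : set pt :=
  [set q + bent_chart u v w a | a in [set: R * R]].

(* The open quadrants around q in the bent plane:
   s = +1 / -1 for the direction along u, r = +1 / -1 for the side v / w. *)
Definition quadrant (u v w q : pt) (s r : R) : set pt :=
  [set q + bent_chart u v w a | a in [set a : R * R | 0 < s * a.1 /\ 0 < r * a.2]].

(* Near the parameter t, the curve b goes from A to B, in either direction. *)
Definition passes (b : R -> pt) (t : R) (A B : set pt) : Prop :=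
  (\forall e \near 0^'+, A (b (t - e)) /\ B (b (t + e))) \/
  (\forall e \near 0^'+, B (b (t - e)) /\ A (b (t + e))).

(* The branches b1 (at t1) and b2 (at t2) lie near q in the bent plane and join
   opposite quadrants of it, i.e. they cross transversally at q. *)
Definition crosses_in (u v w q : pt) (b1 : R -> pt) (t1 : R)
    (b2 : R -> pt) (t2 : R) : Prop :=
  [/\ b1 t1 = q, b2 t2 = q,
      passes b1 t1 (quadrant u v w q (-1) 1) (quadrant u v w q 1 (-1)) &
      passes b2 t2 (quadrant u v w q (-1) (-1)) (quadrant u v w q 1 1)].

Definition singular_knot (K : curves) : Prop :=
  [/\ forall j t, @strand K j (t + 1) = strand j t,
      forall j, PL (@strand K j : R^o -> pt),
      forall j (t : R), exists2 U, nbhs t U & {in U &, injective (@strand K j)},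
      finite_set (singular_point K) &
      forall p, singular_point K p -> exists z1 z2,
        fiber K p = [set z1; z2] /\
        exists u v w, bent_frame u v w /\
          crosses_in u v w p (strand z1.1) z1.2 (strand z2.1) z2.2].

(* Equality of non-oriented curves: the components correspond to each other up
   to reparametrisation of the circle R / Z. *)
Definition same_curves (K L : curves) : Prop :=
  exists2 f : 'I_(ncomp K) -> 'I_(ncomp L), bijective f &
  forall j, exists h : R -> R,
    [/\ continuous h, bijective h,
        exists2 d : R, d = 1 \/ d = -1 & forall t, h (t + 1) = h t + d &
        forall t, strand (f j) (h t) = strand j t].

Definition map_curves (f : pt -> pt) (K : curves) : curves :=
  Curves (fun (j : 'I_(ncomp K)) t => f (strand j t)).

(* The last clause is rigidity: a fixed neighbourhood of the singular point in K
   stays in a (possibly bent) plane, the branches crossing transversally in it. *)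
Definition isotopic (K L : curves) : Prop :=
  exists phi : R -> pt -> pt,
  [/\ {within [set a : R * pt | 0 <= a.1 <= 1],
         continuous (fun a : R * pt => phi a.1 a.2)},
      forall t, 0 <= t <= 1 -> PL_homeo (phi t),
      forall p, phi 0 p = p,
      same_curves (map_curves (phi 1) K) L &
      forall p z1 z2, fiber K p z1 -> fiber K p z2 -> z1 <> z2 ->
        exists2 U, nbhs p U & forall t, 0 <= t <= 1 ->
          exists u v w, [/\ bent_frame u v w,
            phi t @` (image_of K `&` U) `<=` bent_plane u v w (phi t p) &
            crosses_in u v w (phi t p) (phi t \o strand z1.1) z1.2
                                       (phi t \o strand z2.1) z2.2 \/
            crosses_in u v w (phi t p) (phi t \o strand z2.1) z2.2
                                       (phi t \o strand z1.1) z1.2]].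

Definition axis : set pt := [set p | yco p = 0 /\ zco p = 0].

Definition page (i : 'Z_3) : set pt :=
  if i == 0 then [set p | zco p = 0 /\ 0 <= yco p]
  else if i == 1 then [set p | yco p = 0 /\ 0 <= zco p]
  else [set p | zco p = 0 /\ yco p <= 0].

Definition book : set pt := \bigcup_(i in [set: 'Z_3]) page i.

(* The germ of some arc of K issuing from p is contained in A.  Each preimage of
   p yields two arcs, t |-> t + e and t |-> t - e. *)
Definition arc_from (K : curves) (p : pt) (A : set pt) : Prop :=
  exists2 z, fiber K p z &
    (\forall e \near 0^'+, A (strand z.1 (z.2 + e))) \/
    (\forall e \near 0^'+, A (strand z.1 (z.2 - e))).

Definition arc_left (K : curves) (p : pt) (i : 'Z_3) : Prop :=
  arc_from K p (page i `&` [set q | xco q < xco p]).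

Definition arc_right (K : curves) (p : pt) (i : 'Z_3) : Prop :=
  arc_from K p (page i `&` [set q | xco p < xco q]).

Definition near_pages (K : curves) (p : pt) (i : 'Z_3) : Prop :=
  exists2 U, nbhs p U & image_of K `&` U `<=` page (i - 1) `|` page (i + 1).

(* In the fourth clause the four arcs at the singular point p are distributed
   over four disjoint germs, hence one in each.  In the last clause monotone
   means strictly monotone: on a connected set this is injectivity. *)
Definition three_page_embedded (K : curves) : Prop :=
  [/\ singular_knot K /\ image_of K `<=` book,
      [/\ singular_point K `<=` axis & finite_set (image_of K `&` axis)],
      forall p z, axis p -> ~ singular_point K p -> fiber K p z ->
        exists i k, i <> k /\ passes (strand z.1) z.2 (page i) (page k),
      forall p, singular_point K p -> exists i, near_pages K p i /\
        [/\ arc_left K p (i - 1), arc_right K p (i - 1),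
            arc_left K p (i + 1) & arc_right K p (i + 1)] &
      forall i p, (image_of K `&` page i) p ->
        {in connected_component (image_of K `&` page i) p &, injective xco}].

End Knots.

Inductive letter : Type :=
  LA of 'Z_3 | LB of 'Z_3 | LC of 'Z_3 | LD of 'Z_3 | LX of 'Z_3.

Definition letter_code (l : letter) : 'I_5 * 'Z_3 :=
  match l with
  | LA i => (inord 0, i) | LB i => (inord 1, i) | LC i => (inord 2, i)
  | LD i => (inord 3, i) | LX i => (inord 4, i)
  end.

Definition letter_decode (c : 'I_5 * 'Z_3) : letter :=
  match nat_of_ord c.1 with
  | 0%N => LA c.2 | 1%N => LB c.2 | 2%N => LC c.2 | 3%N => LD c.2 | _ => LX c.2
  end.

Lemma letter_codeK : cancel letter_code letter_decode.
Proof. by case=> i; rewrite /letter_decode /letter_code /= inordK. Qed.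

HB.instance Definition _ := Finite.copy letter (can_type letter_codeK).

Definition word := seq letter.

Definition letter_at (R : realType) (K : curves R) (p : pt R) (l : letter) : Prop :=
  match l with
  | LA i => [/\ ~ singular_point K p, arc_right K p (i - 1) & arc_right K p (i + 1)]
  | LB i => [/\ ~ singular_point K p, arc_left K p (i - 1) & arc_right K p (i + 1)]
  | LC i => [/\ ~ singular_point K p, arc_left K p (i - 1) & arc_left K p (i + 1)]
  | LD i => [/\ ~ singular_point K p, arc_left K p (i + 1) & arc_right K p (i - 1)]
  | LX i => singular_point K p /\ near_pages K p i
  end.

Definition encodes (R : realType) (K : curves R) (w : word) : Prop :=
  exists ps : seq (pt R),
  [/\ sorted (fun p q => xco p < xco q) ps,
      [set` ps] = image_of K `&` @axis R,
      size ps = size w &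
      forall k, (k < size w)%N ->
        letter_at K (nth 0 ps k) (nth (LA 0) w k)].

Definition a_ (i : 'Z_3) : word := [:: LA i].
Definition b_ (i : 'Z_3) : word := [:: LB i].
Definition c_ (i : 'Z_3) : word := [:: LC i].
Definition d_ (i : 'Z_3) : word := [:: LD i].
Definition x_ (i : 'Z_3) : word := [:: LX i].
Definition t_ (i : 'Z_3) : word := b_ (i + 1) ++ d_ (i - 1) ++ d_ (i + 1) ++ b_ (i - 1).

Inductive SK_relation : word -> word -> Prop :=
| SK1a i : SK_relation (a_ i) (a_ (i + 1) ++ d_ (i - 1))
| SK1b i : SK_relation (b_ i) (a_ (i - 1) ++ c_ (i + 1))
| SK1c i : SK_relation (c_ i) (b_ (i - 1) ++ c_ (i + 1))
| SK1d i : SK_relation (d_ i) (a_ (i + 1) ++ c_ (i - 1))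
| SK2 i : SK_relation (x_ i) (d_ (i + 1) ++ x_ (i - 1) ++ b_ (i + 1))
| SK3 : SK_relation (d_ 0 ++ d_ 1 ++ d_ 2) [::]
| SK4l i : SK_relation (b_ i ++ d_ i) [::]
| SK4r i : SK_relation (d_ i ++ b_ i) [::]
| SK5d i : SK_relation (d_ i ++ x_ i ++ d_ i) (a_ i ++ (d_ i ++ x_ i ++ d_ i) ++ c_ i)
| SK5b i : SK_relation (b_ i ++ x_ i ++ b_ i) (a_ i ++ (b_ i ++ x_ i ++ b_ i) ++ c_ i)
| SK6 i : SK_relation (x_ i ++ (d_ (i + 1) ++ d_ i ++ d_ (i - 1)))
                      ((d_ (i + 1) ++ d_ i ++ d_ (i - 1)) ++ x_ i)
| SK7 (i : 'Z_3) (w : word) : w \in [:: c_ (i + 1); x_ (i + 1); b_ i ++ d_ (i + 1) ++ d_ i] ->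
    SK_relation ((d_ i ++ c_ i) ++ w) (w ++ (d_ i ++ c_ i))
| SK8 (i : 'Z_3) (w : word) : w \in [:: a_ (i + 1); b_ (i + 1); c_ (i + 1); x_ (i + 1);
                      b_ i ++ d_ (i + 1) ++ d_ i] ->
    SK_relation ((a_ i ++ b_ i) ++ w) (w ++ (a_ i ++ b_ i))
| SK9 (i : 'Z_3) (w : word) : w \in [:: a_ i; b_ i; c_ i; x_ i; b_ (i - 1) ++ d_ i ++ d_ (i - 1)] ->
    SK_relation (t_ i ++ w) (w ++ t_ i)
| SK10 (i : 'Z_3) (w : word) : w \in [:: a_ (i + 1); b_ (i + 1); c_ (i + 1); x_ (i + 1);
                       b_ i ++ d_ (i + 1) ++ d_ i] ->
    SK_relation ((d_ i ++ x_ i ++ b_ i) ++ w) (w ++ (d_ i ++ x_ i ++ b_ i)).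

Inductive SK_congr : word -> word -> Prop :=
| SK_rel u v : SK_relation u v -> SK_congr u v
| SK_refl u : SK_congr u u
| SK_sym u v : SK_congr u v -> SK_congr v u
| SK_trans u v w : SK_congr u v -> SK_congr v w -> SK_congr u w
| SK_cat u u' v v' : SK_congr u u' -> SK_congr v v' -> SK_congr (u ++ v) (u' ++ v').

Definition SK_eqb : rel word := fun u v => `[< SK_congr u v >].

Lemma SK_eqb_refl : reflexive SK_eqb.
Proof. by move=> u; apply/asboolP; exact: SK_refl. Qed.

Lemma SK_eqb_sym : symmetric SK_eqb.
Proof. by move=> u v; apply/asboolP/asboolP; exact: SK_sym. Qed.

Lemma SK_eqb_trans : transitive SK_eqb.
Proof. by move=> v u w /asboolP uv /asboolP vw; apply/asboolP; exact: SK_trans uv vw. Qed.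

Canonical SK_equiv := EquivRel SK_eqb SK_eqb_refl SK_eqb_sym SK_eqb_trans.

Definition SK := {eq_quot SK_eqb}%qT.
HB.instance Definition _ : EqQuotient _ SK_eqb SK := EqQuotient.on SK.
HB.instance Definition _ := Choice.on SK.

Definition SK_class (w : word) : SK := \pi_SK%qT w.
Definition SK_one : SK := SK_class [::].
Definition SK_mul (g h : SK) : SK := SK_class (repr g ++ repr h).

Lemma SK_classP (u v : word) : SK_class u = SK_class v <-> SK_congr u v.
Proof.
split; first by move/eqP; rewrite /SK_class piE => /asboolP.
by move=> uv; apply/eqP; rewrite /SK_class piE; apply/asboolP.
Qed.

Lemma SK_class_repr (g : SK) : SK_class (repr g) = g.
Proof. exact: reprK. Qed.

Lemma SK_mulE (u v : word) : SK_mul (SK_class u) (SK_class v) = SK_class (u ++ v).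
Proof. by apply/SK_classP/SK_cat; apply/SK_classP; exact: SK_class_repr. Qed.

Lemma SK_mulA : associative SK_mul.
Proof.
move=> g h k; rewrite -(SK_class_repr g) -(SK_class_repr h) -(SK_class_repr k).
by rewrite !SK_mulE catA.
Qed.

Lemma SK_mul1 : left_id SK_one SK_mul.
Proof. by move=> g; rewrite -(SK_class_repr g) SK_mulE. Qed.

Lemma SK_mulr1 : right_id SK_one SK_mul.
Proof. by move=> g; rewrite -(SK_class_repr g) SK_mulE cats0. Qed.

HB.instance Definition _ := isMonoid.Build SK SK_mulA SK_mul1 SK_mulr1.

Definition corresponds (R : realType) (g : SK) (K : curves R) : Prop :=
  exists w : word, SK_class w = g /\
  exists L : curves R, [/\ three_page_embedded L, encodes L w & isotopic L K].

(* Main.v *)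
(* The knot may be taken to be the embedding itself, so that the isotopy plays no
   role: an element has to be central if and only if it is the class of a word
   whose letters, read as opening and closing brackets, are balanced in each of
   the three pages.  Indeed, following the strands of an embedding shows that its
   word is balanced, and a balanced word is drawn with tents of slope 1 over the
   pairs of matching brackets.

   A balanced word is central because a distant line d_i can be slid over it: for
   a prefix leaving p and q lines in two of the pages, d_i is replaced by its
   conjugate [sdelta p q i] by the powers of generators that move these lines to
   the third page.  All the other letters are products of the d_i, their inverses
   and of loops based on a single page, for which similar families exist.

   Conversely, let u be a central word.  Removing a set of strands none of which
   crosses the other strands at a singular point is compatible with the
   relations.  If the word A opens enough lines, then A u = u A in SK; colour red
   the strands of A on the right-hand side and transport the colouring to the
   left-hand side.  Removing the red strands leaves u on the right, and on the
   left a word that closes no line coming from the left.  The mirror argument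
   takes care of the lines leaving to the right. *)
Require Import Defs.
From HB Require Import structures.
From mathcomp Require Import all_boot all_order all_algebra.
From mathcomp Require Import all_classical all_reals all_analysis.
From mathcomp Require Import zify ring lra.
Set Implicit Arguments.
Unset Strict Implicit.
Unset Printing Implicit Defensive.
Import Order.TTheory GRing.Theory Num.Theory.
Import numFieldTopology.Exports numFieldNormedType.Exports.
Local Open Scope classical_set_scope.
Local Open Scope ring_scope.

(** * Balanced words are central *)

(** Finitely many relations have to control arbitrarily many lines. For sliding, commutation with
    [sd i] and with [sf 1 i], which the relations provide, propagates to the conjugates by all
    powers through the twists [st i]; the hinge is that a twist can be conjugated in two ways with
    the same result ([twist_conjP]). For colourings, a relation reaches only boundedly many
    innermost lines, so transport becomes a finite computation. Deleting strands of a relation may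
    leave a commutation with a letter [d] that is not a defining relation but was derived for the
    sliding argument.

    In the drawing of a balanced word the letters sit at consecutive integers, so nested tents
    differ in height by at least 1. This gap keeps arcs disjoint, isolates the singular points and
    gives monotonicity on connected components. The closed curves are the orbits of the composite of
    two involutions on germs, passage to the other end of an arc and continuation of a strand
    through a point. Each curve gives two orbits, one per direction, and one of them has to be
    selected. *)

Lemma Z3_add11 (i : 'Z_3) : i + 1 + 1 = i - 1.
Proof. by apply/eqP; case: i => -[|[|[|//]]] ?; vm_compute. Qed.

Lemma Z3_sub11 (i : 'Z_3) : i - 1 - 1 = i + 1.
Proof. by apply/eqP; case: i => -[|[|[|//]]] ?; vm_compute. Qed.

Definition Z3E := (Z3_add11, Z3_sub11, addrK, subrK).

Lemma Z3_cases (i j : 'Z_3) : [\/ j = i, j = i + 1 | j = i - 1].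
Proof.
have /or3P[/eqP ->|/eqP ->|/eqP ->] : [|| j == i, j == i + 1 | j == i - 1];
  [|by constructor 1|by constructor 2|by constructor 3].
by case: i j => -[|[|[|//]]] ? [[|[|[|//]]] ?]; vm_compute.
Qed.

Lemma Z3_neq (i : 'Z_3) : ((i + 1 == i) = false) * ((i - 1 == i) = false) *
  ((i == i + 1) = false) * ((i == i - 1) = false) *
  ((i + 1 == i - 1) = false) * ((i - 1 == i + 1) = false).
Proof. by case: i => -[|[|[|//]]] ?; vm_compute. Qed.

Section Central.
Local Open Scope group_scope.
Local Notation "i ⊕1" := (i + 1)%R (at level 1, format "i ⊕1").
Local Notation "i ⊖1" := (i - 1)%R (at level 1, format "i ⊖1").

Lemma SK_classM u v : SK_class (u ++ v) = SK_class u * SK_class v.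
Proof. by rewrite -SK_mulE. Qed.

Lemma SK_relE u v : SK_relation u v -> SK_class u = SK_class v.
Proof. by move=> uv; apply/SK_classP/SK_rel. Qed.

Definition sa i : SK := SK_class (a_ i).
Definition sb i : SK := SK_class (b_ i).
Definition sc i : SK := SK_class (c_ i).
Definition sd i : SK := SK_class (d_ i).
Definition sx i : SK := SK_class (x_ i).

Lemma sbdK i : sb i * sd i = 1.
Proof. by rewrite -SK_classM; exact/SK_relE/SK4l. Qed.

Lemma sdbK i : sd i * sb i = 1.
Proof. by rewrite -SK_classM; exact/SK_relE/SK4r. Qed.

Lemma sbdKl i g : sb i * (sd i * g) = g.
Proof. by rewrite mulgA sbdK mul1g. Qed.

Lemma sdbKl i g : sd i * (sb i * g) = g.
Proof. by rewrite mulgA sdbK mul1g. Qed.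

Lemma sdX_sbX i n : sd i ^+ n * sb i ^+ n = 1.
Proof. elim: n => [|n IH]; [exact: mulg1|by rewrite expgSr expgS -mulgA sdbKl]. Qed.

Lemma sbX_sdX i n : sb i ^+ n * sd i ^+ n = 1.
Proof. elim: n => [|n IH]; [exact: mulg1|by rewrite expgSr expgS -mulgA sbdKl]. Qed.

(** [SK3] gives one cyclic order only; the rotated products follow because every [sd i] is
    invertible with inverse [sb i]. *)
Lemma sddE i : sd i⊕1 * sd i⊖1 = sb i.
Proof.
have d3 : sd 0%R * sd 1%R * sd (1 + 1)%R = 1.
  have -> : (1 + 1 : 'Z_3)%R = 2%:R by exact: val_inj.
  by have := SK_relE SK3; rewrite !SK_classM mulgA.
have d12 : sd 1%R * sd (1 + 1)%R = sb 0%R.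
  by rewrite -[LHS]mul1g -(sbdK 0%R) -mulgA (mulgA (sd 0%R)) d3 mulg1.
have d20 : sd (1 + 1)%R * sd 0%R = sb 1%R.
  rewrite -[LHS]mul1g -(sbdK 1%R) -mulgA (mulgA (sd 1%R)) d12.
  by rewrite sbdK mulg1.
have d01 : sd 0%R * sd 1%R = sb (1 + 1)%R.
  by rewrite -[LHS]mulg1 -(sdbK (1 + 1)%R) mulgA d3 mul1g.
case: (Z3_cases 0%R i) => ->; rewrite ?Z3E ?add0r.
- by rewrite -d12; congr (_ * sd _); exact: val_inj.
- by rewrite -d20; congr (sd _ * sd _); exact: val_inj.
- have -> : (-1 : 'Z_3) = 1 + 1 by exact: val_inj.
  by rewrite -d01; congr (sd _ * sd _); exact: val_inj.
Qed.

Lemma sddE' i : sd i⊖1 * sd i = sb i⊕1.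
Proof. by rewrite -sddE !Z3E. Qed.

Lemma sddE'' i : sd i * sd i⊕1 = sb i⊖1.
Proof. by rewrite -[in RHS]sddE !Z3E. Qed.

Lemma commute_sb y i : commute y (sd i) -> commute y (sb i).
Proof.
move=> yd; rewrite /commute -[LHS]mul1g -(sbdK i) -(mulgA (sb i)) (mulgA (sd i)).
by rewrite -yd -!mulgA sdbK mulg1.
Qed.

Lemma commute_conj i n y z :
  commute y (sb i ^+ n * z * sd i ^+ n) -> commute (sd i ^+ n * y * sb i ^+ n) z.
Proof.
move=> c; rewrite /commute -[RHS]mul1g -(sdX_sbX i n).
have -> : sd i ^+ n * sb i ^+ n * (z * (sd i ^+ n * y * sb i ^+ n)) =
  sd i ^+ n * ((sb i ^+ n * z * sd i ^+ n) * y) * sb i ^+ n by rewrite !mulgA.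
by rewrite -c -!mulgA sdX_sbX mulg1.
Qed.

(** * Twists and the conjugates of [sd i] *)

Definition st i := sb i⊕1 * sd i⊖1 * sd i⊕1 * sb i⊖1.
(** [st i] is the group commutator of [sb (i + 1)] and [sd (i - 1)], and [sf 1 i] is the
    three-letter word of the commutation relations, of which [sf p i] is the version for [p]
    lines. *)
Definition sf p i := sb i⊖1 ^+ p * sd i * sd i⊖1 ^+ p.

Lemma sf1E i : sf 1 i = st i⊕1 * sd i.
Proof. by rewrite /sf /st !expg1 !Z3E -!mulgA sbdK mulg1. Qed.

Lemma sf1_conj i : sb i * sf 1 i * sd i = sd i * st i⊖1.
Proof.
rewrite /st /sf !expg1 !Z3E -!mulgA sdbKl sddE' -{1}sddE.
by rewrite -!mulgA sdbKl.
Qed.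

(** Both sides clear [j] lines out of page [i], the left one to page [i + 1], the right one to page
    [i - 1]. *)
Definition twist_conj j := forall i,
  sd i⊖1 ^+ j * st i * sb i⊖1 ^+ j = sb i⊕1 ^+ j * st i * sd i⊕1 ^+ j.

Lemma sfS p i : twist_conj p ->
  sf p.+1 i = sd i ^+ p * st i⊕1 * sb i ^+ p * sf p i.
Proof.
move=> /(_ i⊕1); rewrite !Z3E => ->.
have -> : sf p.+1 i = sb i⊖1 ^+ p * sf 1 i * sd i⊖1 ^+ p.
  by rewrite /sf !expg1 expgSr expgS !mulgA.
rewrite sf1E /sf; set B := sb _ ^+ p; set E := sd _ ^+ p.
have EB : E * B = 1 by exact: sdX_sbX.
by rewrite -!mulgA (mulgA E B) EB mul1g.
Qed.

Lemma commute_sbX y i n : commute y (sd i) -> commute y (sb i ^+ n).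
Proof. by move=> yd; exact/commuteX/commute_sb. Qed.

Lemma commute_st y i :
  commute y (sd i) -> commute y (sf 1 i) -> commute y (st i⊕1).
Proof.
move=> yd yf; have -> : st i⊕1 = sf 1 i * sb i by rewrite sf1E -mulgA sdbK mulg1.
by apply: commuteM => //; exact: commute_sb.
Qed.

(** By [sfS], passing from [sf p i] to [sf p.+1 i] multiplies by a conjugate of [st (i + 1)] by
    powers of [sd i], and [st (i + 1)] is [sf 1 i * sb i]. Two commutations thus imply infinitely
    many. *)
Lemma commute_sf y i p : (forall j, (j < p)%N -> twist_conj j) ->
  commute y (sd i) -> commute y (sf 1 i) -> commute y (sf p i).
Proof.
move=> tc yd yf; elim: p tc => [|p IH] tc; first by rewrite /sf mul1g mulg1.
rewrite sfS; last exact: tc.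
apply: commuteM; last by apply: IH => j jp; exact/tc/ltnW.
by do 2?apply: commuteM; [exact: commuteX|exact: commute_st|exact: commute_sbX].
Qed.

Lemma SK9E i w : w \in [:: a_ i; b_ i; c_ i; x_ i; b_ i⊖1 ++ d_ i ++ d_ i⊖1] ->
  commute (st i) (SK_class w).
Proof. by move=> /SK9 /SK_relE; rewrite /commute /st /t_ !SK_classM !mulgA. Qed.

Lemma commute_st_sd i : commute (st i) (sd i).
Proof.
have tb : commute (st i) (sb i) by apply: SK9E; rewrite !inE eqxx ?orbT.
rewrite /commute -[RHS]mulg1 -(sbdK i) -(mulgA (sd i)) (mulgA (st i)).
by rewrite tb -!mulgA sdbKl.
Qed.

Lemma commute_st_sf1 i : commute (st i) (sf 1 i).
Proof.
have := @SK9E i (b_ i⊖1 ++ d_ i ++ d_ i⊖1).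
by rewrite !SK_classM mulgA /sf !expg1; apply; rewrite !inE eqxx !orbT.
Qed.

(** Since [sd (i - 1)] is [sb (i + 1) * sb i], the two sides at [j.+1] differ by a conjugation by
    [sb i]. It acts trivially on the twist already conjugated [j] times as soon as [st i] commutes
    with [sf j i], which in turn rests on [twist_conj] below [j]; hence the joint induction. *)
Lemma twist_conjP j : twist_conj j.
Proof.
suff: twist_conj j /\ forall i, commute (st i) (sf j i) by case.
elim/ltn_ind: j => -[|j] IH.
  by split=> i; rewrite ?/sf ?mul1g ?mulg1 //; exact: commute_st_sd.
have tc k : (k < j.+1)%N -> twist_conj k by case/IH.
split=> i; last first.
  by apply: commute_sf => //; [exact: commute_st_sd|exact: commute_st_sf1].
have [tj /(_ i) ctf] := IH j (ltnSn j).
have cw : commute (sd i⊖1 ^+ j * st i * sb i⊖1 ^+ j) (sb i).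
  by apply/commute_sb/commute_conj.
rewrite expgS expgSr; set w := (X in commute X _) in cw.
have -> : sd i⊖1 * sd i⊖1 ^+ j * st i * (sb i⊖1 ^+ j * sb i⊖1) =
  sd i⊖1 * w * sb i⊖1 by rewrite /w !mulgA.
rewrite (expgS (sb _)) (expgSr (sd _)).
have -> : sb i⊕1 * sb i⊕1 ^+ j * st i * (sd i⊕1 ^+ j * sd i⊕1) =
  sb i⊕1 * w * sd i⊕1 by rewrite /w tj !mulgA.
have e1 : sd i⊖1 = sb i⊕1 * sb i by rewrite -(sddE i) sbdKl.
clearbody w; rewrite {1}e1 -!mulgA (mulgA (sb i)) -cw -!mulgA -[sb i]sddE.
by rewrite -!mulgA sdbK mulg1.
Qed.

(** The powers carry [p] lines of page [i + 1] and [q] lines of page [i - 1] to page [i], out of the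
    way of [sd i], which uses only the other two pages. *)
Definition sdelta p q i :=
  sb i⊖1 ^+ p * sd i⊕1 ^+ q * sd i * sb i⊕1 ^+ q * sd i⊖1 ^+ p.

(* The factor by which [sdelta] changes is a twist of two lines of one page. *)
Lemma sdeltaS p q i :
  sdelta p q.+1 i = sdelta p q i * (sb i ^+ q * st i⊖1 * sd i ^+ q).
Proof.
have tq := twist_conjP q i⊖1; rewrite !Z3E in tq.
have cq : commute (sb i ^+ q * st i⊖1 * sd i ^+ q) (sd i⊖1).
  rewrite -tq; apply: commute_conj.
  have := @commute_sf (st i⊖1) i⊖1 q (fun j _ => twist_conjP j)
    (commute_st_sd _) (commute_st_sf1 _).
  by rewrite /sf Z3E.
set y := _ * sd i ^+ q in cq tq *.
have cqp : y * sd i⊖1 ^+ p = sd i⊖1 ^+ p * y by exact: commuteX.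
have -> : sdelta p q i * y =
    sb i⊖1 ^+ p * sd i⊕1 ^+ q * sd i * sb i⊕1 ^+ q * y * sd i⊖1 ^+ p.
  by clearbody y; rewrite /sdelta -!mulgA -cqp.
rewrite -tq /sdelta (expgSr (sd _)) (expgS (sb _)) -!mulgA.
rewrite (mulgA (sb i⊕1 ^+ q) (sd i⊕1 ^+ q)) sbX_sdX mul1g.
by rewrite !Z3E sdbKl.
Qed.

(** The new factor in [sdeltaS] is a conjugate of [st (i - 1)] by powers of [sb i], and [sf1_conj]
    expresses [st (i - 1)] through [sf 1 i], [sb i] and [sd i]. The hypotheses of [commute_sf]
    therefore cover both parameters. *)
Lemma commute_sdelta y i p q :
  commute y (sd i) -> commute y (sf 1 i) -> commute y (sdelta p q i).
Proof.
move=> yd yf; elim: q => [|q IH].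
  have -> : sdelta p 0 i = sf p i by rewrite /sdelta /sf !expg0 !mulg1.
  by apply: commute_sf => // j _; exact: twist_conjP.
rewrite sdeltaS; apply: commuteM => //.
do 2?apply: commuteM; [exact: commute_sbX| |exact: commuteX].
have -> : st i⊖1 = sb i * (sb i * sf 1 i * sd i).
  by rewrite sf1_conj sbdKl.
do 3?apply: commuteM => //; exact: commute_sb.
Qed.

(** Without lines counted by [p] an adjacent inverse pair cancels. Each such line makes [sd (i + 1)]
    pass [sb (i - 1)] at the cost of a twist [st i], which commutes with [sdelta p q i] and is
    absorbed on the other side. *)
Lemma sdelta_move p q i : sdelta p q.+1 i * sd i⊕1 = sd i⊕1 * sdelta p q i.
Proof.
elim: p => [|p IH].
  by rewrite /sdelta !expg0 !mul1g !mulg1 expgS (expgSr (sb _)) -!mulgA sbdK mulg1.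
have dS q' : sdelta p.+1 q' i = sb i⊖1 * sdelta p q' i * sd i⊖1.
  by rewrite /sdelta expgS (expgSr (sd _)) !mulgA.
have ct : commute (st i) (sdelta p q i).
  by apply: commute_sdelta; [exact: commute_st_sd|exact: commute_st_sf1].
have tE : sd i⊕1 * sb i⊖1 = sb i⊖1 * sd i⊕1 * st i.
  by rewrite /st -!mulgA !sdbKl sbdKl.
have tE' : sd i⊖1 * sd i⊕1 = sd i⊕1 * st i * sd i⊖1.
  by rewrite /st -!mulgA sdbKl sbdK mulg1.
rewrite !dS.
move: (st i) (sdelta p q.+1 i) (sdelta p q i) tE tE' IH ct => t y' y tE tE' IH ct.
rewrite -mulgA tE' !mulgA tE -(mulgA _ t y) ct.
by rewrite -(mulgA _ y') IH !mulgA.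
Qed.

(** * Loops with all ends in one page *)

Lemma SK1aE i : sa i = sa i⊕1 * sd i⊖1.
Proof. by rewrite -SK_classM; exact/SK_relE/SK1a. Qed.

Lemma SK1cE i : sc i = sb i⊖1 * sc i⊕1.
Proof. by rewrite -SK_classM; exact/SK_relE/SK1c. Qed.

Lemma SK2E i : sx i = sd i⊕1 * sx i⊖1 * sb i⊕1.
Proof. by have := SK_relE (SK2 i); rewrite !SK_classM mulgA. Qed.

(** An opening, a closing and a crossing of two lines; all outer ends lie in page [i + 1], and one
    line makes a detour through page [i - 1]. *)
Definition loops i : seq SK :=
  [:: sa i * sb i; sd i * sc i; sd i * sx i * sb i].

Lemma sbbE i : sb i⊕1 * sb i = sd i⊖1.
Proof. by rewrite -[sb i]sddE sbdKl. Qed.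

(** The same loops with the detour through page [i]; this form uses letters of index [i - 1], to
    which the relations for [st (i - 1)] and for [loops (i + 1)] apply. *)
Lemma loopsE i : loops i = [:: sa i⊖1 * sd i⊖1; sb i⊖1 * sc i⊖1;
  sb i⊖1 * sx i⊖1 * sd i⊖1].
Proof.
rewrite /loops; congr [:: _; _; _].
- by rewrite [sa i⊖1]SK1aE !Z3E -sbbE -!mulgA sdbKl.
- by rewrite -[sb i⊖1]sddE'' [sc i⊖1]SK1cE !Z3E -!mulgA sdbKl.
- by rewrite [sx i]SK2E -sddE'' -sbbE -!mulgA.
Qed.

Lemma SK7E i w : w \in [:: c_ i⊕1; x_ i⊕1; b_ i ++ d_ i⊕1 ++ d_ i] ->
  commute (sd i * sc i) (SK_class w).
Proof. by move=> /SK7 /SK_relE; rewrite /commute !SK_classM. Qed.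

Lemma SK8E i w : w \in [:: a_ i⊕1; b_ i⊕1; c_ i⊕1; x_ i⊕1;
    b_ i ++ d_ i⊕1 ++ d_ i] ->
  commute (sa i * sb i) (SK_class w).
Proof. by move=> /SK8 /SK_relE; rewrite /commute !SK_classM. Qed.

Lemma SK10E i w : w \in [:: a_ i⊕1; b_ i⊕1; c_ i⊕1; x_ i⊕1;
    b_ i ++ d_ i⊕1 ++ d_ i] ->
  commute (sd i * sx i * sb i) (SK_class w).
Proof. by move=> /SK10 /SK_relE; rewrite /commute !SK_classM !mulgA. Qed.

Lemma commute_sd y i : commute y (sb i) -> commute y (sd i).
Proof.
move=> yb; rewrite /commute -[RHS]mulg1 -(sbdK i) -(mulgA (sd i)) (mulgA y).
by rewrite yb -!mulgA sdbKl.
Qed.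

Lemma loops_sf1 i z : z \in loops i -> commute z (sf 1 i⊕1).
Proof.
have -> : sf 1 i⊕1 = SK_class (b_ i ++ d_ i⊕1 ++ d_ i).
  by rewrite /sf !expg1 !Z3E !SK_classM mulgA.
rewrite !inE => /or3P[] /eqP ->; [apply: SK8E|apply: SK7E|apply: SK10E];
  by rewrite !inE eqxx ?orbT.
Qed.

(** For two of the loops this is a relation. For [sd i * sc i] the relations provide only
    [sf 1 (i + 1)]; but [sd i * sc i] is also [sb (i - 1) * sc (i - 1)], hence commutes with
    [st (i - 1)], which is [sf 1 (i + 1) * sb (i + 1)]. Cancelling the left-invertible factor
    [sf 1 (i + 1)] leaves [sb (i + 1)]. *)
Lemma loops_sd i z : z \in loops i -> commute z (sd i⊕1).
Proof.
move=> zi; have := loops_sf1 zi; move: zi.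
rewrite !inE => /or3P[] /eqP -> zf; apply: commute_sd.
- by apply: SK8E; rewrite !inE eqxx ?orbT.
- have dcE : sd i * sc i = sb i⊖1 * sc i⊖1.
    by have := loopsE i; rewrite /loops => -[].
  have zt : commute (sd i * sc i) (st i⊖1).
    apply: commute_sym; rewrite dcE; apply: commuteM.
      by apply: SK9E; rewrite !inE eqxx ?orbT.
    by apply: SK9E; rewrite !inE eqxx ?orbT.
  have tE : st i⊖1 = sf 1 i⊕1 * sb i⊕1 by rewrite /st /sf !expg1 !Z3E.
  have : sb i * sb i⊕1 * sd i * sf 1 i⊕1 = 1.
    by rewrite /sf !expg1 !Z3E -!mulgA sdbKl sbdKl sbdK.
  move: (sb i⊕1) (sb i * sb i⊕1 * sd i) (sf 1 i⊕1) (sd i * sc i) (st i⊖1) zf zt tE.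
  move=> b k f y t yf yt tE kf; rewrite tE in yt *.
  rewrite /commute -[LHS]mul1g -kf -(mulgA k) (mulgA f) -yf -(mulgA y) yt.
  by rewrite -(mulgA f) (mulgA k) kf mul1g.
- by apply: SK10E; rewrite !inE eqxx ?orbT.
Qed.

(** [loopsE] writes the loops of index [i] in letters of index [i - 1], on which the relations at
    [i + 1] act. The relation for [sd * sc] does not list the letter [a]; that case exchanges the
    roles and uses the commutations of [sa i * sb i] with [sd (i + 1)] and [sc (i + 1)]. *)
Lemma loops_comm i z y : z \in loops i⊕1 -> y \in loops i -> commute z y.
Proof.
move=> zi; have := loops_sd zi; rewrite Z3_add11 => zd.
have zb := commute_sb zd.
have zc : commute z (sc i⊖1).
  move: zi; rewrite !inE -Z3_add11 => /or3P[] /eqP zE; rewrite zE;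
  [apply: SK8E|apply: SK7E|apply: SK10E]; by rewrite !inE eqxx ?orbT.
have zx : commute z (sx i⊖1).
  move: zi; rewrite !inE -Z3_add11 => /or3P[] /eqP zE; rewrite zE;
  [apply: SK8E|apply: SK7E|apply: SK10E]; by rewrite !inE eqxx ?orbT.
have zA : commute z (sa i * sb i).
  have AE : sa i * sb i = sa i⊖1 * sd i⊖1.
    by have := loopsE i; rewrite /loops => -[].
  move: zi; rewrite !inE => /or3P[] /eqP zE.
  - rewrite AE; apply: commuteM => //; rewrite zE -Z3_add11; apply: SK8E.
    by rewrite !inE eqxx ?orbT.
  - rewrite zE; apply/commute_sym/commuteM; first by apply: loops_sd; rewrite inE eqxx.
    by apply: SK8E; rewrite !inE eqxx ?orbT.
  - rewrite AE; apply: commuteM => //; rewrite zE -Z3_add11; apply: SK10E.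
    by rewrite !inE eqxx ?orbT.
rewrite inE => /orP[/eqP -> //|yi].
have : y \in loops i by rewrite inE yi orbT.
rewrite loopsE inE => /orP[/eqP yE|].
  by move: zA; have := loopsE i; rewrite /loops => -[-> _ _]; rewrite yE.
by rewrite !inE => /orP[] /eqP ->; do 2?apply: commuteM.
Qed.

(* Any family indexed by the numbers of lines in two pages extends from the
   letters [d] to all letters, the others being products of loops in the third
   page and letters [b], [d]. *)
Section Family.
Variables (j : 'Z_3) (G : nat -> nat -> SK).
Hypothesis Gj : forall q p, G q p * sd j = sd j * G q p.+1.
Hypothesis Gj1 : forall q p, G q.+1 p * sd j⊖1 = sd j⊖1 * G q p.
Hypothesis Gloop : forall q p z, z \in loops j -> commute (G q p) z.

Definition shifts y q p q' p' := G q p * y = y * G q' p'.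

Lemma shiftsM y z q p q' p' q'' p'' : shifts y q p q' p' ->
  shifts z q' p' q'' p'' -> shifts (y * z) q p q'' p''.
Proof. by rewrite /shifts => yG zG; rewrite mulgA yG -mulgA zG mulgA. Qed.

Lemma shifts_sb i q p q' p' :
  shifts (sd i) q p q' p' -> shifts (sb i) q' p' q p.
Proof.
rewrite /shifts => dG; rewrite -[LHS]mul1g -(sbdK i) -(mulgA (sb i)) (mulgA (sd i)).
by rewrite -dG -!mulgA sdbK mulg1.
Qed.

Lemma shifts_bj q p : shifts (sb j) q p.+1 q p.
Proof. exact/shifts_sb/Gj. Qed.

Lemma shifts_bj1 q p : shifts (sb j⊖1) q p q.+1 p.
Proof. exact/shifts_sb/Gj1. Qed.

Lemma shifts_dj2 q p : shifts (sd j⊕1) q p.+1 q.+1 p.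
Proof.
by rewrite -Z3_sub11 -sbbE subrK; apply: shiftsM (shifts_bj _ _) (shifts_bj1 _ _).
Qed.

Lemma shifts_bj2 q p : shifts (sb j⊕1) q.+1 p q p.+1.
Proof. exact/shifts_sb/shifts_dj2. Qed.

Lemma shifts_aj q p : shifts (sa j) q p q p.+1.
Proof.
have -> : sa j = sa j * sb j * sd j by rewrite -mulgA sbdK mulg1.
by apply: shiftsM (Gj _ _); apply: Gloop; rewrite inE eqxx.
Qed.

Lemma shifts_aj1 q p : shifts (sa j⊖1) q p q.+1 p.
Proof.
by rewrite SK1aE !Z3E; apply: shiftsM (shifts_aj _ _) (shifts_dj2 _ _).
Qed.

Lemma shifts_aj2 q p : shifts (sa j⊕1) q p q.+1 p.+1.
Proof.
have -> : sa j⊕1 = sa j * sb j⊖1 by rewrite [sa j]SK1aE -mulgA sdbK mulg1.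
exact: shiftsM (shifts_aj _ _) (shifts_bj1 _ _).
Qed.

Lemma shifts_cj q p : shifts (sc j) q p.+1 q p.
Proof.
have -> : sc j = sb j * (sd j * sc j) by rewrite sbdKl.
by apply: shiftsM (shifts_bj _ _) _; apply: Gloop; rewrite !inE eqxx orbT.
Qed.

Lemma shifts_cj1 q p : shifts (sc j⊖1) q.+1 p q p.
Proof.
by rewrite SK1cE !Z3E; apply: shiftsM (shifts_bj2 _ _) (shifts_cj _ _).
Qed.

Lemma shifts_cj2 q p : shifts (sc j⊕1) q.+1 p.+1 q p.
Proof.
have -> : sc j⊕1 = sd j⊖1 * sc j by rewrite [sc j]SK1cE sdbKl.
exact: shiftsM (Gj1 _ _) (shifts_cj _ _).
Qed.

Lemma shifts_xj q p : shifts (sx j) q p.+1 q p.+1.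
Proof.
have -> : sx j = sb j * (sd j * sx j * sb j) * sd j.
  by rewrite -!mulgA sbdKl sbdK mulg1.
apply: shiftsM (Gj _ _); apply: shiftsM (shifts_bj _ _) _.
by apply: Gloop; rewrite !inE eqxx !orbT.
Qed.

Lemma shifts_xj2 q p : shifts (sx j⊕1) q.+1 p.+1 q.+1 p.+1.
Proof.
rewrite SK2E !Z3E; apply: shiftsM (shifts_bj1 _ _).
exact: shiftsM (Gj1 _ _) (shifts_xj _ _).
Qed.

Lemma shifts_xj1 q p : shifts (sx j⊖1) q.+1 p q.+1 p.
Proof.
have -> : sx j⊖1 = sb j⊕1 * sx j * sd j⊕1.
  by rewrite [sx j]SK2E -!mulgA sbdKl sbdK mulg1.
apply: shiftsM (shifts_dj2 _ _).
exact: shiftsM (shifts_bj2 _ _) (shifts_xj _ _).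
Qed.

End Family.

(** The analogue of [sdelta]: [q] lines are carried out of page [i + 1], where the ends of the loop
    lie. A line added in page [i] does not change it, by [loop_conj_sd]. *)
Definition loop_conj i z q := sd i ^+ q * z * sb i ^+ q.

Lemma loop_conj_sd i z q : z \in loops i -> commute (loop_conj i z q) (sd i⊕1).
Proof.
move=> zi; apply: commute_conj.
have := @commute_sf z i⊕1 q (fun k _ => twist_conjP k) (loops_sd zi) (loops_sf1 zi).
by rewrite /sf !Z3E.
Qed.

(** As [sd i * sd (i + 1)] is [sb (i - 1)] and the conjugated loop commutes with [sd (i + 1)],
    conjugation by [sd i] may be replaced by conjugation by [sb (i - 1)], and [y] commutes with
    everything in the new expression. *)
Lemma loop_conj_loops i z y q :
  z \in loops i -> y \in loops i⊕1 -> commute (loop_conj i z q) y.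
Proof.
move=> zi yi; have -> : loop_conj i z q = sb i⊖1 ^+ q * z * sd i⊖1 ^+ q.
  elim: q => [|q IH]; first by rewrite /loop_conj !mul1g !mulg1.
  have -> : loop_conj i z q.+1 = sd i * loop_conj i z q * sb i.
    by rewrite /loop_conj expgS expgSr !mulgA.
  have -> : sb i⊖1 ^+ q.+1 * z * sd i⊖1 ^+ q.+1 = sb i⊖1 * loop_conj i z q * sd i⊖1.
    by rewrite IH expgS expgSr !mulgA.
  have := loop_conj_sd q zi; rewrite -sddE'' -[sd i⊖1]sbbE.
  by move: (loop_conj _ _ _) => c cd; rewrite -!mulgA (mulgA (sd i⊕1)) -cd -!mulgA sdbKl.
have yd := loops_sd yi; rewrite Z3_add11 in yd.
have yz := loops_comm yi zi.
apply: commute_sym; do 2?apply: commuteM => //; last exact: commuteX.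
exact: commute_sbX.
Qed.

End Central.

Definition closes (l : letter) (i : 'Z_3) : bool :=
  match l with
  | LA _ => false | LB k => i == k - 1 | LD k => i == k + 1
  | LC k | LX k => (i == k - 1) || (i == k + 1)
  end.

Definition opens (l : letter) (i : 'Z_3) : bool :=
  match l with
  | LC _ => false | LB k => i == k + 1 | LD k => i == k - 1
  | LA k | LX k => (i == k - 1) || (i == k + 1)
  end.

Definition lines := 'Z_3 -> nat.

Definition lines_after (l : letter) (n : lines) : lines :=
  fun i => (n i - closes l i + opens l i)%N.

(* [opens] and [closes] are the brackets written by a letter in each page; a run
   from [no_lines] to [no_lines] means that w is balanced in every page. *)
Fixpoint run (w : word) (n n' : lines) : Prop :=
  if w is l :: w' then (forall i, closes l i <= n i)%N /\ run w' (lines_after l n) n'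
  else n = n'.

Section Balanced.
Local Open Scope group_scope.

Lemma run_shifts j G (Gj : forall q p, G q p * sd j = sd j * G q p.+1)
  (Gj1 : forall q p, G q.+1 p * sd (j - 1)%R = sd (j - 1)%R * G q p)
  (Gloop : forall q p z, z \in loops j -> commute (G q p) z) w n n' :
  run w n n' ->
  shifts G (SK_class w) (n j) (n (j - 1)%R) (n' j) (n' (j - 1)%R).
Proof.
elim: w n => [|l w IH] n /= => [->|[cl rw]].
  by rewrite /shifts mulg1 mul1g.
rewrite -cat1s SK_classM; apply: shiftsM (IH _ rw) => {w IH rw}.
have := cl j; have := cl (j - 1)%R; rewrite /lines_after.
move: (n j) (n (j - 1)%R) => q p {n cl}.
case: l => k; case: (Z3_cases j k) => -> /=; rewrite ?Z3E ?Z3_neq ?eqxx /=;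
case: p => [|p] //= _; case: q => [|q] //= _; rewrite ?addn0 ?subn0 ?subn1 ?addn1 /=;
eauto using shifts_bj, shifts_bj1, shifts_bj2, shifts_dj2, shifts_aj, shifts_aj1,
 shifts_aj2, shifts_cj, shifts_cj1, shifts_cj2, shifts_xj, shifts_xj1, shifts_xj2;
first [exact: Gj|exact: Gj1].
Qed.

Definition no_lines : lines := fun=> 0%N.

Lemma run_sd w i : run w no_lines no_lines -> commute (SK_class w) (sd i).
Proof.
(* The family is based at [i - 1]: [q] counts the lines of page [i - 1], [p] those of page [i + 1],
   and the uncounted page is [i]. *)
pose G q p := sdelta p q i.
move=> /(@run_shifts (i - 1)%R G) => rG; apply: commute_sym.
have : shifts G (SK_class w) 0 0 0 0.
  apply: rG => [q p|q p|q p z zi].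
  - rewrite /G /sdelta (expgS (sb _)) (expgSr (sd (i - 1)%R)) -!mulgA.
    by rewrite sdbKl.
  - by rewrite Z3_sub11; exact: sdelta_move.
  - have := loops_sd zi; have := loops_sf1 zi; rewrite subrK => zf zd.
    exact/commute_sym/commute_sdelta.
by rewrite /shifts /G /sdelta !expg0 !mul1g !mulg1.
Qed.

Lemma run_loops w i z : run w no_lines no_lines -> z \in loops i ->
  commute (SK_class w) z.
Proof.
pose G q (p : nat) := loop_conj i z q.
move=> /(@run_shifts (i + 1)%R G) => rG zi; apply: commute_sym.
have : shifts G (SK_class w) 0 0 0 0.
  apply: rG => [q p|q p|q p y yi]; rewrite /G.
  - exact: loop_conj_sd.
  - by rewrite addrK /loop_conj expgS (expgSr (sb _)) -!mulgA sbdK mulg1.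
  - exact: loop_conj_loops.
by rewrite /shifts /G /loop_conj !expg0 !mul1g !mulg1.
Qed.

Lemma run_central w : run w no_lines no_lines ->
  forall h : SK, SK_class w * h = h * SK_class w.
Proof.
move=> rw h; rewrite -(SK_class_repr h).
elim: (repr h) => [|l v IH]; first by rewrite mulg1 mul1g.
rewrite -cat1s SK_classM; apply: commuteM IH.
have cd i := run_sd i rw; have cb i := commute_sb (cd i).
have cl i z := @run_loops w i z rw.
case: l => k.
- have -> : SK_class [:: LA k] = sa k * sb k * sd k by rewrite -mulgA sbdK mulg1.
  by apply: commuteM (cd k); apply: (cl k); rewrite inE eqxx.
- exact: cb.
- have -> : SK_class [:: LC k] = sb k * (sd k * sc k) by rewrite sbdKl.
  by apply: commuteM (cb k) _; apply: (cl k); rewrite !inE eqxx orbT.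
- exact: cd.
- have -> : SK_class [:: LX k] = sb k * (sd k * sx k * sb k) * sd k.
    by rewrite -!mulgA sbdKl sbdK mulg1.
  apply: commuteM (cd k); apply: commuteM (cb k) _.
  by apply: (cl k); rewrite !inE eqxx !orbT.
Qed.

End Balanced.

(** * Deletion of coloured strands and its compatibility with the relations *)

(** * Removing strands *)

Definition inverse_letters (l m : letter) : bool :=
  match l, m with
  | LB i, LD j | LD i, LB j => i == j
  | _, _ => false
  end.

Definition cancel_cons (l : letter) (w : word) : word :=
  if w is m :: w' then if inverse_letters l m then w' else l :: w else [:: l].

(** Deleting strands leaves inverse pairs of letters [b], [d] side by side; cancelling them makes
    the remaining words comparable with the relations. *)
Definition reduce : word -> word := foldr cancel_cons [::].

Lemma SK_congr_reduce w : SK_congr w (reduce w).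
Proof.
elim: w => [|l w IH] /=; first exact: SK_refl.
have lw : SK_congr (l :: w) (l :: reduce w).
  by rewrite -cat1s -(cat1s l); exact: SK_cat (SK_refl _) IH.
apply: SK_trans lw _; case: (reduce w) => [|m v] /=; first exact: SK_refl.
case: ifP => [lm|_]; last exact: SK_refl.
rewrite -[l :: _]/([:: l; m] ++ v) -[X in SK_congr _ X]cat0s.
apply: SK_cat (SK_refl _); apply: SK_rel.
by case: l m lm => i [] j //= /eqP ->; constructor.
Qed.

Definition commutation (u v : word) : word * word := (u ++ v, v ++ u).

Definition relations (i : 'Z_3) : seq (word * word) :=
  [:: (a_ i, a_ (i + 1) ++ d_ (i - 1)); (b_ i, a_ (i - 1) ++ c_ (i + 1));
      (c_ i, b_ (i - 1) ++ c_ (i + 1)); (d_ i, a_ (i + 1) ++ c_ (i - 1));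
      (x_ i, d_ (i + 1) ++ x_ (i - 1) ++ b_ (i + 1));
      (d_ 0 ++ d_ 1 ++ d_ 2, [::]); (b_ i ++ d_ i, [::]); (d_ i ++ b_ i, [::]);
      (d_ i ++ x_ i ++ d_ i, a_ i ++ (d_ i ++ x_ i ++ d_ i) ++ c_ i);
      (b_ i ++ x_ i ++ b_ i, a_ i ++ (b_ i ++ x_ i ++ b_ i) ++ c_ i);
      commutation (x_ i) (d_ (i + 1) ++ d_ i ++ d_ (i - 1)) ] ++
  map (commutation (d_ i ++ c_ i)) [:: c_ (i + 1); x_ (i + 1); b_ i ++ d_ (i + 1) ++ d_ i] ++
  map (commutation (a_ i ++ b_ i)) [:: a_ (i + 1); b_ (i + 1); c_ (i + 1); x_ (i + 1);
    b_ i ++ d_ (i + 1) ++ d_ i] ++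
  map (commutation (t_ i)) [:: a_ i; b_ i; c_ i; x_ i; b_ (i - 1) ++ d_ i ++ d_ (i - 1)] ++
  map (commutation (d_ i ++ x_ i ++ b_ i)) [:: a_ (i + 1); b_ (i + 1); c_ (i + 1);
    x_ (i + 1); b_ i ++ d_ (i + 1) ++ d_ i].

Definition pages3 : seq 'Z_3 := [:: 0; 1; 2].

Definition all_relations : seq (word * word) :=
  flatten [seq relations i | i <- pages3].

(* Consequences of the relations that appear when a strand of a relation is
   removed. *)
Definition derived_relations : seq (word * word) := flatten
  [seq [:: commutation (d_ i ++ c_ i) (d_ (i + 1));
           commutation (a_ i ++ b_ i) (d_ (i + 1));
           commutation (d_ i ++ x_ i ++ b_ i) (d_ (i + 1));
           commutation (t_ i) (d_ i)] | i <- pages3].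

Definition reduced_relations : seq (word * word) :=
  [seq (reduce r.1, reduce r.2) | r <- all_relations ++ derived_relations].

(* The equality of the type [letter] does not compute, going through [inord]. *)
Definition letter_eqb (l m : letter) : bool :=
  match l, m with
  | LA i, LA j | LB i, LB j | LC i, LC j | LD i, LD j | LX i, LX j => i == j
  | _, _ => false
  end.

Lemma letter_eqbE l m : letter_eqb l m -> l = m.
Proof. by case: l m => i [] j //= /eqP ->. Qed.

Definition word_eqb : rel word := all2 letter_eqb.

Lemma word_eqbE u v : word_eqb u v -> u = v.
Proof.
by elim: u v => [|l u IH] [|m v] //= /andP[/letter_eqbE -> /IH ->].
Qed.

(** A sufficient test: up to cancellation the words agree or are the two sides of a single relation,
    with no context around it. This is enough for what remains of a relation after deletions. *)
Definition congrb (u v : word) : bool :=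
  let ru := reduce u in let rv := reduce v in
  if word_eqb ru rv then true else
  has (fun r => word_eqb ru r.1 && word_eqb rv r.2 ||
    word_eqb ru r.2 && word_eqb rv r.1) reduced_relations.

(* The colours ([true] is red) of the innermost lines of the three pages.  Lines
   deeper than those reached by a relation do not matter, so the compatibility of
   a relation with the removal of strands is a finite check. *)
Definition tops := seq (seq bool).

Definition top_step (l : letter) (c : bool) (ts : tops) : option tops :=
  if all (fun i => closes l i ==> (ohead (nth [::] ts i) == Some c)) pages3
  then Some [seq let r := if closes l i then behead (nth [::] ts i) else nth [::] ts i in
                 if opens l i then c :: r else r | i <- pages3]
  else None.

Fixpoint colourings (w : word) (ts : tops) : seq (seq (letter * bool) * tops) :=
  if w is l :: w' then
    flatten [seq if top_step l c ts is Some ts'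
                 then [seq ((l, c) :: r.1, r.2) | r <- colourings w' ts'] else [::]
            | c <- [:: true; false]]
  else [:: ([::], ts)].

Definition blue (w : seq (letter * bool)) : word := [seq x.1 | x <- w & ~~ x.2].

Fixpoint bitseqs (n : nat) : seq (seq bool) :=
  if n is n'.+1 then [seq true :: s | s <- bitseqs n'] ++ [seq false :: s | s <- bitseqs n']
  else [:: [::]].

Definition all_tops (n : seq nat) : seq tops :=
  foldr (fun k r => [seq s :: ts | s <- bitseqs k, ts <- r]) [:: [::]] n.

(** The number of lines of page [i] that the word takes from its left. The value is only a
    candidate, validated by [shallow] inside the check. *)
Fixpoint depth (w : word) (i : 'Z_3) : nat :=
  if w is l :: w' then (closes l i + (depth w' i - opens l i))%N else 0%N.

Fixpoint shallow (w : word) (n : seq nat) : bool :=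
  if w is l :: w' then
    all (fun i : 'Z_3 => closes l i <= nth 0 n i)%N pages3 &&
    shallow w' [seq (nth 0 n i - closes l i + opens l i)%N | i : 'Z_3 <- pages3]
  else true.

(** All colourings of [r.1] must be enumerated, which is what [shallow] guarantees ([colouringsP]);
    on the side of [r.2] one suitable colouring has to be found, and soundness ([colouringsE]) is
    enough. The depth of [r.2] enters [n] so that its letters find their lines. *)
Definition check_transport (r : word * word) : bool :=
  let n := [seq maxn (depth r.1 i) (depth r.2 i) | i <- pages3] in
  shallow r.1 n && all (fun ts =>
    let cv := colourings r.2 ts in
    all (fun cu => has (fun cv =>
        if cu.2 == cv.2 then congrb (blue cu.1) (blue cv.1) else false) cv)
     (colourings r.1 ts)) (all_tops n).

Lemma all_pages3 (p : pred 'Z_3) : all p pages3 = [forall i, p i].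
Proof.
apply/idP/forallP => [|p3]; last by rewrite /= !p3.
by case/and4P=> p0 p1 p2 _ [[|[|[|//]]] h]; [move: p0|move: p1|move: p2];
  congr (is_true (p _)); exact: val_inj.
Qed.

Lemma nth_pages3 T (x : T) (F : 'Z_3 -> T) (i : 'Z_3) :
  nth x [seq F j | j <- pages3] i = F i.
Proof. by case: i => -[|[|[|//]]] h /=; congr F; exact: val_inj. Qed.

Lemma mem_pages3 i : i \in pages3.
Proof.
have : all (mem pages3) pages3 by apply/allP.
by rewrite all_pages3 => /forallP/(_ i).
Qed.

Lemma SK_relation_in u v : SK_relation u v -> (u, v) \in all_relations.
Proof.
move=> uv; suff [i ui] : exists i, (u, v) \in relations i.
  by apply/flattenP; exists (relations i) => //; apply/map_f/mem_pages3.
case: uv => [i|i|i|i|i||i|i|i|i|i|i w wi|i w wi|i w wi|i w wi];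
  try by exists i; rewrite /relations mem_cat !inE eqxx ?orbT.
- by exists 0; rewrite /relations mem_cat !inE eqxx ?orbT.
- by exists i; rewrite !mem_cat (map_f (commutation (d_ i ++ c_ i)) wi) ?orbT.
- by exists i; rewrite !mem_cat (map_f (commutation (a_ i ++ b_ i)) wi) ?orbT.
- by exists i; rewrite !mem_cat (map_f (commutation (t_ i)) wi) ?orbT.
- by exists i; rewrite !mem_cat (map_f (commutation (d_ i ++ x_ i ++ b_ i)) wi) ?orbT.
Qed.

Lemma commutationE u v : commute (SK_class u) (SK_class v) ->
  SK_congr (commutation u v).1 (commutation u v).2.
Proof. by move=> uv; apply/SK_classP; rewrite !SK_classM. Qed.

Lemma derived_relationsE r : r \in derived_relations -> SK_congr r.1 r.2.
Proof.
case/flattenP => s /mapP[i _ ->]; rewrite !inE.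
have loop_d z : z \in loops i -> commute z (sd (i + 1)%R) by exact: loops_sd.
case/or4P=> /eqP ->; apply: commutationE; rewrite !SK_classM ?mulgA.
- by apply: loop_d; rewrite !inE eqxx orbT.
- by apply: loop_d; rewrite !inE eqxx.
- by apply: loop_d; rewrite !inE eqxx !orbT.
- by have := commute_st_sd i; rewrite /commute /st !mulgA.
Qed.

Lemma all_relationsE r : r \in all_relations -> SK_congr r.1 r.2.
Proof.
case/flattenP => s /mapP[i _ ->]; rewrite !mem_cat => /or4P[||/mapP[w wi ->]|].
- rewrite !inE; do 10!(case/orP=> [/eqP ->|]; first by apply: SK_rel; constructor).
  by move/eqP ->; apply: SK_rel; constructor.
- by case/mapP=> w wi ->; apply/SK_rel/SK7.
- exact/SK_rel/SK8.
- by case/orP => /mapP[w wi ->]; apply: SK_rel; [exact: SK9|exact: SK10].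
Qed.

Lemma congrbE u v : congrb u v -> SK_congr u v.
Proof.
have ur w := SK_congr_reduce w.
rewrite /congrb; case: ifP => [/word_eqbE uv _|_].
  by apply: SK_trans (ur u) _; rewrite uv; exact/SK_sym/ur.
case/hasP => _ /mapP[r ra ->] /=.
have rr : SK_congr (reduce r.1) (reduce r.2).
  apply: SK_trans (SK_sym (ur _)) (SK_trans _ (ur _)).
  by move: ra; rewrite mem_cat => /orP[/all_relationsE|/derived_relationsE].
case/orP => /andP[/word_eqbE ue /word_eqbE ve]; apply: SK_trans (ur u) _;
  apply: SK_trans (SK_sym (ur v)); rewrite ue ve //; exact: SK_sym.
Qed.

(** Infinite stacks, so that every word can draw lines from its left; the actual number of lines is
    kept separately by [run]. *)
Definition colour_state := 'Z_3 -> nat -> bool.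

Definition push (c : bool) (s : nat -> bool) : nat -> bool :=
  fun n => if n is n'.+1 then s n' else c.

(** A letter has one colour, so both branches at a singular point are deleted or kept together. *)
Definition colour_ok (l : letter) (c : bool) (s : colour_state) : Prop :=
  forall i, closes l i -> s i 0 = c.

Definition colour_after (l : letter) (c : bool) (s : colour_state) : colour_state :=
  fun i => let r := if closes l i then fun n => s i n.+1 else s i in
  if opens l i then push c r else r.

Definition cword := seq (letter * bool).

(* The strands of a word are coloured red ([true]) or blue, consistently with
   the colours of the lines in the pages before and after the word. *)
Fixpoint colour_run (w : cword) (s s' : colour_state) : Prop :=
  if w is x :: w' then colour_ok x.1 x.2 s /\ colour_run w' (colour_after x.1 x.2 s) s'
  else s = s'.

Lemma colour_run_cat u v s s' : colour_run (u ++ v) s s' <->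
  exists2 t, colour_run u s t & colour_run v t s'.
Proof.
elim: u s => [|x u IH] s /=; first by split=> [|[_ <-]//]; exists s.
split=> [[sx /IH[t ut vt]]|[t [sx ut] vt]]; first by exists t.
by split=> //; apply/IH; exists t.
Qed.

Definition glue (ts : tops) (r : colour_state) : colour_state :=
  fun i => foldr push (r i) (nth [::] ts i).

Lemma top_stepE l c ts ts' r : top_step l c ts = Some ts' ->
  colour_ok l c (glue ts r) /\ colour_after l c (glue ts r) = glue ts' r.
Proof.
rewrite /top_step all_pages3; case: ifP => // /forallP cl /Some_inj <-.
split=> [i li|]; first by have := cl i; rewrite li /glue /=; case: nth => //= c' ? /eqP[].
apply/funext => i; rewrite /colour_after /glue nth_pages3.
have := cl i; case: (closes l i) => /=; last by case: opens.
by case: (nth [::] ts i) => //= c' s _; case: opens.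
Qed.

Lemma top_step_ex l c ts r : (forall i : 'Z_3, closes l i <= size (nth [::] ts i))%N ->
  colour_ok l c (glue ts r) -> exists2 ts', top_step l c ts = Some ts' &
  forall i : 'Z_3, size (nth [::] ts' i) = (size (nth [::] ts i) - closes l i + opens l i)%N.
Proof.
move=> sz ok; rewrite /top_step ifT; last first.
  rewrite all_pages3; apply/forallP => i; apply/implyP => li.
  by have := ok i li; have := sz i; rewrite li /glue; case: nth => //= c' s _ ->.
eexists; first by []. move=> i; rewrite nth_pages3 addnC; case: (closes l i) => /=.
  by case: opens; rewrite /= ?size_behead ?subn1.
by case: opens; rewrite /= ?subn0.
Qed.

Lemma colouringsE w ts cw ts' r : (cw, ts') \in colourings w ts ->
  map fst cw = w /\ colour_run cw (glue ts r) (glue ts' r).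
Proof.
elim: w ts cw ts' => [|l w IH] ts cw ts'; first by rewrite inE => /eqP[-> ->].
case/flattenP => q /mapP[c _ ->]; case E: top_step => [t|//].
case/mapP => -[v tv] /IH[vw rv] [-> ->] /=; rewrite vw; split=> //.
by have [ok ->] := top_stepE r E.
Qed.

Lemma shallowE l w n : shallow (l :: w) [seq n i | i <- pages3] ->
  (forall i, closes l i <= n i)%N /\ shallow w [seq (n i - closes l i + opens l i)%N | i <- pages3].
Proof.
case/andP; rewrite all_pages3 => /forallP cl sw; split=> [i|].
  by have := cl i; rewrite nth_pages3.
by move: sw; congr (is_true (shallow w _)).
Qed.

Lemma colouringsP cw ts r s' :
  shallow (map fst cw) [seq size (nth [::] ts i) | i : 'Z_3 <- pages3] ->
  colour_run cw (glue ts r) s' ->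
  exists2 ts', (cw, ts') \in colourings (map fst cw) ts & s' = glue ts' r.
Proof.
elim: cw ts => [|[l c] cw IH] ts.
  by move=> _ <-; exists ts; rewrite ?inE.
case/(@shallowE l _ (fun i => size (nth [::] ts i))) => sz sw [ok rw].
have [t tE tsz] := top_step_ex sz ok.
have [okt at_] := top_stepE r tE.
rewrite /= at_ in rw; have [|t' ct ->] := IH t _ rw.
  by move: sw; congr (is_true (shallow _ _)); apply: eq_map => i; rewrite tsz.
exists t' => //; apply/flattenP.
exists [seq ((l, c) :: q.1, q.2) | q <- colourings (map fst cw) t].
  by apply/mapP; exists c; [case: (c)|rewrite tE].
by apply/mapP; exists (cw, t').
Qed.

Lemma mem_bitseqs (s : seq bool) : s \in bitseqs (size s).
Proof.
by elim: s => //= -[] s IH; rewrite mem_cat map_f // orbT.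
Qed.

Lemma mem_all_tops (ts : tops) : ts \in all_tops (map size ts).
Proof.
elim: ts => // s ts IH; apply/allpairsP; exists (s, ts); split=> //.
exact: mem_bitseqs.
Qed.

Lemma glue_mkseq (s : colour_state) n : s = glue [seq mkseq (s i) (n i) | i <- pages3]
  (fun i k => s i (k + n i)%N).
Proof.
apply/funext => i; rewrite /glue nth_pages3; elim: (n i) => [|m IH].
  by apply/funext => k; rewrite /= addn0.
rewrite {1}IH mkseqS foldr_rcons; congr foldr; apply/funext => -[|k] //=.
by rewrite addSnnS.
Qed.

(** Both boundary states are prescribed for the new colouring; this is what allows transports to be
    pasted along a concatenation. *)
Definition transports (u v : word) : Prop := forall s s' cu, map fst cu = u ->
  colour_run cu s s' ->
  exists cv, [/\ map fst cv = v, colour_run cv s s' & SK_congr (blue cu) (blue cv)].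

Lemma check_transportE r : check_transport r -> transports r.1 r.2.
Proof.
case: r => u v; rewrite /check_transport /=.
set n := [:: _; _; _]; case/andP => su /allP ch s s' cu cuu.
rewrite (glue_mkseq s (fun i => nth 0%N n i)); set ts := map _ _; set r := (fun i k => _).
move=> ru.
have szt : map size ts = n by rewrite /ts /= !size_mkseq.
have tn : ts \in all_tops n by rewrite -szt mem_all_tops.
have [|ts' cuts s'E] := colouringsP _ ru.
  rewrite cuu; move: su; congr (is_true (shallow u _)); rewrite -szt.
  by rewrite /ts /=.
rewrite cuu in cuts.
have /allP/(_ _ cuts)/hasP[[cv tv] cvts /=] := ch _ tn.
case: ifP => // /eqP tt' /congrbE cc; have [cvv rv] := colouringsE r cvts.
by exists cv; split=> //; rewrite s'E tt'.
Qed.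

(** A finite verification by evaluation, in both directions because the congruence is symmetric. *)
Lemma all_relations_checked :
  all (fun r => check_transport r && check_transport (r.2, r.1)) all_relations.
Proof. vm_cast_no_check (erefl true). Qed.

Lemma SK_congr_transports u v : SK_congr u v -> transports u v /\ transports v u.
Proof.
elim=> {u v} [u v /SK_relation_in uv|u|u v _ []|u v w _ [uv vu] _ [vw wv]|
    u u' v v' _ [uu u'u] _ [vv v'v]] //.
- by have /allP/(_ _ uv)/andP[/check_transportE ? /check_transportE] := all_relations_checked.
- by split=> s s' cu cuu ru; exists cu; split=> //; exact: SK_refl.
- have tr x y z : transports x y -> transports y z -> transports x z.
    move=> xy yz s s' cx cxx rx; have [cy [cyy ry xyc]] := xy _ _ _ cxx rx.
    have [cz [czz rz yzc]] := yz _ _ _ cyy ry.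
    by exists cz; split=> //; exact: SK_trans xyc yzc.
  by split; [exact: tr uv vw|exact: tr wv vu].
have tr x x' y y' : transports x x' -> transports y y' -> transports (x ++ y) (x' ++ y').
  move=> xx yy s s' c cE; rewrite -(cat_take_drop (size x) c).
  case/colour_run_cat => t rx ry.
  have [|cx' [cx'E rx' cx]] := xx _ _ _ _ rx; first by rewrite map_take cE take_size_cat.
  have [|cy' [cy'E ry' cy]] := yy _ _ _ _ ry; first by rewrite map_drop cE drop_size_cat.
  exists (cx' ++ cy'); split; first by rewrite map_cat cx'E cy'E.
    by apply/colour_run_cat; exists t.
  by rewrite /blue !filter_cat !map_cat; exact: SK_cat.
by split; exact: tr.
Qed.

(** * Central elements are represented by balanced words *)

Lemma run_cat u v n n' : run (u ++ v) n n' <-> exists2 m, run u n m & run v m n'.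
Proof.
elim: u n => [|l u IH] n /=; first by split=> [|[_ <-]//]; exists n.
split=> [[ln /IH[m um vm]]|[m [ln um] vm]]; first by exists m.
by split=> //; apply/IH; exists m.
Qed.

Lemma run_shift w n n' (m : lines) : run w n n' ->
  run w (fun i => n i + m i)%N (fun i => n' i + m i)%N.
Proof.
elim: w n => [|l w IH] n /= => [->//|[ln rw]].
split=> [i|]; first exact: leq_trans (ln i) (leq_addr _ _).
have -> : lines_after l (fun i => n i + m i)%N = (fun i => lines_after l n i + m i)%N.
  by apply/funext => i; rewrite /lines_after addnAC -addnBAC.
exact: IH.
Qed.

Lemma run_enough w n : (forall i, size w <= n i)%N -> exists n', run w n n'.
Proof.
elim: w n => [|l w IH] n /= sz; first by exists n.
have [i|n' rw] := IH (lines_after l n).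
  by have := sz i; rewrite /lines_after; case: closes; case: opens; lia.
by exists n'; split=> // i; have := sz i; case: closes => //; lia.
Qed.

Definition blue_lines (n : nat) (s : nat -> bool) : nat :=
  count (fun k => ~~ s k) (iota 0 n).

Lemma blue_linesS n s : blue_lines n.+1 s = (~~ s 0%N + blue_lines n (fun k => s k.+1))%N.
Proof. by rewrite /blue_lines /= -[1%N]addn0 iotaDl count_map. Qed.

(** A letter closes and opens lines of its own colour only, so the blue letters see exactly the blue
    lines. *)
Lemma run_blue cw n n' s s' : run (map fst cw) n n' -> colour_run cw s s' ->
  run (blue cw) (fun i => blue_lines (n i) (s i)) (fun i => blue_lines (n' i) (s' i)).
Proof.
elim: cw n s => [|[l c] cw IH] n s /=; first by move=> -> ->.
case=> cl rw [ok cr]; have {IH rw cr} := IH _ _ rw cr.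
have E i : blue_lines (lines_after l n i) (colour_after l c s i) =
    (blue_lines (n i) (s i) - (closes l i && ~~ c) + (opens l i && ~~ c))%N /\
    (closes l i && ~~ c <= blue_lines (n i) (s i))%N.
  have := cl i; have := ok i; rewrite /lines_after /colour_after.
  case: (closes l i) => [/(_ isT) sc|_]; case: (opens l i) => /=;
    case: (n i) => [|k] //= kl;
    rewrite ?addn1 ?addn0 ?subn0 ?subn1 ?addnK /= ?blue_linesS /= ?sc //=;
    by rewrite /blue_lines /=; lia.
case: c ok E => ok E /=.
  congr (run _ _ _); apply/funext => i.
  by have [-> _] := E i; rewrite !andbF subn0 addn0.
move=> rw; split=> [i|]; first by have [_] := E i; rewrite andbT.
by move: rw; congr (run _ _ _); apply/funext => i; have [-> _] := E i; rewrite !andbT.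
Qed.

Definition opener : word := [:: LA 0; LA 1; LA 2].
Definition closer : word := [:: LC 0; LC 1; LC 2].
Definition wpow (w : word) (k : nat) : word := flatten (nseq k w).

Lemma run_opener k n : run (wpow opener k) n (fun i => n i + k.*2)%N.
Proof.
elim: k n => [|k IH] n; first by apply/funext => i; rewrite addn0.
apply/run_cat; exists (fun i => n i + 2)%N; last first.
  have := IH (fun i => n i + 2)%N; congr (run _ _ _); apply/funext => i; lia.
split=> //; split=> //; split=> //; apply/funext => -[[|[|[|//]]] ?];
  rewrite /lines_after /= /Zp_opp /= /eq_op /= /eq_op /=; lia.
Qed.

Lemma run_closer k n : run (wpow closer k) (fun i => n i + k.*2)%N n.
Proof.
elim: k n => [|k IH] n; first by apply/funext => i; rewrite addn0.
apply/run_cat; exists (fun i => n i + k.*2)%N; last exact: IH.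
have three m : run closer (fun i => m i + 2)%N m.
  do 3![split; first by case=> [[|[|[|//]]] ?];
    rewrite /lines_after /= /eq_op /= /eq_op /=; lia].
  by apply/funext => -[[|[|[|//]]] ?]; rewrite /lines_after /= /eq_op /= /eq_op /=; lia.
have := three (fun i => n i + k.*2)%N; congr (run _ _ _).
by apply/funext => i; rewrite doubleS; lia.
Qed.

Definition colour (c : bool) (w : word) : cword := [seq (l, c) | l <- w].

(** Everything below the [k] red lines is blue, so that [u] can be coloured entirely blue whatever
    lines it takes from its left. *)
Definition red_state (k : nat) : colour_state := fun i => iter k (push true) (fun=> false).

Lemma blue_lines_red m k i : (m <= k)%N -> blue_lines m (red_state k i) = 0%N.
Proof.
rewrite /red_state; elim: m k => [|m IH] [|k] //= mk.
by rewrite blue_linesS /= IH.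
Qed.

Lemma push_false : push false (fun=> false) = fun=> false.
Proof. by apply/funext => -[]. Qed.

Lemma colour_run_blue w : colour_run (colour false w) (red_state 0) (red_state 0).
Proof.
elim: w => [|l w IH] //=; split=> //.
have -> // : colour_after l false (red_state 0) = red_state 0.
apply/funext => i; rewrite /colour_after /red_state /=.
by case: closes; case: opens; rewrite ?push_false.
Qed.

Lemma colour_run_opener k m :
  colour_run (colour true (wpow opener k)) (red_state m) (red_state (m + k.*2)).
Proof.
elim: k m => [|k IH] m; first by rewrite addn0.
rewrite /colour map_cat; apply/colour_run_cat; exists (red_state m.+2); last first.
  by have := IH m.+2; rewrite doubleS !addSn !addnS.
split=> //; split=> //; split=> //.
by apply/funext => -[[|[|[|//]]] ?]; apply/funext => -[|[|n]].
Qed.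

Lemma colour_run_closer k m :
  colour_run (colour true (wpow closer k)) (red_state (m + k.*2)) (red_state m).
Proof.
elim: k m => [|k IH] m; first by rewrite addn0.
rewrite /colour map_cat; apply/colour_run_cat; exists (red_state (m + k.*2)); last exact: IH.
rewrite doubleS !addnS.
split=> [[[|[|[|//]]] ?] //|]; split=> [[[|[|[|//]]] ?] //|]; split=> [[[|[|[|//]]] ?] //|].
by apply/funext => -[[|[|[|//]]] ?]; apply/funext => n.
Qed.

Lemma blue_colour c w : blue (colour c w) = if c then [::] else w.
Proof. by case: c; elim: w => //= l w; rewrite /blue /= => ->. Qed.

Lemma blue_cat u v : blue (u ++ v) = blue u ++ blue v.
Proof. by rewrite /blue filter_cat map_cat. Qed.

Lemma und_colour c w : map fst (colour c w) = w.
Proof. by rewrite /colour -map_comp map_id_in. Qed.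

Lemma SK_congr_commute u v : (forall h : SK, SK_class u * h = h * SK_class u)%g ->
  SK_congr (u ++ v) (v ++ u).
Proof. by move=> uc; apply/SK_classP; rewrite !SK_classM uc. Qed.

(* A red word opening more lines than u uses, moved from the right of u to its
   left, shields the blue word left of u from the lines coming from the left. *)
Lemma central_no_left u : (forall h : SK, SK_class u * h = h * SK_class u)%g ->
  exists v n, SK_class v = SK_class u /\ run v no_lines n.
Proof.
move=> uc; pose o := wpow opener (size u).
have [uo _] := SK_congr_transports (SK_congr_commute o uc).
have rc : colour_run (colour false u ++ colour true o) (red_state 0) (red_state (0 + (size u).*2)).
  apply/colour_run_cat; exists (red_state 0); first exact: colour_run_blue.
  exact: colour_run_opener.
have [|cv [cvE rv cvu]] := uo _ _ _ _ rc.
  by rewrite map_cat !und_colour.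
have ro := run_opener (size u) no_lines.
have [i|n' ru] := @run_enough u (fun i => no_lines i + (size u).*2)%N.
  by rewrite /no_lines; lia.
have rou : run (map fst cv) no_lines n' by rewrite cvE; apply/run_cat; eexists; eassumption.
move: cvu; rewrite blue_cat !blue_colour cats0 => cvu.
by exists (blue cv); eexists; split; [exact/SK_classP/SK_sym|exact: run_blue rou rv].
Qed.

(** The red closers move from the left of [u] to its right. The word [u ++ o] is run from
    [k.*2 - n i] lines in page [i], which [u] completes to the [k.*2] lines that [o] closes. These
    initial lines are among the [k.*2] topmost ones, hence red, so the blue word starts with no
    line; it also ends with none. *)
Lemma central_no_right u n : (forall h : SK, SK_class u * h = h * SK_class u)%g ->
  run u no_lines n ->
  exists v, SK_class v = SK_class u /\ run v no_lines no_lines.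
Proof.
move=> uc un; pose k := (\max_i n i)%N; pose o := wpow closer k.
have [_ ou] := SK_congr_transports (SK_congr_commute o uc).
have rc : colour_run (colour true o ++ colour false u) (red_state (0 + k.*2)) (red_state 0).
  apply/colour_run_cat; exists (red_state 0); first exact: colour_run_closer.
  exact: colour_run_blue.
have [|cv [cvE rv cvu]] := ou _ _ _ _ rc.
  by rewrite map_cat !und_colour.
have nk i : (n i <= k.*2)%N.
  by apply: leq_trans (leq_bigmax i) _; rewrite -addnn leq_addr.
have ruo : run (map fst cv) (fun i => k.*2 - n i)%N no_lines.
  rewrite cvE; apply/run_cat; exists (fun i => no_lines i + k.*2)%N; last exact: run_closer.
  have := run_shift (fun i => k.*2 - n i)%N un; congr (run _ _ _).
  by apply/funext => i; rewrite subnKC.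
move: cvu; rewrite blue_cat !blue_colour => cvu.
exists (blue cv); split; first exact/SK_classP/SK_sym.
have := run_blue ruo rv; congr (run _ _ _); apply/funext => i.
by rewrite blue_lines_red // leq_subr.
Qed.

Lemma central_run (g : SK) : (forall h : SK, g * h = h * g)%g ->
  exists w, SK_class w = g /\ run w no_lines no_lines.
Proof.
rewrite -{1 2}(SK_class_repr g) => gc.
have [v [n [vE rv]]] := central_no_left gc.
have [|w [wE rw]] := central_no_right _ rv; first by rewrite vE.
by exists w; rewrite wE vE SK_class_repr.
Qed.

(** * Polyhedral maps and the book *)

Section Topology.
Variable R : realType.

Lemma near0P (P : set R) : (\forall e \near 0^'+, P e) <->
  exists2 d, 0 < d & forall e, 0 < e < d -> P e.
Proof.
split=> [/nbhs_ballP[d /= d0 dP]|[d d0 dP]].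
  exists d => // e /andP[e0 ed]; apply: dP => //.
  by rewrite /ball /= sub0r normrN gtr0_norm.
near=> e; apply: dP; apply/andP; split; first by near: e; exact: nbhs_right_gt.
by near: e; exact: nbhs_right_lt.
Unshelve. all: by end_near. Qed.

Lemma nbhs_RP (x : R) (P : set R) : nbhs x P <->
  exists2 d, 0 < d & forall y, `|y - x| < d -> P y.
Proof.
split=> [/nbhs_ballP[d /= d0 dP]|[d d0 dP]].
  by exists d => // y yd; apply: dP; rewrite /ball /= distrC.
by apply/nbhs_ballP; exists d => // y; rewrite /ball /= distrC; exact: dP.
Qed.

Lemma conv_hull_mem (V : lmodType R) (s : seq V) v : v \in s -> conv_hull s v.
Proof.
move=> vs; have kS : (index v s < size s)%N by rewrite index_mem.
exists (fun j => (j == Ordinal kS)%:R); split=> [j||].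
- exact: ler0n.
- by rewrite (bigD1 (Ordinal kS)) //= eqxx big1 ?addr0 // => j /negbTE ->.
- rewrite (bigD1 (Ordinal kS)) //= eqxx big1 ?addr0 ?scale1r ?nth_index // => j /negbTE ->.
  by rewrite scale0r.
Qed.

Lemma conv_hull_segment (s : seq R) : s != [::] ->
  exists a b, [/\ conv_hull (s : seq R^o) a, conv_hull (s : seq R^o) b &
    forall x, conv_hull (s : seq R^o) x -> a <= x <= b].
Proof.
case: s => // c0 s _; set S := c0 :: s.
pose k0 : 'I_(size S) := ord0.
have [ka _ kaP] := arg_minP (fun k : 'I_(size S) => S`_k) (erefl : xpredT k0).
have [kb _ kbP] := arg_maxP (fun k : 'I_(size S) => S`_k) (erefl : xpredT k0).
exists S`_ka, S`_kb; split.
- exact/(@conv_hull_mem R^o)/mem_nth.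
- exact/(@conv_hull_mem R^o)/mem_nth.
move=> _ [c [c0' c1 ->]]; apply/andP; split.
  rewrite -[leLHS]mul1r -c1 mulr_suml; apply: ler_sum => j _.
  by apply: ler_wpM2l => //; exact: kaP.
rewrite -[leRHS]mul1r -c1 mulr_suml; apply: ler_sum => j _.
by apply: ler_wpM2l => //; exact: kbP.
Qed.

(** On the line a hull lies in a segment whose ends belong to it, so affinity gives an explicit
    Lipschitz formula on the segment. A segment missing [x] contains no point near [x], and finitely
    many hulls cover a neighbourhood. *)
Lemma PL_continuous (W : normedModType R) (f : R -> W) :
  PL (f : R^o -> W) -> continuous f.
Proof.
move=> plf x; have [ss [xss aff]] := plf x.
apply/cvgrPdist_lt => e e0.
suff near_hull s : s \in ss -> \forall y \near x, conv_hull (s : seq R^o) y -> `|f x - f y| < e.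
  have : \forall y \near x, forall s, s \in ss -> conv_hull (s : seq R^o) y -> `|f x - f y| < e.
    elim: (ss) near_hull => [|s l IH] nh; first by near=> y.
    have nl : \forall y \near x, forall s, s \in l -> conv_hull (s : seq R^o) y -> `|f x - f y| < e.
      by apply: IH => t tl; apply: nh; rewrite inE tl orbT.
    have ns := nh s (mem_head _ _).
    near=> y => t; rewrite inE => /orP[/eqP ->|]; first by near: y.
    by move: t; near: y.
  move=> nh; near=> y.
  have [s sss ys] : (\bigcup_(s in [set` ss]) conv_hull (s : seq R^o)) y by near: y.
  have H : forall s, s \in ss -> conv_hull (s : seq R^o) y -> `|f x - f y| < e by near: y.
  exact: H sss ys.
move=> {}/aff affs; case: (eqVneq s [::]) => [->|s0].
  by near=> y => -[c [_ + _]]; rewrite big_ord0 => /esym/eqP; rewrite oner_eq0.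
have [a [b [ha hb hab]]] := conv_hull_segment s0.
have fE y : a <= y <= b -> a < b ->
    f y = f b + ((b - y) / (b - a)) *: (f a - f b).
  move=> /andP[ay yb] ab; have ba0 : 0 < b - a by rewrite subr_gt0.
  have yE : y = ((b - y) / (b - a)) *: (a : R^o) + (1 - (b - y) / (b - a)) *: (b : R^o).
    by rewrite /GRing.scale /=; field; rewrite gt_eqF.
  rewrite {1}yE (affs a b) //; last first.
    by apply/andP; split; [apply: divr_ge0; lra|rewrite ler_pdivrMr //; lra].
  by rewrite scalerBl scale1r scalerBr addrCA addrA.
case: (ltP x a) => [xa|ax].
  near=> y => /hab; suff : y < a by move=> ? /andP[]; lra.
  by near: y; exact: lt_nbhsl.
case: (ltP b x) => [bx|xb].
  near=> y => /hab; suff : b < y by move=> ? /andP[]; lra.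
  by near: y; exact: lt_nbhsr.
case: (ltP a b) => [ab|ba]; last first.
  near=> y => /hab /andP[ay yb]; have -> : y = x by lra.
  by rewrite subrr normr0.
have ba0 : 0 < b - a by rewrite subr_gt0.
(* The summand 1 keeps the denominator positive when [f a = f b]. *)
apply/nbhs_RP; exists (e * (b - a) / (`|f a - f b| + 1)).
  by rewrite divr_gt0 ?mulr_gt0 // ltr_wpDl.
move=> y; rewrite ltr_pdivlMr ?ltr_wpDl // => yx /hab yab.
rewrite (fE x) ?ax // (fE y) // opprD addrACA subrr add0r -scalerBl normrZ.
have -> : (b - x) / (b - a) - (b - y) / (b - a) = (y - x) / (b - a) by field; rewrite gt_eqF.
rewrite normrM normfV (gtr0_norm ba0) mulrAC ltr_pdivrMr //.
apply: le_lt_trans yx; apply: ler_wpM2l => //; lra.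
Unshelve. all: by end_near. Qed.

End Topology.

Section Book.
Variable R : realType.
Implicit Types p q : pt R.

(** Continuous on the whole space; on the book it is the height in page [i], negative on the other
    pages off the axis and zero exactly on the axis. Leaving a page thus becomes a change of
    sign. *)
Definition page_sign (i : 'Z_3) (p : pt R) : R :=
  if i == 0 then yco p - zco p
  else if i == 1 then zco p - `|yco p| else - yco p - zco p.

Lemma Z3P (P : 'Z_3 -> Prop) : P 0 -> P 1 -> P (1 + 1) -> forall i, P i.
Proof.
move=> P0 P1 P2 [[|[|[|//]]] h]; [move: P0|move: P1|move: P2];
  by congr P; exact: val_inj.
Qed.

Lemma book_pages p : book p -> exists i, page i p.
Proof. by case=> i _ ip; exists i. Qed.

Lemma page_sign_ge0 i p : page i p -> 0 <= page_sign i p.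
Proof.
by move: i; apply: Z3P; rewrite /page /page_sign /= => -[-> h]; rewrite ?normr0; lra.
Qed.

Lemma page_sign_le0 i k p : k != i -> page k p -> page_sign i p <= 0.
Proof.
move: i k; apply: Z3P; apply: Z3P => //= _; rewrite /page /page_sign /= => -[h1 h2];
  rewrite ?h1 ?subr_le0 ?sub0r ?oppr_le0 ?normr_ge0 //; lra.
Qed.

Lemma page_sign0 i p : book p -> page_sign i p = 0 -> axis p.
Proof.
case/book_pages => k; rewrite /axis /=; move: k i; apply: Z3P; apply: Z3P;
  rewrite /page /page_sign /= => -[-> h] /eqP; rewrite ?sub0r ?normr0 ?subr0 ?oppr_eq0 ?normr_eq0;
  move/eqP => h'; split=> //; lra.
Qed.

Lemma axis_page_sign i p : axis p -> page_sign i p = 0.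
Proof.
by case=> y0 z0; move: i; apply: Z3P; rewrite /page_sign /= y0 z0 ?normr0; lra.
Qed.

Lemma axis_page i p : axis p -> page i p.
Proof. by case=> y0 z0; move: i; apply: Z3P; rewrite /page /= y0 z0 lexx. Qed.

Lemma pages_axis i k p : k != i -> page i p -> page k p -> axis p.
Proof.
move=> ki ip kp; apply: (@page_sign0 i); first by exists i.
by apply/eqP; rewrite eq_le page_sign_ge0 // (page_sign_le0 ki kp).
Qed.

Lemma page_sign_gt0 i p : book p -> 0 < page_sign i p -> page i p.
Proof.
case/book_pages => k kp; case: (eqVneq k i) => [<-//|ki].
by rewrite ltNge (page_sign_le0 ki kp).
Qed.

Lemma xco_continuous : continuous (@xco R).
Proof.
by move=> p; apply: continuous_comp; [exact: cvg_fst|exact: cvg_fst].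
Qed.

Lemma yco_continuous : continuous (@yco R).
Proof.
by move=> p; apply: continuous_comp; [exact: cvg_fst|exact: cvg_snd].
Qed.

Lemma zco_continuous : continuous (@zco R).
Proof. by move=> p; exact: cvg_snd. Qed.

Lemma page_sign_continuous i : continuous (page_sign i).
Proof.
have yc := yco_continuous; have zc := zco_continuous.
move: i; apply: Z3P => p; rewrite /page_sign /=.
- exact: continuousB (yc p) (zc p).
- apply: continuousB (zc p) _.
  by apply: continuous_comp; [exact: yc|exact: norm_continuous].
- by apply: continuousB (zc p); apply: continuousN (yc p).
Qed.

End Book.

Section ConvexHull.
Variable R : realType.

Lemma conv_hull_convex (V : lmodType R) (s : seq V) x y (l : R) : 0 <= l <= 1 ->
  conv_hull s x -> conv_hull s y -> conv_hull s (l *: x + (1 - l) *: y).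
Proof.
move=> /andP[l0 l1] [c [c0 c1 ->]] [d [d0 d1 ->]].
exists (fun k => l * c k + (1 - l) * d k); split=> [k||].
- by rewrite addr_ge0 ?mulr_ge0 // subr_ge0.
- by rewrite big_split /= -!mulr_sumr c1 d1 !mulr1 addrC subrK.
- rewrite !scaler_sumr -big_split /=; apply: eq_bigr => k _.
  by rewrite !scalerA -scalerDl.
Qed.

Lemma coord_nbhs (f : pt R -> R) p d : continuous f -> 0 < d ->
  nbhs p [set q | `|f q - f p| < d].
Proof.
move=> cf d0; have fd : nbhs (f p) [set y | `|y - f p| < d] by apply/nbhs_RP; exists d.
exact: (cf p _ fd).
Qed.

Lemma box_nbhs p d : 0 < d -> nbhs p
  [set q : pt R | [/\ `|xco q - xco p| < d, `|yco q - yco p| < d & `|zco q - zco p| < d]].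
Proof.
move=> d0; have nx := coord_nbhs p (@xco_continuous R) d0.
have ny := coord_nbhs p (@yco_continuous R) d0.
have nz := coord_nbhs p (@zco_continuous R) d0.
by apply: filterS (filterI nx (filterI ny nz)) => q [? []].
Qed.

(** For the constant isotopy. One cube around [p] suffices; its points are convex combinations taken
    one coordinate at a time. *)
Lemma PL_id : PL (@id (pt R)).
Proof.
move=> p; pose s : seq R := [:: -1; 1].
pose P a b c : pt R := ((xco p + a, yco p + b), zco p + c).
pose S := [seq P a.1 a.2 c | a <- [seq (a, b) | a <- s, b <- s], c <- s].
exists [:: S]; split=> //; apply: filterS (box_nbhs p ltr01) => q [qx qy qz].
exists S; first by rewrite /= inE.
have sm : -1 \in s by rewrite inE eqxx.
have s1 : 1 \in s by rewrite !inE eqxx orbT.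
have corner a b c : a \in s -> b \in s -> c \in s -> conv_hull S (P a b c).
  move=> sa sb sc; apply: conv_hull_mem; apply/allpairsP; exists ((a, b), c).
  by split=> //; apply/allpairsP; exists (a, b).
have mid (a : R) : `|a| < 1 -> exists2 l, 0 <= l <= 1 & a = l * -1 + (1 - l) * 1.
  by rewrite ltr_norml => aP; exists ((1 - a) / 2); lra.
have edge (a : R) b c : `|a| < 1 -> b \in s -> c \in s -> conv_hull S (P a b c).
  move=> /mid[l lP aE] sb sc.
  have -> : P a b c = l *: P (-1) b c + (1 - l) *: P 1 b c.
    by congr ((_, _), _); rewrite /= -![_ *: _]/(_ * _) ?aE; ring.
  by apply: conv_hull_convex => //; apply: corner.
have face (a b : R) c : `|a| < 1 -> `|b| < 1 -> c \in s -> conv_hull S (P a b c).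
  move=> a1 /mid[l lP bE] sc.
  have -> : P a b c = l *: P a (-1) c + (1 - l) *: P a 1 c.
    by congr ((_, _), _); rewrite /= -![_ *: _]/(_ * _) ?bE; ring.
  by apply: conv_hull_convex => //; apply: edge.
have cube (a b c : R) : `|a| < 1 -> `|b| < 1 -> `|c| < 1 -> conv_hull S (P a b c).
  move=> a1 b1 /mid[l lP cE].
  have -> : P a b c = l *: P a b (-1) + (1 - l) *: P a b 1.
    by congr ((_, _), _); rewrite /= -![_ *: _]/(_ * _) ?cE; ring.
  by apply: conv_hull_convex => //; apply: face.
have -> : q = P (xco q - xco p) (yco q - yco p) (zco q - zco p).
  by rewrite /P ![_ + (_ - _)]addrC !subrK; case: q {qx qy qz} => [[]].
exact: cube.
Qed.

End ConvexHull.

(** * The word of an embedding is balanced *)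

Section Embedded.
Variables (R : realType) (K : curves R).
Hypothesis HK : three_page_embedded K.
Implicit Types p q : pt R.

Lemma strand_periodic j t : @strand R K j (t + 1) = strand j t.
Proof. by case: HK => -[[+ _ _ _ _] _] _ _ _ _; apply. Qed.

Lemma strand_continuous j : continuous (@strand R K j).
Proof. by apply: PL_continuous; case: HK => -[[_ + _ _ _] _] _ _ _ _; apply. Qed.

Lemma strand_book j t : book (@strand R K j t).
Proof. by case: HK => -[_ +] _ _ _ _; apply; exists j, t. Qed.

Lemma singular_axis p : singular_point K p -> axis p.
Proof. by case: HK => _ [+ _] _ _ _; apply. Qed.

Lemma strand_int j t (m : int) : @strand R K j (t + m%:~R) = strand j t.
Proof.
have nat_case n u : @strand R K j (u + n%:R) = strand j u.
  elim: n => [|n IH]; first by rewrite addr0.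
  by rewrite -natr1 addrA strand_periodic.
by case: m => n; rewrite ?NegzE ?mulrNz -?pmulrn // -(nat_case n.+1) subrK.
Qed.

Lemma int_shift (t : R) : exists u (m : int), 0 <= u < 1 /\ t = u + m%:~R.
Proof.
exists (t - (Num.floor t)%:~R), (Num.floor t); split; last by rewrite subrK.
by have := floor_itv t; rewrite intrD; lra.
Qed.

Lemma strand_eq j1 t1 j2 t2 : @strand R K j1 t1 = @strand R K j2 t2 ->
  ~ axis (@strand R K j1 t1) -> exists m : int, t1 = t2 + m%:~R.
Proof.
move=> st nax; have [u1 [m1 [u1P t1E]]] := int_shift t1.
have [u2 [m2 [u2P t2E]]] := int_shift t2; exists (m1 - m2).
case: (pselect ((j1, u1) = (j2, u2))) => [[_ u12]|z12].
  by rewrite t1E t2E u12 intrB; ring.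
case: nax; apply: singular_axis; exists (j1, u1), (j2, u2); split=> //.
- by split=> //=; rewrite -(strand_int _ _ m1) -t1E.
- by split=> //=; rewrite -(strand_int _ _ m2) -t2E.
Qed.

Section Path.
Variables (j : 'I_(ncomp K)) (t0 sg : R).
Hypothesis sgP : sg = 1 \/ sg = -1.
Let s e := strand j (t0 + sg * e).

Lemma path_continuous : continuous s.
Proof.
move=> e; apply: (@continuous_comp _ _ _ (fun e => t0 + sg * e) (@strand R K j)).
  by apply: continuousD; [exact: cst_continuous|exact: mulrl_continuous].
exact: strand_continuous.
Qed.

Lemma path1 : s 1 = s 0.
Proof.
rewrite /s mulr0 addr0 mulr1; case: sgP => ->; first exact: strand_periodic.
by rewrite -strand_periodic subrK.
Qed.

Lemma path_inj e1 e2 : 0 <= e1 < 1 -> 0 <= e2 < 1 -> s e1 = s e2 -> ~ axis (s e1) -> e1 = e2.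
Proof.
move=> e1P e2P s12 nax; have [m tE] := strand_eq s12 nax.
have sm : sg * (e1 - e2) = m%:~R by lra.
have m0 : m = 0.
  have : -1 < m%:~R :> R /\ m%:~R < 1 :> R.
    by rewrite -sm; case: sgP => ->; rewrite ?mul1r ?mulN1r; lra.
  by case; rewrite -[1]/(1%:~R) -mulrNz !ltr_int; lia.
by move: sm; rewrite m0; case: sgP => ->; rewrite ?mul1r ?mulN1r; lra.
Qed.

Lemma path_nbhs U : nbhs (s 0) U -> exists2 d, 0 < d & forall e, 0 < e < d -> U (s e).
Proof.
move=> /(path_continuous (x := 0)) /nbhs_RP[d d0 dU]; exists d => // e /andP[e0 ed].
by apply: dU; rewrite subr0 gtr0_norm.
Qed.

(** The points of the knot on the axis other than [s 0] are finitely many, hence at positive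
    distance from it; the hypothesis on [xco] excludes [s 0] itself. *)
Lemma path_off_axis d : 0 < d ->
  (forall e, 0 < e < d -> xco (s e) != xco (s 0)) ->
  exists2 d', 0 < d' & forall e, 0 < e < d' -> ~ axis (s e).
Proof.
move=> d0 xs; have [_ [_ finK] _ _ _] := HK.
pose F := (image_of K `&` @axis R) `\ s 0.
have clF : closed F.
  have /accessible_finite_set_closed : accessible_space (pt R).
    by apply: hausdorff_accessible; exact: norm_hausdorff.
  by apply; exact: finite_setD.
have : nbhs (s 0) (~` F).
  by apply: open_nbhs_nbhs; split; [exact: closed_openC|move=> -[_]; apply].
case/path_nbhs => d1 d10 d1F; exists (Num.min d d1); first by rewrite lt_min d0.
move=> e /andP[e0]; rewrite lt_min => /andP[ed ed1] ax.
apply: (d1F e); first by rewrite e0.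
split; first by split=> //; exists j, (t0 + sg * e).
by move=> /= s0; have := xs e; rewrite e0 ed s0 eqxx => /(_ isT).
Qed.

(** The path is back at [s 0] at time 1, so the set of return times from [Num.min d 1] on is compact
    and nonempty, and has a minimum. *)
Lemma first_return d : 0 < d -> (forall e, 0 < e < d -> ~ axis (s e)) -> axis (s 0) ->
  exists tau, [/\ 0 < tau, tau <= 1, axis (s tau) & forall e, 0 < e < tau -> ~ axis (s e)].
Proof.
move=> d0 ds ax0.
pose E := [set e : R | Num.min d 1 <= e <= 1 /\ axis (s e)].
have E1 : E 1 by split; [rewrite ge_min lexx orbT|rewrite path1].
have clE : closed E.
  have -> : E = `[Num.min d 1, 1] `&` ((@yco R \o s) @^-1` [set 0] `&` (@zco R \o s) @^-1` [set 0]).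
    by apply/seteqP; split=> e; rewrite /E /axis /= in_itv.
  apply: closedI; first exact: interval_closed.
  have cc (f : pt R -> R) : continuous f -> closed ((f \o s) @^-1` [set 0]).
    move=> cf; apply: preimage_closed; last exact: closed_eq.
    by move=> e _; apply: continuous_comp; [exact: path_continuous|exact: cf].
  by apply: closedI; apply: cc; [exact: yco_continuous|exact: zco_continuous].
have cE : compact E.
  apply: (subclosed_compact clE (@segment_compact _ (Num.min d 1) 1)).
  by move=> e [] /=; rewrite in_itv.
have [|tau] := compact_EVT_min (ex_intro _ 1 E1) cE (f := id).
  by apply: continuous_subspaceT => x; exact: cvg_id.
rewrite inE => -[/andP[dt t1] axt] tmin; exists tau; split=> //.
  by apply: lt_le_trans dt; rewrite lt_min d0 ltr01.
move=> e /andP[e0 et]; case: (ltP e d) => [ed|de]; first by apply: ds; rewrite e0.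
move=> axe; have : tau <= e; last by rewrite leNgt et.
by apply: tmin; rewrite inE; split=> //; rewrite ge_min de /=; lra.
Qed.

(** By the intermediate value theorem the path could change page only through a zero of [page_sign],
    that is, on the axis. *)
Lemma path_page i d tau : 0 < d -> (forall e, 0 < e < d -> page i (s e)) ->
  axis (s 0) -> axis (s tau) -> (forall e, 0 < e < tau -> ~ axis (s e)) ->
  forall e, 0 <= e <= tau -> page i (s e).
Proof.
move=> d0 ds ax0 axt off e /andP[]; rewrite le_eqVlt => /predU1P[<- _|e0].
  exact: axis_page.
rewrite le_eqVlt => /predU1P[->|et]; first exact: axis_page.
case: (ltP e d) => [ed|de]; first by apply: ds; rewrite e0.
have bk e' : book (s e') by exact: strand_book.
have sgn e' : 0 < e' < tau -> page_sign i (s e') != 0.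
  by move=> /off nax; apply: contra_notN nax => /eqP /page_sign0; apply.
apply: page_sign_gt0 => //; rewrite lt_neqAle eq_sym sgn ?e0 //=; apply/negbNE/negP.
rewrite -ltNge => neg; pose e1 := d / 2.
have e1P : 0 < e1 < d by rewrite /e1; lra.
have pos : 0 <= page_sign i (s e1) by apply/page_sign_ge0/ds.
have [|||c] := @IVT R (fun e => page_sign i (s e)) e1 e 0.
- lra.
- apply: continuous_subspaceT => x; apply: continuous_comp; first exact: path_continuous.
  exact: page_sign_continuous.
- by rewrite ge_min le_max pos (ltW neg) orbT.
rewrite in_itv /= => /andP[c1 c2] c0; have := sgn c; rewrite c0 eqxx.
by have -> // : 0 < c < tau; lra.
Qed.

Lemma path_component i tau e1 e2 : (forall e, 0 <= e <= tau -> page i (s e)) ->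
  0 <= e1 <= tau -> 0 <= e2 <= tau ->
  connected_component (image_of K `&` page i) (s e1) (s e2).
Proof.
move=> pg e1P e2P.
have cS : connected (s @` `[0, tau]).
  apply: connected_continuous_connected; first exact: segment_connected.
  by apply: continuous_subspaceT; exact: path_continuous.
have mem e : 0 <= e <= tau -> (s @` `[0, tau]) (s e).
  by move=> eP; exists e => //=; rewrite in_itv.
apply: (connected_component_max (mem _ e1P) _ cS); last exact: mem.
move=> q [e /=]; rewrite in_itv /= => eP <-; split; last exact: pg.
by exists j, (t0 + sg * e).
Qed.

Lemma component_xco i p q r : connected_component (image_of K `&` page i) p q ->
  connected_component (image_of K `&` page i) p r -> xco q = xco r -> q = r.
Proof.
move=> pq pr; have [_ _ _ _ mono] := HK.
have ip : (image_of K `&` page i) p by case: pq => C [Cp CA _] _; exact: CA.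
by apply: (mono _ _ ip); rewrite inE.
Qed.

(** Until the next axis point the path stays in one component of a page, where [xco] is injective,
    so [xco] is strictly monotone along it, in the direction of the initial germ. Injectivity of the
    path is available only on [[0, tau[], because [tau] may be a full turn; the endpoint is reached
    by continuity, which in particular rules out a return to the start. *)
Lemma path_follow i rho d : rho = 1 \/ rho = -1 -> axis (s 0) -> 0 < d ->
  (forall e, 0 < e < d -> page i (s e) /\ 0 < rho * (xco (s e) - xco (s 0))) ->
  exists tau, [/\ 0 < tau, axis (s tau), forall e, 0 <= e <= tau -> page i (s e),
    forall e, 0 < e < tau -> ~ axis (s e) &
    forall e1 e2, 0 <= e1 -> e1 < e2 -> e2 <= tau -> rho * xco (s e1) < rho * xco (s e2)].
Proof.
move=> rhoP ax0 d0 ds.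
have rho0 : rho != 0 by case: rhoP => ->; rewrite ?oppr_eq0 oner_neq0.
have [|d' d'0 offd] := path_off_axis d0.
  by move=> e /ds[_]; apply: contraTneq => ->; rewrite subrr mulr0 ltxx.
have [tau [tau0 tau1 axt off]] := first_return d'0 offd ax0.
have pg := path_page d0 (fun e eP => (ds e eP).1) ax0 axt off.
exists tau; split=> //.
pose h e := rho * xco (s e).
have ch : continuous h.
  move=> e; apply: (@continuous_comp _ _ _ (fun e => xco (s e)) (fun x => rho * x)).
    by apply: continuous_comp; [exact: path_continuous|exact: xco_continuous].
  exact: mulrl_continuous.
have hinj e1 e2 : 0 <= e1 < tau -> 0 <= e2 < tau -> h e1 = h e2 -> e1 = e2.
  move=> e1P e2P /(mulfI rho0) x12.
  have s12 : s e1 = s e2.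
    by apply: (component_xco (i := i) (p := s e1)) => //; apply: (path_component pg); lra.
  have aux a b : 0 <= a -> 0 < b -> a < tau -> b < tau -> s a = s b -> a = b.
    move=> a0 b0 at_ bt sab; apply: path_inj => //; [lra|lra|].
    by rewrite sab; apply: off; lra.
  have [e10 e20] : 0 <= e1 /\ 0 <= e2 by lra.
  move: e20; rewrite le_eqVlt => /predU1P[e20|e20].
    move: e10; rewrite le_eqVlt => /predU1P[e10|e10]; first by rewrite -e10 -e20.
    by apply/esym/aux => //; lra.
  by apply: aux => //; lra.
have hpos e : 0 < e < d -> h 0 < h e.
  by move=> /ds[_]; rewrite mulrBr subr_gt0.
have mono e1 e2 : 0 <= e1 -> e1 < e2 -> e2 < tau -> h e1 < h e2.
  move=> e10 e12 e2t.
  (* At time [b] the initial germ fixes the direction; [c] is a time before [tau] that bounds both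
     [b] and [e2], so a continuous injection on [[0, c]] must increase there. *)
  pose b := Num.min (d / 2) (tau / 2); pose c := Num.max b e2.
  have bP : 0 < b < d /\ b < tau.
    by rewrite /b; case: (leP (d / 2) (tau / 2)) => le2; lra.
  have cP : b <= c /\ c < tau /\ e2 <= c.
    by case: bP => _ bt; rewrite /c; case: (leP b e2) => be; lra.
  have injc : {in `[0, c]%R &, injective h}.
    by move=> x y; rewrite !in_itv /= => xP yP; apply: hinj; lra.
  have ctc : {within `[0, c], continuous h} by exact: continuous_subspaceT.
  have [x [y [xc yc xy hxy]]] : exists x y,
      [/\ x \in `[0, c]%R, y \in `[0, c]%R, x < y & h x <= h y].
    case: bP cP => bd bt cP; exists 0, b; rewrite !in_itv /=.
    by split; [lra|lra|lra|apply/ltW/hpos].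
  have hle : {in `[0, c]%R &, {mono h : x y / x <= y}}.
    by apply: (@itv_continuous_inj_le R h `[0, c]%R) => //; exists x, y.
  rewrite ltNge hle ?in_itv /= -?ltNge //; lra.
move=> e1 e2 e10 e12; rewrite le_eqVlt => /predU1P[e2E|]; last exact: mono.
pose m := (e1 + tau) / 2.
have mP : e1 < m < tau by rewrite /m; lra.
have hm : h e1 < h m by apply: mono; lra.
apply: lt_le_trans hm _; rewrite e2E leNgt; apply/negP => htm.
have /nbhs_RP[r r0 rP] : \forall e \near tau, h e < h m.
  by have /cvgr_lt := ch tau; apply.
pose e := Num.max ((m + tau) / 2) (tau - r / 2).
have [em [et er]] : m < e /\ e < tau /\ tau - r < e.
  by rewrite /e; case: (leP ((m + tau) / 2) (tau - r / 2)) => le2; lra.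
have het : h e < h m by apply: rP; rewrite ltr_norml; lra.
have : h m < h e by apply: mono => //; lra.
by rewrite ltNge (ltW het).
Qed.

End Path.
Definition ahead (rho : R) p (i : 'Z_3) : set (pt R) :=
  page i `&` [set q | 0 < rho * (xco q - xco p)].

Lemma arc_right_ahead p i : arc_right K p i = arc_from K p (ahead 1 p i).
Proof.
rewrite /arc_right; congr arc_from; congr (_ `&` _); apply/funext => q /=.
by rewrite mul1r subr_gt0.
Qed.

Lemma arc_left_ahead p i : arc_left K p i = arc_from K p (ahead (-1) p i).
Proof.
rewrite /arc_left; congr arc_from; congr (_ `&` _); apply/funext => q /=.
by rewrite mulN1r opprB subr_gt0.
Qed.

Lemma arc_fromP p A : arc_from K p A <-> exists z sg d, [/\ @fiber R K p z,
  sg = 1 \/ sg = -1, 0 < d & forall e, 0 < e < d -> A (strand z.1 (z.2 + sg * e))].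
Proof.
split=> [[z zp [/near0P[d d0 dA]|/near0P[d d0 dA]]]|[z [sg [d [zp sgP d0 dA]]]]].
- by exists z, 1, d; split=> // [|e /dA]; [left|rewrite mul1r].
- by exists z, (-1), d; split=> // [|e /dA]; [right|rewrite mulN1r].
exists z => //; case: sgP dA => -> dA; [left|right]; apply/near0P; exists d => // e /dA.
- by rewrite mul1r.
- by rewrite mulN1r.
Qed.

(** The last clause makes [p] recoverable from [q]: the path from [p] to [q] passes over the
    abscissa of [p'], and within a component the abscissa determines the point. *)
Lemma follow_arc i rho p : rho = 1 \/ rho = -1 -> axis p ->
  arc_from K p (ahead rho p i) ->
  exists q, [/\ (image_of K `&` @axis R) q, rho * xco p < rho * xco q,
    arc_from K q (ahead (- rho) q i), connected_component (image_of K `&` page i) q p &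
    forall p', axis p' -> connected_component (image_of K `&` page i) q p' ->
      rho * xco p <= rho * xco p' < rho * xco q -> p' = p].
Proof.
move=> rhoP axp /arc_fromP[[j t0] [sg [d [[/= t0P jp] sgP d0 dA]]]].
pose s e := strand j (t0 + sg * e).
have s0 : s 0 = p by rewrite /s mulr0 addr0.
have [|e eP|tau [tau0 axt pg off mono]] := @path_follow j t0 sg sgP i rho d rhoP _ d0.
- by rewrite mulr0 addr0 jp.
- by have [ip xp] := dA e eP; split=> //; rewrite mulr0 addr0 jp.
have rho0 : rho != 0 by case: rhoP => ->; rewrite ?oppr_eq0 oner_neq0.
exists (s tau); split.
- by split=> //; exists j, (t0 + sg * tau).
- by rewrite -s0; apply: mono; rewrite ?lexx.
- have [u [m [uP uE]]] := int_shift (t0 + sg * tau).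
  apply/arc_fromP; exists (j, u), (- sg), tau; split=> //.
  + by split=> //=; rewrite -(strand_int _ _ m) -uE.
  + by case: sgP => ->; rewrite ?opprK; [right|left].
  + move=> e eP /=; have -> : strand j (u + - sg * e) = s (tau - e).
      rewrite -(strand_int _ _ m) /s; congr strand.
      by rewrite mulrBr addrA uE mulNr addrAC.
    split; first by apply: pg; lra.
    rewrite /= mulNr -mulrN opprB mulrBr subr_gt0; apply: mono; lra.
- by rewrite -s0; apply: (path_component pg); lra.
move=> p' axp' cp' xp'.
have ch : continuous (fun e => rho * xco (s e)).
  move=> e; apply: (@continuous_comp _ _ _ (fun e => xco (s e)) (fun x => rho * x)).
    by apply: continuous_comp; [exact: path_continuous|exact: xco_continuous].
  exact: mulrl_continuous.
have [|||e] := @IVT R (fun e => rho * xco (s e)) 0 tau (rho * xco p').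
- exact: ltW.
- exact: continuous_subspaceT.
- rewrite s0 ge_min le_max; case/andP: xp' => -> /ltW -> /=; exact: orbT.
rewrite in_itv /= => /andP[e0 et] /(mulfI rho0) xe.
have p'E : s e = p'.
  by apply: component_xco cp' xe; apply: (path_component pg); lra.
move: e0; rewrite le_eqVlt => /predU1P[e0|e0]; first by rewrite -p'E -e0.
move: et; rewrite le_eqVlt => /predU1P[et|et].
  by move: xp'; rewrite -p'E et ltxx andbF.
by case: (off e); rewrite ?e0 ?et // -/(s e) p'E.
Qed.

End Embedded.

Section Letters.
Variables (R : realType) (K : curves R).
Hypothesis HK : three_page_embedded K.
Implicit Types p q : pt R.

Definition germ_in p (z : 'I_(ncomp K) * R) (sg rho : R) (i : 'Z_3) : Prop :=
  exists2 d, 0 < d & forall e, 0 < e < d ->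
    ahead rho p i (strand z.1 (z.2 + sg * e)) /\ ~ axis (strand z.1 (z.2 + sg * e)).

Lemma arc_germ p rho i : arc_from K p (ahead rho p i) -> exists z sg,
  [/\ @fiber R K p z, sg = 1 \/ sg = -1 & germ_in p z sg rho i].
Proof.
move=> /arc_fromP[[j t0] [sg [d [[/= t0P jp] sgP d0 dA]]]].
have [|d' d'0 offd] := path_off_axis HK (j := j) (t0 := t0) (sg := sg) d0.
  move=> e /dA[_ /=]; apply: contraTneq; rewrite mulr0 addr0 jp => ->.
  by rewrite subrr mulr0 ltxx.
exists (j, t0), sg; split=> //; exists (Num.min d d'); first by rewrite lt_min d0.
move=> e /andP[e0]; rewrite lt_min => /andP[ed ed'].
by split; [apply: dA|apply: offd]; rewrite e0.
Qed.

Lemma germ_uniq p z sg rho rho' i i' : rho = 1 \/ rho = -1 -> rho' = 1 \/ rho' = -1 ->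
  germ_in p z sg rho i -> germ_in p z sg rho' i' -> rho = rho' /\ i = i'.
Proof.
move=> rhoP rhoP' [d d0 dA] [d' d'0 dA'].
pose e := Num.min d d' / 2.
have [ed ed'] : 0 < e < d /\ 0 < e < d'.
  by rewrite /e; case: (leP d d') => dd'; lra.
have [[ip /= xp] nax] := dA _ ed; have [[ip' /= xp'] _] := dA' _ ed'.
split; first by case: rhoP xp => ->; case: rhoP' xp' => ->; lra.
by apply/eqP; apply: contraT => ii'; case: nax; apply: pages_axis ii' ip' ip.
Qed.

(** A nonsingular point has one preimage, hence only two arcs, one for each direction of travel;
    among three germs two coincide. *)
Lemma three_arcs p r1 i1 r2 i2 r3 i3 : ~ singular_point K p ->
  r1 = 1 \/ r1 = -1 -> r2 = 1 \/ r2 = -1 -> r3 = 1 \/ r3 = -1 ->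
  arc_from K p (ahead r1 p i1) -> arc_from K p (ahead r2 p i2) ->
  arc_from K p (ahead r3 p i3) ->
  [\/ r1 = r2 /\ i1 = i2, r3 = r1 /\ i3 = i1 | r3 = r2 /\ i3 = i2].
Proof.
move=> nsing r1P r2P r3P /arc_germ[z1 [s1 [fz1 s1P g1]]] /arc_germ[z2 [s2 [fz2 s2P g2]]].
move=> /arc_germ[z3 [s3 [fz3 s3P g3]]].
have zE z z' : fiber p z -> fiber p z' -> z = z' :> 'I_(ncomp K) * R.
  by move=> fz fz'; apply: contrapT => zz'; apply: nsing; exists z, z'.
rewrite (zE _ _ fz2 fz1) in g2; rewrite (zE _ _ fz3 fz1) in g3.
have [s12|[s31|s32]] : s1 = s2 \/ s3 = s1 \/ s3 = s2.
- by case: s1P => ->; case: s2P => ->; case: s3P => ->; auto.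
- by constructor 1; rewrite -s12 in g2; exact: germ_uniq g1 g2.
- by constructor 2; rewrite s31 in g3; exact: germ_uniq g3 g1.
- by constructor 3; rewrite s32 in g3; exact: germ_uniq g3 g2.
Qed.

Lemma near_pages_arc p rho i k : rho = 1 \/ rho = -1 -> near_pages K p k ->
  arc_from K p (ahead rho p i) -> (i == k - 1) || (i == k + 1).
Proof.
move=> rhoP [U pU UK] /arc_germ[[j t0] [sg [[/= t0P jp] sgP [d d0 dA]]]].
have [|d' d'0 dU] := path_nbhs HK (j := j) (t0 := t0) (sg := sg) (U := U).
  by rewrite mulr0 addr0 jp.
pose e := Num.min d d' / 2.
have [ed ed'] : 0 < e < d /\ 0 < e < d'.
  by rewrite /e; case: (leP d d') => dd'; lra.
have [[ip _] nax] := dA _ ed; set q := strand _ _ in ip nax.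
have [kp|kp] : (page (k - 1) `|` page (k + 1)) q.
- by apply: UK; split; [exists j, (t0 + sg * e)|exact: dU].
- by apply/orP; left; apply: contraT => ik; case: nax; exact: pages_axis ik kp ip.
- by apply/orP; right; apply: contraT => ik; case: nax; exact: pages_axis ik kp ip.
Qed.

(** The four arcs of the embedding condition meet both pages [i - 1] and [i + 1], which forces the
    index of [near_pages] to be [i]. *)
Lemma singular_arcs p k : singular_point K p -> near_pages K p k ->
  [/\ arc_left K p (k - 1), arc_right K p (k - 1),
      arc_left K p (k + 1) & arc_right K p (k + 1)].
Proof.
move=> sp nk; have [_ _ _ sing _] := HK.
have [i [ni [l1 r1 l2 r2]]] := sing _ sp.
suff -> : k = i by [].
have arcs i' : arc_right K p i' -> (i' == k - 1) || (i' == k + 1).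
  by rewrite arc_right_ahead => /(near_pages_arc (or_introl erefl) nk).
have := arcs _ r1; have := arcs _ r2.
by case: (Z3_cases k i) => -> //; rewrite ?Z3E ?Z3_neq.
Qed.

(** [letter_at] asserts only that certain arcs exist; that there are no others comes from
    [three_arcs], and at singular points from [near_pages]. *)
Lemma letter_arcs p l i : letter_at K p l ->
  (opens l i <-> arc_right K p i) /\ (closes l i <-> arc_left K p i).
Proof.
have P1 : 1 = 1 :> R \/ 1 = -1 :> R by left.
have N1 : -1 = 1 :> R \/ -1 = -1 :> R by right.
have neq : (1 : R) <> -1 by lra.
have neq' : (-1 : R) <> 1 by lra.
have pagesN (k : 'Z_3) : k - 1 <> k + 1 by apply/eqP; rewrite Z3_neq.
have pagesN' (k : 'Z_3) : k + 1 <> k - 1 by apply/eqP; rewrite Z3_neq.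
rewrite arc_right_ahead arc_left_ahead.
case: l => k /=; rewrite ?arc_right_ahead ?arc_left_ahead.
- move=> [ns g1 g2]; split; split=> //.
  + by case/orP => /eqP ->.
  + by move/(three_arcs ns P1 P1 P1 g1 g2) => [[_ /pagesN]|[_ ->]|[_ ->]] //;
      rewrite eqxx ?orbT.
  + by move/(three_arcs ns P1 P1 N1 g1 g2) => [[_ /pagesN]|[/neq']|[/neq']].
- move=> [ns g1 g2]; split; split=> [/eqP -> //|].
  + by move/(three_arcs ns N1 P1 P1 g1 g2) => [[/neq']|[/neq]|[_ ->]].
  + by move/(three_arcs ns N1 P1 N1 g1 g2) => [[/neq']|[_ ->]|[/neq']].
- move=> [ns g1 g2]; split; split=> //.
  + by move/(three_arcs ns N1 N1 P1 g1 g2) => [[_ /pagesN]|[/neq]|[/neq]].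
  + by case/orP => /eqP ->.
  + by move/(three_arcs ns N1 N1 N1 g1 g2) => [[_ /pagesN]|[_ ->]|[_ ->]] //;
      rewrite eqxx ?orbT.
- move=> [ns g1 g2]; split; split=> [/eqP -> //|].
  + by move/(three_arcs ns N1 P1 P1 g1 g2) => [[/neq']|[/neq]|[_ ->]].
  + by move/(three_arcs ns N1 P1 N1 g1 g2) => [[/neq']|[_ ->]|[/neq']].
- move=> [sp nk]; have [l1 r1 l2 r2] := singular_arcs sp nk.
  rewrite -arc_right_ahead -arc_left_ahead; split; split.
  + by case/orP => /eqP ->.
  + by rewrite arc_right_ahead => /(near_pages_arc P1 nk).
  + by case/orP => /eqP ->.
  + by rewrite arc_left_ahead => /(near_pages_arc N1 nk).
Qed.

End Letters.

(** * Runs in terms of bracket counts *)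

Section Counts.
Implicit Types w : word.

(** A letter closes before it opens, so its own openings cannot serve its closings: closings up to
    and including position [m] are compared with openings strictly before [m]. *)
Lemma run_counts w (n : lines) :
  (forall m i, (m < size w)%N ->
    count (closes^~ i) (take m.+1 w) <= n i + count (opens^~ i) (take m w))%N ->
  run w n (fun i => n i + count (opens^~ i) w - count (closes^~ i) w)%N.
Proof.
elim: w n => [|l w IH] n cnt /=; first by apply/funext => i; rewrite addn0 subn0.
have c0 i : (closes l i <= n i)%N.
  by have := cnt 0%N i isT; rewrite /= take0 /= !addn0.
split=> //; have := IH (lines_after l n).
have -> : (fun i => lines_after l n i + count (opens^~ i) w - count (closes^~ i) w)%N =
    (fun i => n i + (opens l i + count (opens^~ i) w) - (closes l i + count (closes^~ i) w))%N.
  by apply/funext => i; have := c0 i; rewrite /lines_after; lia.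
apply=> m i mw; have := cnt m.+1 i mw; have := c0 i.
by rewrite /lines_after /=; lia.
Qed.

Lemma count_take (a : pred letter) w m : (m <= size w)%N ->
  count a (take m w) = size [seq k <- iota 0 m | a (nth (LA 0) w k)].
Proof.
move=> mw; rewrite size_filter -(count_map (nth (LA 0) w) a).
by rewrite map_nth_iota0.
Qed.

Lemma leq_count_inj (a b : pred letter) w m m' (f : nat -> nat) :
  (m <= size w)%N -> (m' <= size w)%N ->
  (forall k, (k < m)%N -> a (nth (LA 0) w k) -> (f k < m')%N /\ b (nth (LA 0) w (f k))) ->
  (forall k k', (k < m)%N -> (k' < m)%N -> a (nth (LA 0) w k) -> a (nth (LA 0) w k') ->
    f k = f k' -> k = k') ->
  (count a (take m w) <= count b (take m' w))%N.
Proof.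
move=> mw mw' fP finj; rewrite !count_take //.
rewrite -(size_map f); apply: uniq_leq_size.
  rewrite map_inj_in_uniq ?filter_uniq ?iota_uniq // => k k'.
  rewrite !mem_filter !mem_iota !add0n => /and3P[ak _ km] /and3P[ak' _ km'].
  exact: finj.
move=> x /mapP[k]; rewrite mem_filter mem_iota add0n => /and3P[ak _ km] ->.
by have [fm bf] := fP k km ak; rewrite mem_filter bf mem_iota add0n.
Qed.

End Counts.

Section EmbeddingRun.
Variables (R : realType) (K : curves R).
Hypothesis HK : three_page_embedded K.

Lemma encodes_run w : encodes K w -> run w no_lines no_lines.
Proof.
case=> ps [srt psE sz lt].
pose P k := nth 0 ps k.
have PK k : (k < size w)%N -> (image_of K `&` @axis R) (P k).
  by move=> kw; rewrite -psE /=; apply: mem_nth; rewrite sz.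
have Plt k k' : (k < size w)%N -> (k' < size w)%N -> (xco (P k) < xco (P k')) = (k < k')%N.
  move=> kw kw'; have tr : transitive (fun p q : pt R => xco p < xco q).
    by move=> ? ? ?; exact: lt_trans.
  have lts a b : (a < b)%N -> (b < size w)%N -> xco (P a) < xco (P b).
    by move=> ab bw; apply: (sorted_ltn_nth tr 0 srt); rewrite ?inE ?sz //; exact: ltn_trans bw.
  case: (ltngtP k k') => [kk'|k'k|->]; last exact: ltxx.
  - exact: lts.
  - by apply/negbTE; rewrite -leNgt ltW // lts.
have matched rho i (a b : letter -> bool) : rho = 1 \/ rho = -1 ->
    (forall k, (k < size w)%N ->
      (a (nth (LA 0) w k) <-> arc_from K (P k) (ahead rho (P k) i)) /\
      (b (nth (LA 0) w k) <-> arc_from K (P k) (ahead (- rho) (P k) i))) ->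
    exists f : nat -> nat,
    (forall k, (k < size w)%N -> a (nth (LA 0) w k) ->
      [/\ (f k < size w)%N, b (nth (LA 0) w (f k)) & rho * xco (P k) < rho * xco (P (f k))]) /\
    (forall k k', (k < size w)%N -> (k' < size w)%N -> a (nth (LA 0) w k) ->
      a (nth (LA 0) w k') -> f k = f k' -> k = k').
  move=> rhoP ab; pose comp q := connected_component (image_of K `&` page i) q.
  have ex k : exists k', (k < size w)%N -> a (nth (LA 0) w k) ->
      [/\ (k' < size w)%N, b (nth (LA 0) w k'), rho * xco (P k) < rho * xco (P k'),
        comp (P k') (P k) &
        forall p', axis p' -> comp (P k') p' ->
          rho * xco (P k) <= rho * xco p' < rho * xco (P k') -> p' = P k].
    case: (pselect ((k < size w)%N /\ a (nth (LA 0) w k))) => [[kw ak]|no]; last first.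
      by exists 0%N => kw ak; case: no.
    have [q [Kq xq arcq cq uq]] := follow_arc HK rhoP (PK k kw).2 ((ab k kw).1.1 ak).
    have [k' k'w k'E] : exists2 k', (k' < size w)%N & P k' = q.
      move: Kq; rewrite -psE => /(nthP 0)[k' k'w k'E].
      by exists k'; rewrite -?sz.
    exists k' => _ _; rewrite k'E; split=> //.
    by apply/(ab k' k'w).2; rewrite k'E.
  have [f fP] := choice ex; exists f; split.
    by move=> k kw ak; have [] := fP k kw ak.
  move=> k k' kw kw' ak ak' fkk'.
  have [fw _ xk ck uk] := fP k kw ak; have [_ _ xk' ck' uk'] := fP k' kw' ak'.
  (* Of two points with the same partner, the farther one in direction [-rho] starts a path over the
     other, so uniqueness applied to it identifies them. *)
  rewrite -fkk' in xk' ck' uk'.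
  have PE : P k = P k'.
    case: (leP (rho * xco (P k)) (rho * xco (P k'))) => [le|/ltW le].
      by apply/esym/uk; [exact: (PK _ kw').2|exact: ck'|rewrite le].
    by apply: uk'; [exact: (PK _ kw).2|exact: ck|rewrite le].
  case: (ltngtP k k') => // kk'.
    by have := Plt k k' kw kw'; rewrite kk' PE ltxx.
  by have := Plt k' k kw' kw; rewrite kk' PE ltxx.
have arcs i k : (k < size w)%N ->
    (opens (nth (LA 0) w k) i <-> arc_from K (P k) (ahead 1 (P k) i)) /\
    (closes (nth (LA 0) w k) i <-> arc_from K (P k) (ahead (-1) (P k) i)).
  move=> kw; have := letter_arcs HK i (lt k kw).
  by rewrite arc_right_ahead arc_left_ahead.
(* The first matching bounds openings by closings, so the truncated final counts vanish; the second
   bounds the closings of a prefix by strictly earlier openings. *)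
have right i := matched 1 i (opens^~ i) (closes^~ i) (or_introl erefl) (arcs i).
have left i : _ := matched (-1) i (closes^~ i) (opens^~ i) (or_intror erefl).
have := @run_counts w no_lines; rewrite /no_lines.
have -> : (fun i => 0 + count (opens^~ i) w - count (closes^~ i) w)%N = fun=> 0%N.
  apply/funext => i; apply/eqP; rewrite subn_eq0 add0n.
  have [f [fP finj]] := right i.
  rewrite -(take_size w); apply: (leq_count_inj (f := f)) => //.
  by move=> k kw ak; have [] := fP k kw ak.
apply=> m i mw; rewrite add0n.
have [k kw|f [fP finj]] := left i.
  by rewrite opprK; have [] := arcs i k kw.
apply: (leq_count_inj (f := f)) => // [|k km ak|k k' km km'].
- exact: ltnW.
- have kw : (k < size w)%N by exact: leq_trans km mw.
  have [fw bf] := fP k kw ak; rewrite !mulN1r ltrN2 Plt // => fk.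
  by split=> //; exact: leq_trans fk _.
- by apply: finj; [exact: leq_trans km mw|exact: leq_trans km' mw].
Qed.

End EmbeddingRun.

(** * The embedding encoded by a balanced word *)

Section Matching.
Variable w : word.
Hypothesis Hw : run w no_lines no_lines.
Let N := size w.

Definition letter_nth k : letter := nth (LA 0) w k.
Definition level k : lines := foldl (fun n l => lines_after l n) no_lines (take k w).
(** The count between the closing and the opening at position [k]. A letter [LX] closes and opens in
    the same page and leaves [level] unchanged, so brackets are matched by comparing these lower
    values. *)
Definition low k i : nat := (level k i - closes (letter_nth k) i)%N.

Lemma run_level (v : word) n n' : run v n n' ->
  (forall k, (k < size v)%N -> forall i : 'Z_3, (closes (nth (LA 0%R) v k) i <=
     foldl (fun n l => lines_after l n) n (take k v) i)%N) /\
  foldl (fun n l => lines_after l n) n v = n'.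
Proof.
elim: v n => [|l v IH] n //= [ln /IH[kv <-]]; split=> // -[|k] /=; last exact: kv.
by [].
Qed.

Lemma level0 (i : 'Z_3) : level 0 i = 0%N.
Proof. by rewrite /level take0. Qed.

Lemma level_size (i : 'Z_3) : level N i = 0%N.
Proof. by rewrite /level take_size (run_level Hw).2. Qed.

Lemma closes_level k i : (k < N)%N -> (closes (letter_nth k) i <= level k i)%N.
Proof. by move=> kN; apply: (run_level Hw).1. Qed.

Lemma levelS k i : (k < N)%N -> level k.+1 i = (low k i + opens (letter_nth k) i)%N.
Proof. by move=> kN; rewrite /level (take_nth (LA 0)) // foldl_rcons. Qed.

Definition matched (i : 'Z_3) (k k' : nat) : Prop :=
  [/\ (k < k' < N)%N, opens (letter_nth k) i, closes (letter_nth k') i,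
      low k i = low k' i & forall m, (k < m < k')%N -> (low k i < low m i)%N].

(** The partner is the first later position whose [low] drops to that of [k]; it exists because the
    run ends with no line. As a letter closes at most one line per page, the drop is exact and that
    letter closes. *)
Lemma matched_open i k : (k < N)%N -> opens (letter_nth k) i -> exists k', matched i k k'.
Proof.
move=> kN ok; pose Q m := [&& (k < m)%N, (m < N)%N & (low m i <= low k i)%N].
have lev m : (forall j, (k < j < m)%N -> (low k i < low j i)%N) ->
    (k < m <= N)%N -> (low k i < level m i)%N.
  case: m => [|m] lows /andP[km mN]; first by [].
  rewrite levelS //; case: (ltngtP k m) => [km'|mk|<-]; last by rewrite ok addn1.
    by apply: leq_trans (leq_addr _ _); apply: lows; rewrite km' ltnSn.
  by move: km; rewrite ltnS leqNgt mk.
have [|k' /and3P[kk' k'N lk'] min] := @ex_minnP Q.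
  apply: contrapT => no; have := lev N; rewrite level_size ltn0 kN leqnn => H.
  apply: notF; apply: H => // j /andP[kj jN]; rewrite ltnNge; apply/negP => lj.
  by apply: no; exists j; rewrite /Q kj jN.
have lows m : (k < m < k')%N -> (low k i < low m i)%N.
  move=> /andP[km mk']; rewrite ltnNge; apply/negP => lm.
  have : Q m by rewrite /Q km (ltn_trans mk').
  by move/min; rewrite leqNgt mk'.
have lk : (low k i < level k' i)%N by apply: lev => //; rewrite kk' ltnW.
have := closes_level i k'N; move: lk' lk; rewrite /(low k') => lk' lk ck.
by exists k'; split=> //; [rewrite kk'|lia|rewrite /(low k'); lia].
Qed.

Lemma matched_close i k' : (k' < N)%N -> closes (letter_nth k') i -> exists k, matched i k k'.
Proof.
move=> k'N ck; pose Q m := (m < k')%N && (low m i <= low k' i)%N.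
have lk' : (level k' i = low k' i + 1)%N.
  by have := closes_level i k'N; rewrite /low ck; lia.
have k'0 : (0 < k')%N by case: (k') lk' => //; rewrite level0; lia.
have [||k /andP[kk' lk] max] := @ex_maxnP Q k'.
- by exists 0%N; rewrite /Q k'0 /low level0 sub0n.
- by move=> m /andP[/ltnW].
have lows m : (k < m < k')%N -> (low k' i < low m i)%N.
  move=> /andP[km mk']; rewrite ltnNge; apply/negP => lm.
  by have := max m; rewrite /Q mk' lm leqNgt km => /(_ isT).
have kN : (k < N)%N by exact: ltn_trans k'N.
have : (low k' i < level k.+1 i)%N.
  case: (ltngtP k.+1 k') => [kk1|kk1|->]; last by rewrite lk' addn1.
    apply: leq_trans (leq_subr _ _); apply: lows; rewrite ltnSn //.
  by move: kk1; rewrite ltnS leqNgt kk'.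
rewrite levelS // => ok; exists k; split=> //.
- by rewrite kk'.
- lia.
- lia.
- by move=> m mP; apply: leq_ltn_trans lk _; exact: lows.
Qed.

Lemma matched_cases i k k' l l' : matched i k k' -> matched i l l' ->
  [\/ k = l /\ k' = l', (k' <= l)%N \/ (l' <= k)%N, (k < l)%N /\ (l' < k')%N |
      (l < k)%N /\ (k' < l')%N].
Proof.
move=> [/andP[kk' k'N] _ _ kE km] [/andP[ll' l'N] _ _ lE lm].
case: (ltngtP k l) => [kl|lk|kl].
- case: (leqP k' l) => [k'l|lk']; first by constructor 2; left.
  have lkl := km l; rewrite kl lk' in lkl; have {}lkl := lkl isT.
  case: (ltngtP l' k') => [l'k'|k'l'|l'k']; first by constructor 3.
    by have := lm k'; rewrite lk' k'l' => /(_ isT); lia.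
  by move: lE; rewrite l'k'; lia.
- case: (leqP l' k) => [l'k|kl']; first by constructor 2; right.
  have lkl := lm k; rewrite lk kl' in lkl; have {}lkl := lkl isT.
  case: (ltngtP k' l') => [k'l'|l'k'|k'l']; first by constructor 4.
    by have := km l'; rewrite kl' l'k' => /(_ isT); lia.
  by move: kE; rewrite k'l'; lia.
- subst l; constructor 1; split=> //; case: (ltngtP k' l') => // h.
    by have := lm k'; rewrite kk' h => /(_ isT); lia.
  by have := km l'; rewrite ll' h => /(_ isT); lia.
Qed.

Definition germ_ok (g : 'I_N * 'Z_3 * bool) : bool :=
  if g.2 then opens (letter_nth g.1.1) g.1.2 else closes (letter_nth g.1.1) g.1.2.

(* The germs of the arcs at the points of the axis: the point, the page and the
   direction, [true] standing for right. *)
Definition germ := {g : 'I_N * 'Z_3 * bool | germ_ok g}.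
HB.instance Definition _ := Finite.on germ.
Definition Germ g (ok : germ_ok g) : germ := exist (fun g => germ_ok g) g ok.

Definition gpt (g : germ) : 'I_N := (val g).1.1.
Definition gpage (g : germ) : 'Z_3 := (val g).1.2.
Definition gdir (g : germ) : bool := (val g).2.

Lemma germ_eq g g' : gpt g = gpt g' -> gpage g = gpage g' -> gdir g = gdir g' -> g = g'.
Proof.
rewrite /gpt /gpage /gdir => e1 e2 e3; apply/val_inj.
by move: (val g) (val g') e1 e2 e3 => [[? ?] ?] [[? ?] ?] /= -> -> ->.
Qed.

Lemma germ_opens g : gdir g -> opens (letter_nth (gpt g)) (gpage g).
Proof. by case: g => -[[k i] d] /=; rewrite /germ_ok /gdir /=; case: d. Qed.

Lemma germ_closes g : ~~ gdir g -> closes (letter_nth (gpt g)) (gpage g).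
Proof. by case: g => -[[k i] d] /=; rewrite /germ_ok /gdir /=; case: d. Qed.

Definition mates (g g' : germ) : Prop :=
  [/\ gpage g' = gpage g, gdir g' = ~~ gdir g &
      if gdir g then matched (gpage g) (gpt g) (gpt g')
      else matched (gpage g) (gpt g') (gpt g)].

Lemma mates_ex g : exists g', mates g g'.
Proof.
case E : (gdir g).
  have [k' mk] := matched_open (ltn_ord (gpt g)) (germ_opens E).
  have k'N : (k' < N)%N by case: mk => /andP[].
  have ok : germ_ok (Ordinal k'N, gpage g, false) by case: mk.
  by exists (Germ ok); split; rewrite ?E.
have [k mk] := matched_close (ltn_ord (gpt g)) (germ_closes (negbT E)).
have kN : (k < N)%N by case: mk => /andP[kk /(ltn_trans kk)].
have ok : germ_ok (Ordinal kN, gpage g, true) by case: mk.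
by exists (Germ ok); split; rewrite ?E.
Qed.

Definition mate (g : germ) : germ := sval (cid (mates_ex g)).

Lemma mateP g : mates g (mate g).
Proof. by rewrite /mate; case: cid. Qed.

Lemma gpage_mate g : gpage (mate g) = gpage g. Proof. by case: (mateP g). Qed.
Lemma gdir_mate g : gdir (mate g) = ~~ gdir g. Proof. by case: (mateP g). Qed.

Lemma mate_matched g : gdir g -> matched (gpage g) (gpt g) (gpt (mate g)).
Proof. by move=> dg; case: (mateP g); rewrite dg. Qed.

Lemma mateK : involutive mate.
Proof.
move=> g; apply: germ_eq; rewrite ?gpage_mate ?gdir_mate ?negbK //.
have [_ _ m1] := mateP g; have [_ _] := mateP (mate g).
rewrite gpage_mate gdir_mate; case: (gdir g) m1 => /= m1 m2; apply: val_inj => /=;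
  case: (matched_cases m1 m2) => [[]|[]|[]|[]] //; case: m1 => /andP[? ?] _ _ _ _;
  case: m2 => /andP[? ?] _ _ _ _; lia.
Qed.

Lemma mate_neq g : mate g != g.
Proof. by apply/eqP => /(congr1 gdir); rewrite gdir_mate; case: gdir. Qed.

Definition letter_index (l : letter) : 'Z_3 :=
  match l with LA i | LB i | LC i | LD i | LX i => i end.

Definition is_x (l : letter) : bool := if l is LX _ then true else false.

(** The germ continuing the strand through its point. A letter of index [j] uses pages [j - 1] and
    [j + 1]; the three indices add up to 0 modulo 3, whence the formula for the other page. At a
    singular point the direction also flips, since a branch joins opposite quadrants; elsewhere the
    letter has a single direction in that page. *)
Definition turn_val (l : letter) (i : 'Z_3) (d : bool) : 'Z_3 * bool :=
  let i' := - letter_index l - i in (i', if is_x l then ~~ d else opens l i').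

Lemma turn_page (j : 'Z_3) : (- j - (j - 1) = j + 1) * (- j - (j + 1) = j - 1).
Proof. by split; move: j; apply: Z3P; exact: val_inj. Qed.

Definition has_germ (l : letter) (i : 'Z_3) (d : bool) : bool :=
  if d then opens l i else closes l i.

Lemma has_germ_page l i d : has_germ l i d ->
  (i == letter_index l - 1) || (i == letter_index l + 1).
Proof. by case: l => j /=; case: d => //= ->; rewrite ?orbT. Qed.

Lemma turn_val_germ l i d : has_germ l i d ->
  has_germ l (turn_val l i d).1 (turn_val l i d).2.
Proof.
move=> h; case/orP: (has_germ_page h) => /eqP iE; move: h; rewrite iE /turn_val;
  case: l {iE} => j /=; rewrite turn_page /has_germ ?Z3_neq ?eqxx ?orbT /=;
  by case: d; rewrite /= ?Z3_neq ?eqxx ?orbT.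
Qed.

Lemma turn_valK l i d : has_germ l i d ->
  turn_val l (turn_val l i d).1 (turn_val l i d).2 = (i, d).
Proof.
move=> h; have h' := has_germ_page h; rewrite /turn_val /=.
have -> : - letter_index l - (- letter_index l - i) = i by rewrite opprB addrC subrK.
congr (_, _); case/orP: h' h => /eqP ->; case: l => j /=; rewrite ?negbK //;
  by case: d; rewrite /has_germ /= ?Z3_neq ?eqxx.
Qed.

Lemma germ_has g : has_germ (letter_nth (gpt g)) (gpage g) (gdir g).
Proof. by case: g => -[[k i] d]. Qed.

Lemma turn_ok g : germ_ok (gpt g, (turn_val (letter_nth (gpt g)) (gpage g) (gdir g)).1,
  (turn_val (letter_nth (gpt g)) (gpage g) (gdir g)).2).
Proof. exact: turn_val_germ (germ_has g). Qed.

Definition turn g : germ := Germ (turn_ok g).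

Lemma turnK : involutive turn.
Proof.
move=> g; have tK := turn_valK (germ_has g).
apply: germ_eq => //; first exact: (congr1 fst tK).
exact: (congr1 snd tK).
Qed.

Lemma gpage_turn g : gpage (turn g) != gpage g.
Proof.
have := has_germ_page (germ_has g); rewrite /gpage /= -/(gpage g) => h.
by case/orP: h => /eqP ->; rewrite turn_page Z3_neq.
Qed.

Lemma turn_neq g : turn g != g.
Proof. by apply/eqP => tg; have := gpage_turn g; rewrite tg eqxx. Qed.

End Matching.

(** * Orienting the closed curves formed by two involutions *)

Section Orientation.
Variables (G : finType) (mu nu : G -> G).
Hypotheses (muK : involutive mu) (nuK : involutive nu).
Hypotheses (mu_neq : forall g, mu g != g) (nu_neq : forall g, nu g != g).

Definition cyc_next g := nu (mu g).
Definition cyc_prev g := mu (nu g).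

Lemma nextK : cancel cyc_next cyc_prev.
Proof. by move=> g; rewrite /cyc_prev /cyc_next nuK muK. Qed.

Lemma prevK : cancel cyc_prev cyc_next.
Proof. by move=> g; rewrite /cyc_prev /cyc_next muK nuK. Qed.

Lemma next_inj : injective cyc_next. Proof. exact: can_inj nextK. Qed.

(** Integer iterates, because strands are parametrised by all real numbers and follow the integer
    part of a rescaled parameter. *)
Definition iterz (m : int) (g : G) : G :=
  match m with Posz k => iter k cyc_next g | Negz k => iter k.+1 cyc_prev g end.

Lemma iterzS m g : iterz (m + 1) g = cyc_next (iterz m g).
Proof.
case: m => [k|[|k]]; first by rewrite -PoszD addn1.
  by rewrite /= prevK.
have -> : Negz k.+1 + 1 = Negz k by rewrite !NegzE; lia.
by rewrite /= prevK.
Qed.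

Lemma iterzP m g : iterz (m - 1) g = cyc_prev (iterz m g).
Proof. by rewrite -[in RHS](subrK 1 m) iterzS nextK. Qed.

Lemma int_ind_pm (P : int -> Prop) : P 0 -> (forall m, P m -> P (m + 1)) ->
  (forall m, P m -> P (m - 1)) -> forall m, P m.
Proof.
move=> P0 PS PP [] k.
  by elim: k => [//|k IH]; have := PS _ IH; congr P; lia.
by elim: k => [|k IH]; [have := PP _ P0|have := PP _ IH]; congr P; rewrite ?NegzE; lia.
Qed.

Lemma iterz_order m g : iterz (m + (order cyc_next g)%:Z) g = iterz m g.
Proof.
move: m; apply: int_ind_pm => [|m IH|m IH].
- by rewrite add0r /= iter_order //; exact: next_inj.
- by rewrite addrAC !iterzS IH.
- by rewrite addrAC !iterzP IH.
Qed.

Definition rank_root g : nat := enum_rank (froot cyc_next g).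
(** A curve is traversed by two orbits of [cyc_next], exchanged by [mu]; the one whose root has the
    smaller rank is its orientation. *)
Definition selected g := (rank_root g < rank_root (mu g))%N.

Lemma froot_next g : froot cyc_next (cyc_next g) = froot cyc_next g.
Proof.
apply/esym/eqP; rewrite root_connect ?fconnect1 //.
exact: fconnect_sym next_inj.
Qed.

Lemma next_mu_next g : cyc_next (mu (cyc_next g)) = mu g.
Proof. by rewrite /cyc_next muK nuK. Qed.

Lemma selected_next g : selected (cyc_next g) = selected g.
Proof.
rewrite /selected /rank_root froot_next -(froot_next (mu (cyc_next g))).
by rewrite next_mu_next.
Qed.

Lemma selected_iterz m g : selected (iterz m g) = selected g.
Proof.
move: m; apply: int_ind_pm => [//|m IH|m IH]; first by rewrite iterzS selected_next.
by rewrite -IH -[in RHS](subrK 1 m) iterzS selected_next.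
Qed.

(* The reflection mu reverses the orbits of [cyc_next], and has no fixed point
   on a cycle because neither mu nor nu has one. *)
Lemma iter_next_mu n g : iter n cyc_next g != mu g.
Proof.
elim/ltn_ind: n g => -[|[|n]] IH g; first by rewrite eq_sym.
  exact: nu_neq.
apply/eqP; rewrite iterS iterSr => /(congr1 cyc_prev); rewrite nextK.
by apply/eqP; exact: IH.
Qed.

Lemma selected_mu g : selected (mu g) = ~~ selected g.
Proof.
suff : rank_root g != rank_root (mu g) by rewrite /selected muK; case: ltngtP.
rewrite (inj_eq val_inj) (inj_eq enum_rank_inj) root_connect; last first.
  exact: fconnect_sym next_inj.
apply/negP => /iter_findex E; have := iter_next_mu (findex cyc_next g (mu g)) g.
by rewrite E eqxx.
Qed.

Lemma selected_nu g : selected (nu g) = ~~ selected g.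
Proof. by rewrite -{1}[g]muK -/(cyc_next (mu g)) selected_next selected_mu. Qed.

Definition roots_seq : seq G := [seq g <- enum G | (froot cyc_next g == g) && selected g].

Definition base (j : 'I_(size roots_seq)) : G := tnth (in_tuple roots_seq) j.

Lemma baseP j : froot cyc_next (base j) = base j /\ selected (base j).
Proof.
have := mem_tnth j (in_tuple roots_seq); rewrite -/(base j) /=.
by rewrite mem_filter => /andP[/andP[/eqP]].
Qed.

Lemma selected_base j m : selected (iterz m (base j)).
Proof. by rewrite selected_iterz; case: (baseP j). Qed.

Lemma froot_iter n g : froot cyc_next (iter n cyc_next g) = froot cyc_next g.
Proof. by elim: n => //= n; rewrite froot_next. Qed.

Lemma base_inj j j' (m m' : nat) :
  (m < order cyc_next (base j))%N -> (m' < order cyc_next (base j'))%N ->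
  iter m cyc_next (base j) = iter m' cyc_next (base j') -> j = j' /\ m = m'.
Proof.
move=> mo m'o E; have jj : j = j'.
  have : base j = base j'.
    by rewrite -(baseP j).1 -(baseP j').1 -(froot_iter m) E froot_iter.
  rewrite /base !(tnth_nth (base j)) => /eqP.
  have u : uniq roots_seq by apply/filter_uniq/enum_uniq.
  by rewrite /= nth_uniq // => /eqP/val_inj.
split=> //; subst j'; rewrite -(findex_iter mo) E findex_iter //.
Qed.

Lemma base_ex g : selected g ->
  exists j (m : nat), (m < order cyc_next (base j))%N /\ iter m cyc_next (base j) = g.
Proof.
move=> sg; pose r := froot cyc_next g.
have cs : connect_sym (frel cyc_next) by exact: fconnect_sym next_inj.
have rg : fconnect cyc_next r g by rewrite cs; exact: connect_root.
have gE := iter_findex rg.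
have rin : r \in roots_seq.
  rewrite mem_filter mem_enum andbT root_root ?eqxx //=.
  by have := selected_iterz (Posz (findex cyc_next r g)) r; rewrite /= gE sg => <-.
have jlt : (index r roots_seq < size roots_seq)%N by rewrite index_mem.
have bE : base (Ordinal jlt) = r.
  by rewrite /base (tnth_nth r) /= nth_index.
exists (Ordinal jlt), (findex cyc_next r g); rewrite bE; split=> //.
by rewrite findex_max.
Qed.

End Orientation.

(** * Tents over matched brackets *)

Section Tents.
Variable R : realType.

Definition pagey (i : 'Z_3) : R := if i == 0 then 1 else if i == 1 then 0 else -1.
Definition pagez (i : 'Z_3) : R := if i == 1 then 1 else 0.

Definition page_pt (i : 'Z_3) (x h : R) : pt R := ((x, pagey i * h), pagez i * h).

Lemma page_page_pt i x h : 0 <= h -> page i (page_pt i x h).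
Proof.
move=> h0; move: i; apply: Z3P; rewrite /page /page_pt /pagey /pagez /= /yco /zco /=;
  by split; lra.
Qed.

Lemma page_sign_pt i x h : 0 <= h -> page_sign i (page_pt i x h) = h.
Proof.
move=> h0; move: i; apply: Z3P; rewrite /page_sign /page_pt /pagey /pagez /= /yco /zco /=;
  by rewrite ?mul0r ?normr0; lra.
Qed.

Lemma axis_pt i x : axis (page_pt i x 0).
Proof. by split; rewrite /yco /zco /= mulr0. Qed.

Lemma axis_ptE i x h : 0 <= h -> axis (page_pt i x h) -> h = 0.
Proof. by move=> h0 /(axis_page_sign i); rewrite page_sign_pt. Qed.

Lemma page_pt0 i k x : page_pt i x 0 = page_pt k x 0.
Proof. by rewrite /page_pt !mulr0. Qed.

Lemma page_pt_page i k x h : 0 < h -> page k (page_pt i x h) -> k = i.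
Proof.
move=> h0 kp; apply/eqP; apply: contraT => ki.
have ip : page i (page_pt i x h) by apply/page_page_pt/ltW.
by have := axis_ptE (ltW h0) (pages_axis ki ip kp); lra.
Qed.

Lemma page_pt_inj i x h k x' h' : 0 < h -> 0 <= h' ->
  page_pt i x h = page_pt k x' h' -> [/\ i = k, x = x' & h = h'].
Proof.
move=> h0 h'0 E; have ik : k = i.
  by apply: (@page_pt_page _ _ x h h0); rewrite E; exact: page_page_pt.
split=> //; first by case: E.
by move/(congr1 (page_sign i)): E; rewrite ik !page_sign_pt // ltW.
Qed.

Definition tent (k k' x : R) : R := Num.min (x - k) (k' - x).

Lemma tent_out k k' x : x <= k \/ k' <= x -> tent k k' x <= 0.
Proof. by rewrite /tent; case: (leP (x - k) (k' - x)) => h; lra. Qed.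

Lemma tent_in k k' x : k <= x <= k' -> 0 <= tent k k' x.
Proof. by rewrite /tent; case: (leP (x - k) (k' - x)) => h; lra. Qed.

Lemma tent_gt0 k k' x : k < x < k' -> 0 < tent k k' x.
Proof. by rewrite /tent; case: (leP (x - k) (k' - x)) => h; lra. Qed.

Lemma tent_nested (k k' l l' : nat) x : (k < l)%N -> (l' < k')%N ->
  tent l%:R l'%:R x <= tent k%:R k'%:R x - 1.
Proof.
move=> kl lk; have h1 : k%:R + 1 <= l%:R :> R by rewrite natr1 ler_nat.
have h2 : l'%:R + 1 <= k'%:R :> R by rewrite natr1 ler_nat.
rewrite /tent; case: (leP (x - k%:R)) => c1; case: (leP (x - l%:R)) => c2; lra.
Qed.

(** Disjoint brackets compare a nonnegative tent with a nonpositive one; nested brackets have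
    integer ends, which puts their tents at least 1 apart. The forbidden interval between -1 and 0
    separates the components of a page. *)
Lemma matched_tent (w : word) i k k' l l' x : matched w i k k' -> matched w i l l' ->
  l%:R <= x <= l'%:R -> let t := tent l%:R l'%:R x - tent k%:R k'%:R x in
  (k = l /\ k' = l') \/ 0 <= t /\ (l%:R < x < l'%:R -> 0 < t) \/ t <= -1.
Proof.
move=> m1 m2 xl /=; have t0 := tent_in xl.
have lt_ : l%:R < x < l'%:R -> 0 < tent l%:R l'%:R x by exact: tent_gt0.
case: (matched_cases m1 m2) => [[-> ->]|[k'l|l'k]|[kl l'k']|[lk k'l']].
- by left.
- have o : tent k%:R k'%:R x <= 0.
    by apply: tent_out; right; have : k'%:R <= l%:R :> R; [rewrite ler_nat|lra].
  by right; left; split=> [|/lt_]; lra.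
- have o : tent k%:R k'%:R x <= 0.
    by apply: tent_out; left; have : l'%:R <= k%:R :> R; [rewrite ler_nat|lra].
  by right; left; split=> [|/lt_]; lra.
- by right; right; have := tent_nested x kl l'k'; lra.
- by right; left; have := tent_nested x lk k'l'; split; lra.
Qed.

Lemma PL_pieces (f : R -> pt R) d : 0 < d ->
  (forall k : int, affine_on [set x : R^o | k%:~R * d <= x <= (k + 1)%:~R * d] f) ->
  PL (f : R^o -> pt R).
Proof.
move=> d0 aff x; pose k := Num.floor (x / d).
have [k1 k2] : k%:~R * d <= x /\ x < (k + 1)%:~R * d.
  by have := floor_itv (x / d); rewrite ler_pdivlMr // ltr_pdivrMr // => /andP.
have hullE (a b : R) : a < b -> conv_hull ([:: a; b] : seq R^o) = [set y : R^o | a <= y <= b].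
  move=> ab; apply/seteqP; split=> y /=.
    case=> c [c0 c1 ->]; move: c1 (c0 ord0) (c0 (lift ord0 ord0)).
    rewrite !big_ord_recl !big_ord0 /= /GRing.scale /= !addr0 => c1 h0 h1.
    move: (c (lift ord0 ord0)) (c ord0) c1 h0 h1 => q p pq p0 q0.
    have -> : q = 1 - p by lra.
    by apply/andP; split; nra.
  move=> /andP[ay yb]; have ba : 0 < b - a by lra.
  exists (fun k => if k == ord0 then (b - y) / (b - a) else (y - a) / (b - a)); split.
  - by move=> k'; case: ifP => _; apply: divr_ge0; lra.
  - by rewrite !big_ord_recl big_ord0 /=; field; rewrite gt_eqF.
  - by rewrite !big_ord_recl big_ord0 /= /GRing.scale /=; field; rewrite gt_eqF.
have kd (m : int) : m%:~R * d < (m + 1)%:~R * d :> R by rewrite ltr_pM2r // ltr_int; lia.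
pose seg (m : int) : seq R^o := [:: m%:~R * d; (m + 1)%:~R * d].
exists [:: seg (k - 1); seg k]; split; last first.
  by move=> s; rewrite !inE => /orP[]/eqP ->; rewrite hullE.
apply/nbhs_RP; exists (Num.min d ((k + 1)%:~R * d - x)).
  by rewrite lt_min d0 subr_gt0.
move=> y; rewrite lt_min !ltr_norml => /andP[/andP[y1 y2] /andP[y3 y4]].
have kE : (k - 1 + 1)%:~R = k%:~R :> R by rewrite subrK.
have kE' : (k - 1)%:~R = k%:~R - 1 :> R by rewrite intrB.
case: (leP (k%:~R * d) y) => yk.
  exists (seg k); first by rewrite /= !inE eqxx orbT.
  by rewrite hullE //=; lra.
exists (seg (k - 1)); first by rewrite /= !inE eqxx.
by rewrite hullE //= kE kE' mulrBl mul1r; lra.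
Qed.

End Tents.

(** * The polygonal embedding of a balanced word *)

Section Build.
Variables (R : realType) (w : word).
Hypothesis Hw : run w no_lines no_lines.

Local Notation germ := (germ w).
Local Notation mate := (mate Hw).
Local Notation turn := (@turn w).
Local Notation nxt := (cyc_next mate turn).
Local Notation iterz := (iterz mate turn).
Local Notation bases := (roots_seq mate turn).
Local Notation base := (@base germ mate turn).
Local Notation sel := (selected mate turn).
Implicit Types (g : germ) (e x t : R).

Definition vert (k : nat) : pt R := @page_pt R 0 k%:R 0.

(** The tent from the point of [g] to that of its mate, for [e] from 0 to 1; the mate runs along it
    backwards. *)
Definition arc g e : pt R :=
  let v := (gpt g)%:R in let o := (gpt (mate g))%:R in
  @page_pt R (gpage g) (v + e * (o - v)) (Num.min e (1 - e) * `|o - v|).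

Lemma gpt_mate_lt g : gdir g -> (gpt g < gpt (mate g))%N.
Proof. by move/(mate_matched Hw); case=> /andP[]. Qed.

Lemma gpt_mate_ltR g : gdir g -> (gpt g)%:R + 1 <= (gpt (mate g))%:R :> R.
Proof. by move/gpt_mate_lt; rewrite natr1 ler_nat. Qed.

Lemma gpt_mate_gtR g : ~~ gdir g -> (gpt (mate g))%:R + 1 <= (gpt g)%:R :> R.
Proof.
move=> dg; have := @gpt_mate_ltR (mate g).
by rewrite gdir_mate dg mateK; apply.
Qed.

Lemma arc0 g : arc g 0 = vert (gpt g).
Proof.
rewrite /arc subr0 minElt ltr01 mul0r addr0 mul0r; exact: page_pt0.
Qed.

Lemma arc_mate g e : arc (mate g) (1 - e) = arc g e.
Proof.
rewrite /arc gpage_mate mateK; congr page_pt; first by ring.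
by rewrite distrC minC; congr (Num.min _ _ * _); ring.
Qed.

Lemma arc1 g : arc g 1 = vert (gpt (mate g)).
Proof. by rewrite -arc_mate subrr arc0. Qed.

Lemma arc_low g e : 0 <= e <= 1 / 2 -> let v := (gpt g)%:R in
  let o := (gpt (mate g))%:R in
  arc g e = @page_pt R (gpage g) (v + e * (o - v)) (e * `|o - v|).
Proof. by move=> eP /=; rewrite /arc minEle ifT //; lra. Qed.

Lemma arc_high g e : 1 / 2 <= e <= 1 -> let v := (gpt g)%:R in
  let o := (gpt (mate g))%:R in
  arc g e = @page_pt R (gpage g) (v + e * (o - v)) ((1 - e) * `|o - v|).
Proof.
move=> eP /=; rewrite /arc; case: (leP e (1 - e)) => // h.
have eE : e = 1 - e by lra.
by rewrite -eE.
Qed.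

Lemma arc_tent g e : gdir g -> 0 <= e <= 1 ->
  let v := (gpt g)%:R in let o := (gpt (mate g))%:R in
  let x := v + e * (o - v) in
  v <= x <= o /\ arc g e = @page_pt R (gpage g) x (tent v o x).
Proof.
move=> dg eP /=; have := gpt_mate_ltR dg; rewrite /arc.
move: (_%:R) (_%:R) => o v vo; split; first by apply/andP; split; nra.
congr page_pt; rewrite gtr0_norm ?subr_gt0; last lra.
rewrite /tent; case: (leP e) => h1; case: (leP (v + _ - v)) => h2; first [lra|nra].
Qed.

Lemma rightward_arc g e : 0 <= e <= 1 -> exists g' e', [/\ gdir g', 0 <= e' <= 1,
  arc g e = arc g' e', gpage g' = gpage g &
  (g' = g /\ e' = e) \/ (g' = mate g /\ e' = 1 - e)].
Proof.
move=> eP; case dg : (gdir g).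
  by exists g, e; split=> //; left.
exists (mate g), (1 - e); rewrite gdir_mate dg arc_mate gpage_mate; split=> //.
- by lra.
- by right.
Qed.

Lemma arc_height_gt0 g e : 0 < e < 1 ->
  0 < Num.min e (1 - e) * `|(gpt (mate g))%:R - (gpt g)%:R| :> R.
Proof.
move=> eP; apply: mulr_gt0; first by rewrite lt_min; lra.
rewrite normr_gt0 subr_eq0; apply/eqP => E.
case dg : (gdir g); first by have := gpt_mate_ltR dg; lra.
by have := gpt_mate_gtR (negbT dg); lra.
Qed.

Lemma arc_height_ge0 g e : 0 <= e <= 1 ->
  0 <= Num.min e (1 - e) * `|(gpt (mate g))%:R - (gpt g)%:R| :> R.
Proof. by move=> eP; rewrite mulr_ge0 ?normr_ge0 // le_min; lra. Qed.

Lemma arc_axis g e : 0 < e < 1 -> ~ axis (arc g e).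
Proof.
move=> eP; have h := arc_height_gt0 g eP.
by move/(axis_ptE (ltW h)); lra.
Qed.

Lemma arc_page g e : 0 <= e <= 1 -> page (gpage g) (arc g e).
Proof. by move=> eP; apply/page_page_pt/arc_height_ge0. Qed.

Lemma arc_right_inj g g' e e' : gdir g -> gdir g' -> 0 < e < 1 -> 0 < e' < 1 ->
  arc g e = arc g' e' -> g = g' /\ e = e'.
Proof.
move=> dg dg' eP eP'.
have [|xP aE] := @arc_tent g e dg; first by lra.
have [|xP' aE'] := @arc_tent g' e' dg'; first by lra.
have c := gpt_mate_ltR dg; have c' := gpt_mate_ltR dg'.
have m := mate_matched Hw dg; have m' := mate_matched Hw dg'.
rewrite aE aE' => /page_pt_inj[||pg xE hE].
- by apply: tent_gt0; move: c; move: (_%:R) (_%:R) => o v; nra.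
- by apply: tent_in.
rewrite -pg in m'; rewrite -xE in hE xP'.
have x'lt :
    (gpt g')%:R < (gpt g)%:R + e * ((gpt (mate g))%:R - (gpt g)%:R : R) < (gpt (mate g'))%:R.
  by rewrite xE; move: c'; move: (_%:R) (_%:R) => o v; nra.
case: (matched_tent m m' xP') => [[kE k'E]|[[_ /(_ x'lt)]|]]; rewrite ?hE ?subrr; try lra.
have gE : g = g' by apply: germ_eq => //; [exact: val_inj|rewrite dg dg'].
split=> //; rewrite -gE in xE; have : (e - e') * ((gpt (mate g))%:R - (gpt g)%:R) = 0 :> R by lra.
by move/eqP; rewrite mulf_eq0 => /orP[]/eqP h; lra.
Qed.

Lemma arc_inj g g' e e' : 0 < e < 1 -> 0 < e' < 1 -> arc g e = arc g' e' ->
  (g' = g /\ e' = e) \/ g' = mate g.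
Proof.
move=> eP eP' E.
have [|g1 [e1 [d1 e1P E1 _ c1]]] := @rightward_arc g e; first by lra.
have [|g2 [e2 [d2 e2P E2 _ c2]]] := @rightward_arc g' e'; first by lra.
have [|||] := @arc_right_inj g1 g2 e1 e2 d1 d2.
- by case: c1 => -[_ ->]; lra.
- by case: c2 => -[_ ->]; lra.
- by rewrite -E1 -E2.
case: c1 => -[-> ->]; case: c2 => -[-> ->].
- by move=> -> ->; left.
- by move=> -> _; right; rewrite mateK.
- by move=> <- _; right.
- by move=> /(congr1 mate); rewrite !mateK => -> h; left; split=> //; lra.
Qed.

Definition cycles := 'I_(size bases).

Definition ordr (j : cycles) : nat := order nxt (base j).

Lemma ordr_gt0 j : 0 < (ordr j)%:R :> R.
Proof. by rewrite ltr0n order_gt0. Qed.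

Definition germ_at (j : cycles) (m : int) : germ := iterz m (base j).

(** One period is divided into as many equal parts as the orbit has germs, each part running along
    the arc of one germ and ending where the arc of the next one starts. *)
Definition built_strand (j : cycles) t : pt R :=
  let s := (ordr j)%:R * t in arc (germ_at j (Num.floor s)) (s - (Num.floor s)%:~R).

Definition built : curves R := Curves built_strand.
Local Notation K := built.

Lemma arc_next g : arc g 1 = arc (nxt g) 0.
Proof. by rewrite arc1 arc0. Qed.

Lemma built_strandE j t (m : int) e : 0 <= e <= 1 -> (ordr j)%:R * t = m%:~R + e ->
  built_strand j t = arc (germ_at j m) e.
Proof.
move=> /andP[e0 e1] tE; rewrite /built_strand tE.
move: e1; rewrite le_eqVlt => /predU1P[->|e1].
  have -> : Num.floor (m%:~R + 1 : R) = m + 1.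
    by apply: floor_def; rewrite !intrD; lra.
  by rewrite arc_next /germ_at (iterzS (mateK Hw) (@turnK w)) intrD subrr.
have -> : Num.floor (m%:~R + e) = m by apply: floor_def; rewrite intrD; lra.
by rewrite addrAC subrr add0r.
Qed.

Lemma built_strandP j t : exists (m : int) e, [/\ 0 <= e < 1,
  (ordr j)%:R * t = m%:~R + e & built_strand j t = arc (germ_at j m) e].
Proof.
pose s := (ordr j)%:R * t.
exists (Num.floor s), (s - (Num.floor s)%:~R); split=> //; last by rewrite addrC subrK.
by have := floor_itv s; rewrite intrD; lra.
Qed.

Lemma built_strand_periodic j t : built_strand j (t + 1) = built_strand j t.
Proof.
have [m [e [eP tE ->]]] := built_strandP j t.
rewrite (@built_strandE _ _ (m + (ordr j)%:Z) e); first last.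
- by rewrite mulrDr tE mulr1 intrD -pmulrn; ring.
- by lra.
by rewrite /germ_at iterz_order //; [exact: mateK|exact: turnK].
Qed.

Lemma sel_germ_at j m : sel (germ_at j m).
Proof.
apply: selected_base; [exact: mateK|exact: turnK].
Qed.

Lemma sel_mate g : sel (mate g) = ~~ sel g.
Proof.
by apply: selected_mu; [exact: mateK|exact: turnK|exact: mate_neq|exact: turn_neq].
Qed.

Lemma sel_turn g : sel (turn g) = ~~ sel g.
Proof.
by apply: selected_nu; [exact: mateK|exact: turnK|exact: mate_neq|exact: turn_neq].
Qed.

(** An arc is run along by its two end germs in opposite directions, only one of which is selected;
    so off the axis equal images come from equal germs and positions. *)
Lemma built_strand_eq j j' t t' (m m' : int) e e' : 0 <= e < 1 -> 0 <= e' < 1 ->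
  (ordr j)%:R * t = m%:~R + e -> (ordr j')%:R * t' = m'%:~R + e' ->
  built_strand j t = built_strand j' t' ->
  (e = 0 /\ e' = 0) \/ (germ_at j m = germ_at j' m' /\ e = e').
Proof.
move=> /andP[e0 e1] /andP[e0' e1'] tE tE'.
rewrite (@built_strandE j t m e) ?e0 ?(ltW e1) // (@built_strandE j' t' m' e') ?e0' ?(ltW e1') //.
move: e0 e0'; rewrite !le_eqVlt => /predU1P[<-|e0] /predU1P[<-|e0'] E; first by left.
- have := @arc_axis (germ_at j' m') e'; rewrite e0' e1' -E arc0 => /(_ isT) [].
  exact: axis_pt.
- have := @arc_axis (germ_at j m) e; rewrite e0 e1 E arc0 => /(_ isT) [].
  exact: axis_pt.
have [||[gE eE]|gE] := arc_inj _ _ E; rewrite ?e0 ?e1 ?e0' ?e1' //; first by right.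
by have := sel_germ_at j' m'; rewrite gE sel_mate sel_germ_at.
Qed.

Lemma built_PL j : PL (built_strand j : R^o -> pt R).
Proof.
have n0 := @ordr_gt0 j; set n := (ordr j)%:R in n0.
(* The breakpoints are the axis points and the tops of the tents, that is, the half-integers in the
   parameter [n * t]. *)
have d0 : 0 < (2 * n)^-1 by rewrite invr_gt0; lra.
apply: (PL_pieces d0) => k x y l /= xP yP lP.
have [m mE] : exists m : int, k = m + m \/ k = m + m + 1.
  exists (k %/ 2)%Z; have := divz_eq k 2; have : (0 <= k %% 2 < 2)%Z.
    by rewrite modz_ge0 // ltz_pmod.
  by lia.
have scl t : k%:~R / (2 * n) <= t <= (k + 1)%:~R / (2 * n) ->
    k%:~R / 2 <= n * t <= (k%:~R + 1) / 2.
  rewrite ler_pdivrMr ?ler_pdivlMr ?intrD; try lra.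
have xyP : k%:~R / (2 * n) <= l * x + (1 - l) * y <= (k + 1)%:~R / (2 * n).
  by move: xP yP lP; rewrite /GRing.scale /=; move: (_ / _) (_ / _) => u v; nra.
have {}xP := scl _ xP; have {}yP := scl _ yP; have {}xyP := scl _ xyP.
have fE t : k%:~R / 2 <= n * t <= (k%:~R + 1) / 2 ->
    built_strand j t = arc (germ_at j m) (n * t - m%:~R).
  move=> tP; apply: built_strandE; last by rewrite addrC subrK.
  by case: mE tP => ->; rewrite ?intrD; lra.
rewrite (fE _ xyP) (fE _ xP) (fE _ yP); set g := germ_at j m.
case: mE xP yP xyP => -> xP yP xyP; rewrite ?intrD in xP yP xyP.
  have A t : (m%:~R + m%:~R) / 2 <= n * t <= (m%:~R + m%:~R + 1) / 2 -> _ :=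
    fun tP => @arc_low g (n * t - m%:~R) ltac:(lra).
  rewrite (A _ xyP) (A _ xP) (A _ yP) /page_pt.
  by congr ((_, _), _); rewrite /= -[l *: _]/(l * _) -[(1 - l) *: _]/((1 - l) * _); ring.
have A t : (m%:~R + m%:~R + 1) / 2 <= n * t <= (m%:~R + m%:~R + 1 + 1) / 2 -> _ :=
  fun tP => @arc_high g (n * t - m%:~R) ltac:(lra).
rewrite (A _ xyP) (A _ xP) (A _ yP) /page_pt.
by congr ((_, _), _); rewrite /= -[l *: _]/(l * _) -[(1 - l) *: _]/((1 - l) * _); ring.
Qed.

Lemma built_local_inj j t : exists2 U, nbhs t U & {in U &, injective (built_strand j)}.
Proof.
have n0 := @ordr_gt0 j; set n := (ordr j)%:R in n0.
(* Equal images have equal fractional parts of [n * t]; with this radius the values [n * t1] and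
   [n * t2] differ by less than 1, hence not at all. *)
exists [set s : R | `|s - t| < (2 * n)^-1].
  by apply/nbhs_RP; exists (2 * n)^-1 => //; rewrite invr_gt0; lra.
move=> t1 t2; rewrite !inE /= => t1P t2P E.
have [m1 [e1 [e1P t1E _]]] := built_strandP j t1.
have [m2 [e2 [e2P t2E _]]] := built_strandP j t2.
have e12 : e1 = e2.
  by have [[-> ->]|[]] := built_strand_eq e1P e2P t1E t2E E.
have nt : n * (t1 - t2) = (m1 - m2)%:~R by rewrite intrB; lra.
have m12 : m1 = m2.
  have : -1 < (m1 - m2)%:~R :> R /\ (m1 - m2)%:~R < 1 :> R.
    rewrite -nt; have : n * (2 * n)^-1 = 1 / 2 by field; rewrite gt_eqF.
    by move: t1P t2P; rewrite !ltr_norml; move: (_^-1) => r; nra.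
  by case; rewrite -[1]/(1%:~R) -mulrNz !ltr_int; lia.
have : n * (t1 - t2) = 0 by rewrite nt m12 subrr.
by move/eqP; rewrite mulf_eq0 gt_eqF //= subr_eq0 => /eqP.
Qed.

Definition at_germ (z : cycles * R) g : Prop := exists m : nat,
  [/\ (m < ordr z.1)%N, (ordr z.1)%:R * z.2 = m%:R & germ_at z.1 m = g].

Lemma vert_inj : injective vert.
Proof. by move=> k k' [/eqP]; rewrite eqr_nat => /eqP. Qed.

Lemma axis_vert k : axis (vert k).
Proof. exact: axis_pt. Qed.

Lemma germ_at_inj j j' (m m' : nat) : (m < ordr j)%N -> (m' < ordr j')%N ->
  germ_at j m = germ_at j' m' :> germ -> j = j' /\ m = m'.
Proof. by move=> mo mo' E; apply: (base_inj (mateK Hw) (@turnK w) mo mo' E). Qed.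

Lemma fiberP p (z : cycles * R) : @fiber R K p z -> exists (m : nat) e,
  [/\ (m < ordr z.1)%N, 0 <= e < 1, (ordr z.1)%:R * z.2 = m%:R + e &
      p = arc (germ_at z.1 m) e].
Proof.
case: z => j t [/= tP sp]; have [m [e [eP tE sE]]] := built_strandP j t.
have n0 := @ordr_gt0 j.
have [m0 mn] : -1 < m%:~R :> R /\ m%:~R < (ordr j)%:R :> R by split; nra.
have : (-1 < m)%R /\ (m < ordr j)%R by split; rewrite -(ltr_int R).
case: m tE sE {m0 mn} => m tE sE []; last by lia.
by move=> _ mo; exists m, e; split=> //; rewrite -sp -sE.
Qed.

Lemma fiber_uniq p (z z' : cycles * R) : (forall k, p <> vert k) ->
  @fiber R K p z -> @fiber R K p z' -> z = z'.
Proof.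
move=> np fz fz'; have [m [e [mo eP tE pE]]] := fiberP fz.
have [m' [e' [mo' eP' tE' pE']]] := fiberP fz'.
case: z z' fz fz' m mo tE pE m' mo' tE' pE' => [j t] [j' t'] [/= tP sp] [/= tP' sp'].
move=> m mo tE pE m' mo' tE' pE'.
have E : built_strand j t = built_strand j' t' by rewrite [LHS]sp [RHS]sp'.
have [[e0 _]|[gE eE]] := built_strand_eq (m := m) (m' := m') eP eP' tE tE' E.
  by case: (np (gpt (germ_at j m))); rewrite pE e0 arc0.
have [jj mm] := germ_at_inj mo mo' gE; subst j' m' e'.
congr (_, _); have n0 := @ordr_gt0 j.
by apply: (mulfI (lt0r_neq0 n0)); rewrite tE tE'.
Qed.

Lemma fiber_vert k (z : cycles * R) : @fiber R K (vert k) z ->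
  exists g, at_germ z g /\ gpt g = k :> nat.
Proof.
move=> fz; have [m [e [mo eP tE pE]]] := fiberP fz.
have e0 : e = 0.
  apply: contrapT => /eqP e0; have := @arc_axis (germ_at z.1 m) e.
  by rewrite -pE lt_neqAle eq_sym e0 /= => /(_ eP); apply; exact: axis_vert.
exists (germ_at z.1 m); split; first by exists m; rewrite tE e0 addr0.
by apply/esym/vert_inj; rewrite pE e0 arc0.
Qed.

Lemma at_germ_local z g : at_germ z g -> let n := (ordr z.1)%:R in
  forall e, 0 <= e <= n^-1 ->
  built_strand z.1 (z.2 + e) = arc g (n * e) /\ built_strand z.1 (z.2 - e) = arc (turn g) (n * e).
Proof.
move=> [m [mo tE <-]] n e; have n0 := @ordr_gt0 z.1; rewrite -/n in n0 tE.
have nV : n * n^-1 = 1 by rewrite mulfV ?gt_eqF.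
move=> eP; have neP : 0 <= n * e <= 1 by move: nV eP; move: (_^-1) => r; nra.
split; first by apply: built_strandE => //; rewrite mulrDr tE.
rewrite (@built_strandE _ _ (m%:Z - 1) (1 - n * e)); first last.
- by rewrite mulrBr -/n tE intrB -pmulrn; ring.
- by lra.
rewrite /germ_at (iterzP (mateK Hw) (@turnK w)) -[in LHS](arc_mate) mateK.
by congr arc; ring.
Qed.

Lemma at_germ_fiber z g : at_germ z g -> @fiber R K (vert (gpt g)) z.
Proof.
move=> zg; have [m [mo tE gE]] := zg; have n0 := @ordr_gt0 z.1.
split; last first.
  have [|+ _] := at_germ_local zg (e := 0); first by rewrite lexx invr_ge0 ltW.
  by rewrite addr0 mulr0 arc0.
have m0 : 0 <= (m%:R : R) < (ordr z.1)%:R by rewrite ler0n ltr_nat.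
by move: m0; rewrite -tE; move: n0; move: (_%:R) => n n0 /andP[h1 h2]; apply/andP; split; nra.
Qed.

Lemma at_germ_sel z g : at_germ z g -> sel g.
Proof. by move=> [m [_ _ <-]]; exact: sel_germ_at. Qed.

Lemma at_germ_ex g : sel g -> exists z, at_germ z g.
Proof.
move=> /(base_ex (mateK Hw) (@turnK w))[j [m [mo mE]]].
exists (j, m%:R / (ordr j)%:R), m; split=> //=.
by rewrite mulrC divfK // gt_eqF // ordr_gt0.
Qed.

Lemma at_germ_inj z z' g : at_germ z g -> at_germ z' g -> z = z'.
Proof.
case: z z' => [j t] [j' t'] [m [/= mo tE gE]] [m' [/= mo' tE' gE']].
have [jj mm] := germ_at_inj mo mo' (etrans gE (esym gE')); subst j' m'.
congr (_, _); have n0 := @ordr_gt0 j.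
by apply: (mulfI (lt0r_neq0 n0)); rewrite tE tE'.
Qed.

Lemma at_germ_fun z g g' : at_germ z g -> at_germ z g' -> g = g'.
Proof.
move=> [m [_ tE <-]] [m' [_ tE' <-]]; congr germ_at; apply/eqP.
by rewrite eqz_nat -(eqr_nat R) -tE -tE'.
Qed.

Lemma germs_not_x g g' : gpt g = gpt g' -> ~~ is_x (letter_nth w (gpt g)) ->
  g' = g \/ g' = turn g.
Proof.
move=> kk nx.
have same (h h' : germ) : gpt h = gpt h' -> ~~ is_x (letter_nth w (gpt h)) ->
    gpage h = gpage h' -> h = h'.
  move=> hk hx hp; apply: germ_eq => //.
  have := germ_has h; have := germ_has h'; rewrite -hk -hp.
  case: (letter_nth w (gpt h)) hx => j //= _; case: (gdir h); case: (gdir h') => //=;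
    by rewrite /has_germ /= => /eqP -> ; rewrite Z3_neq.
have [pp|pn] := eqVneq (gpage g') (gpage g); first by left; exact/esym/same.
right; apply/esym/(same (turn g) g') => //.
have hg := has_germ_page (germ_has g); have := has_germ_page (germ_has g').
rewrite -kk => hg'; rewrite -[LHS]/(- letter_index (letter_nth w (gpt g)) - gpage g).
by move: pn; case/orP: hg => /eqP ->; case/orP: hg' => /eqP ->; rewrite ?eqxx // turn_page.
Qed.

Lemma singularP p : singular_point K p -> exists k : 'I_(size w),
  p = vert k /\ is_x (letter_nth w k).
Proof.
case=> z1 [z2 [f1 f2 z12]].
have [k pk] : exists k, p = vert k.
  by apply: contrapT => np; apply: z12; apply: fiber_uniq f1 f2 => k pk; apply: np; exists k.
rewrite pk in f1 f2; have [g1 [a1 k1]] := fiber_vert f1; have [g2 [a2 k2]] := fiber_vert f2.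
exists (gpt g1); split; first by rewrite k1.
apply: contraT => nx; have gg : gpt g1 = gpt g2 by apply: val_inj; rewrite /= k1 k2.
have [gE|gE] := germs_not_x gg nx.
  by case: z12; rewrite gE in a2; exact: at_germ_inj a1 a2.
by have := at_germ_sel a2; rewrite gE sel_turn (at_germ_sel a1).
Qed.

Lemma near_vertex z g (P Q : set (pt R)) : at_germ z g ->
  (forall e, 0 < e < 1 / 2 -> P (arc g e)) ->
  (forall e, 0 < e < 1 / 2 -> Q (arc (turn g) e)) ->
  \forall e \near 0^'+, P (built_strand z.1 (z.2 + e)) /\ Q (built_strand z.1 (z.2 - e)).
Proof.
move=> zg Pg Qg; have n0 := @ordr_gt0 z.1.
have loc := at_germ_local zg; cbv zeta in loc.
move: (_%:R) n0 loc => n n0 loc.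
have nV : n * n^-1 = 1 by rewrite mulfV ?gt_eqF.
apply/near0P; exists (n^-1 / 2); first by rewrite divr_gt0 ?invr_gt0.
move=> e eP; have [|-> ->] := loc e; first by lra.
by split; [apply: Pg|apply: Qg]; move: nV eP; move: (_^-1) => r; nra.
Qed.

(** Exactly one of [g] and [turn g] is selected: the strand leaves the point along [g] in one case
    and arrives along it in the other. *)
Lemma arc_from_germ g (A : set (pt R)) : (forall e, 0 < e < 1 / 2 -> A (arc g e)) ->
  arc_from K (vert (gpt g)) A.
Proof.
move=> Ag; case sg : (sel g).
  have [z zg] := at_germ_ex sg; exists z; first exact: at_germ_fiber.
  left; have := near_vertex zg Ag (Q := setT) (fun _ _ => I).
  by apply: filterS => e [].
have sg' : sel (turn g) by rewrite sel_turn sg.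
have [z zg] := at_germ_ex sg'; exists z; first exact: (at_germ_fiber zg).
right; have := near_vertex zg (P := setT) (Q := A) (fun _ _ => I).
rewrite turnK => /(_ Ag); by apply: filterS => e [].
Qed.

Lemma passes_germ g (A B : set (pt R)) : (forall e, 0 < e < 1 / 2 -> A (arc g e)) ->
  (forall e, 0 < e < 1 / 2 -> B (arc (turn g) e)) ->
  exists z, (at_germ z g \/ at_germ z (turn g)) /\ passes (built_strand z.1) z.2 A B.
Proof.
move=> Ag Bg; case sg : (sel g).
  have [z zg] := at_germ_ex sg; exists z; split; first by left.
  by right; have := near_vertex zg Ag Bg; apply: filterS => e [].
have sg' : sel (turn g) by rewrite sel_turn sg.
have [z zg] := at_germ_ex sg'; exists z; split; first by right.
left; have := near_vertex (Q := A) zg Bg; rewrite turnK => /(_ Ag).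
by apply: filterS => e [].
Qed.

Definition side (d : bool) : R := if d then 1 else -1.

Lemma arc_germ_pt g e : 0 < e < 1 / 2 -> exists2 h, 0 < h &
  arc g e = page_pt (gpage g) ((gpt g)%:R + side (gdir g) * h) h.
Proof.
move=> eP; exists (e * `|(gpt (mate g))%:R - (gpt g)%:R|).
  apply: mulr_gt0; first by lra.
  have := @arc_height_gt0 g e; rewrite pmulr_rgt0; first by apply; lra.
  by rewrite lt_min; lra.
rewrite arc_low; last by lra.
congr page_pt; congr (_ + _); rewrite mulrCA; congr (_ * _); rewrite /side.
case: ifP => dg.
  by rewrite mul1r ger0_norm //; have := @gpt_mate_ltR g dg; lra.
by rewrite mulN1r ler0_norm ?opprK //; have := @gpt_mate_gtR g (negbT dg); lra.
Qed.

Lemma arc_dir g e : 0 < e < 1 / 2 -> page (gpage g) (arc g e) /\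
  (if gdir g then xco (vert (gpt g)) < xco (arc g e) else xco (arc g e) < xco (vert (gpt g))).
Proof.
move=> /(arc_germ_pt g)[h h0 ->]; split; first exact/page_page_pt/ltW.
by rewrite /side /xco /=; case: (gdir g); lra.
Qed.

Definition uvec : pt R := ((1, 0), 0).
Definition pvec (i : 'Z_3) : pt R := ((0, pagey R i), pagez R i).

Lemma bent_chart_pages i k (a : R * R) : bent_chart uvec (pvec i) (pvec k) a =
  if 0 <= a.2 then page_pt i a.1 a.2 else page_pt k a.1 (- a.2).
Proof.
rewrite /bent_chart /page_pt; case: ifP => _; congr ((_, _), _); rewrite /=;
  rewrite -?[a.1 *: _]/(a.1 * _) -?[a.2 *: _]/(a.2 * _) -?[(- a.2) *: _]/((- a.2) * _); ring.
Qed.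

Lemma bent_frame_pages i k : i != k -> bent_frame uvec (pvec i) (pvec k).
Proof.
move=> ik [a1 a2] [b1 b2]; rewrite !bent_chart_pages /=.
have aux (x h x' h' : R) : 0 <= h -> h' < 0 -> page_pt i x h <> page_pt k x' (- h').
  move=> h0 h'0 E; have := esym E => /page_pt_inj[||kE _ _]; [lra|lra|].
  by rewrite kE eqxx in ik.
have inj (l : 'Z_3) (x h x' h' : R) : 0 <= h -> 0 <= h' ->
    page_pt l x h = page_pt l x' h' -> x = x' /\ h = h'.
  move=> h0 h'0 E; split; first by case: E.
  by move/(congr1 (page_sign l)): E; rewrite !page_sign_pt.
case: (leP 0 a2) => a0; case: (leP 0 b2) => b0.
- by move/(inj _ _ _ _ _ a0 b0) => [-> ->].
- by move/(aux _ _ _ _ a0 b0).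
- by move/esym/(aux _ _ _ _ b0 a0).
- by move/inj => [||-> h]; [lra|lra|congr (_, _); lra].
Qed.

Lemma vert_add n i x h : vert n + page_pt i x h = page_pt i (n%:R + x) h.
Proof. by congr ((_, _), _); rewrite /= mulr0 add0r. Qed.

Lemma arc_quadrant g i k e : i != k -> (gpage g == i) || (gpage g == k) -> 0 < e < 1 / 2 ->
  quadrant uvec (pvec i) (pvec k) (vert (gpt g)) (side (gdir g)) (side (gpage g == i)) (arc g e).
Proof.
move=> ik pg /(arc_germ_pt g)[h h0 ->].
have s2 : side (gdir g) * side (gdir g) = 1 by rewrite /side; case: ifP; lra.
exists (side (gdir g) * h, side (gpage g == i) * h).
  rewrite /= !mulrA s2 mul1r; split=> //.
  by rewrite /side; case: ifP; lra.
rewrite bent_chart_pages /= -vert_add; case: eqVneq pg => [-> _|_ /= /eqP ->] /=.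
  by rewrite /side mul1r ifT // ltW.
by rewrite /side mulN1r opprK ifF //; apply/negbTE; rewrite -ltNge; lra.
Qed.

Lemma x_letter k : is_x (letter_nth w k) -> exists j, letter_nth w k = LX j.
Proof. by case: letter_nth => // j; exists j. Qed.

Lemma x_germs (k : 'I_(size w)) j : letter_nth w k = LX j ->
  exists g1 g2 : germ,
  [/\ [/\ gpt g1 = k, gpage g1 = j - 1, gdir g1 = false,
          gpage (turn g1) = j + 1 & gdir (turn g1) = true],
      [/\ gpt g2 = k, gpage g2 = j + 1, gdir g2 = false,
          gpage (turn g2) = j - 1 & gdir (turn g2) = true] &
      forall g, gpt g = k -> [\/ g = g1, g = turn g1, g = g2 | g = turn g2]].
Proof.
move=> kx.
have ok1 : germ_ok (k, j - 1, false) by rewrite /germ_ok /= kx /= eqxx.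
have ok2 : germ_ok (k, j + 1, false) by rewrite /germ_ok /= kx /= eqxx orbT.
exists (Germ ok1), (Germ ok2).
have t1 : gpage (turn (Germ ok1)) = j + 1 by rewrite /gpage /gpt /= kx /= turn_page.
have t2 : gpage (turn (Germ ok2)) = j - 1 by rewrite /gpage /gpt /= kx /= turn_page.
have d1 : gdir (turn (Germ ok1)) = true by rewrite /gdir /gpt /= kx.
have d2 : gdir (turn (Germ ok2)) = true by rewrite /gdir /gpt /= kx.
split=> // g gk; have := has_germ_page (germ_has g); rewrite gk kx /= => /orP[]/eqP pg;
  case dg : (gdir g).
- by constructor 4; apply: germ_eq; rewrite ?t2 ?d2.
- by constructor 1; apply: germ_eq.
- by constructor 2; apply: germ_eq; rewrite ?t1 ?d1.
- by constructor 3; apply: germ_eq.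
Qed.

Lemma x_crossing (k : 'I_(size w)) j : letter_nth w k = LX j ->
  exists z1 z2, [/\ z1 <> z2, @fiber R K (vert k) = [set z1; z2],
    bent_frame uvec (pvec (j - 1)) (pvec (j + 1)) &
    crosses_in uvec (pvec (j - 1)) (pvec (j + 1)) (vert k)
      (@strand R K z1.1) z1.2 (@strand R K z2.1) z2.2].
Proof.
move=> kx; have [g1 [g2 [[k1 p1 d1 p1' d1'] [k2 p2 d2 p2' d2'] all_g]]] := x_germs kx.
have jj : j - 1 != j + 1 by rewrite Z3_neq.
have q g e : gpt g = k -> (gpage g == j - 1) || (gpage g == j + 1) -> 0 < e < 1 / 2 ->
    quadrant uvec (pvec (j - 1)) (pvec (j + 1)) (vert k)
      (side (gdir g)) (side (gpage g == j - 1)) (arc g e).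
  by move=> <-; exact: arc_quadrant.
have jj' := Z3_neq j.
have [z1 [z1g pass1]] : exists z, (at_germ z g1 \/ at_germ z (turn g1)) /\
    passes (built_strand z.1) z.2 (quadrant uvec (pvec (j - 1)) (pvec (j + 1)) (vert k) (-1) 1)
                             (quadrant uvec (pvec (j - 1)) (pvec (j + 1)) (vert k) 1 (-1)).
  apply: passes_germ => e eP.
    by have := q g1 e k1; rewrite d1 p1 eqxx; apply.
  by have := q (turn g1) e k1; rewrite d1' p1' eqxx orbT jj'; apply.
have [z2 [z2g pass2]] : exists z, (at_germ z g2 \/ at_germ z (turn g2)) /\
    passes (built_strand z.1) z.2 (quadrant uvec (pvec (j - 1)) (pvec (j + 1)) (vert k) (-1) (-1))
                             (quadrant uvec (pvec (j - 1)) (pvec (j + 1)) (vert k) 1 1).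
  apply: passes_germ => e eP.
    by have := q g2 e k2; rewrite d2 p2 eqxx orbT jj'; apply.
  by have := q (turn g2) e k2; rewrite d2' p2' eqxx; apply.
have fib z : at_germ z g1 \/ at_germ z (turn g1) -> @fiber R K (vert k) z.
  by case=> /at_germ_fiber; rewrite [gpt _]k1.
have fib' z : at_germ z g2 \/ at_germ z (turn g2) -> @fiber R K (vert k) z.
  by case=> /at_germ_fiber; rewrite [gpt _]k2.
have f1 := fib _ z1g; have f2 := fib' _ z2g.
exists z1, z2; split.
- move=> z12; rewrite -z12 in z2g.
  have neq h h' : gpage h != gpage h' \/ gdir h != gdir h' ->
      at_germ z1 h -> at_germ z1 h' -> False.
    by move=> hh a a'; case: hh; rewrite (at_germ_fun a a') eqxx.
  by case: z1g => a1; case: z2g => a2; apply: (neq _ _ _ a1 a2);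
    rewrite ?p1 ?p2 ?p1' ?p2' ?d1 ?d2 ?d1' ?d2' ?jj'; auto.
- apply/seteqP; split=> z /=; last by case=> ->.
  move=> fz; have [g [ag gk]] := fiber_vert fz.
  have {}gk : gpt g = k by apply: val_inj.
  have s1 g' : sel g' -> ~~ sel (turn g') by rewrite sel_turn negbK.
  have sg := at_germ_sel ag.
  have pair h z' : at_germ z' h \/ at_germ z' (turn h) -> g = h \/ g = turn h -> z = z'.
    case=> a [] gE; rewrite gE in ag sg.
    + exact: at_germ_inj ag a.
    + by have := at_germ_sel a; have := s1 _ sg; rewrite turnK => /negbTE ->.
    + by have := at_germ_sel a; have := s1 _ sg => /negbTE ->.
    + exact: at_germ_inj ag a.
  have [] := all_g g gk => gE; [left|left|right|right]; apply: pair; eauto.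
- exact: bent_frame_pages.
- by split=> //; [case: f1|case: f2].
Qed.

Lemma built_singular p : singular_point K p <->
  exists k : 'I_(size w), p = vert k /\ is_x (letter_nth w k).
Proof.
split; first exact: singularP.
case=> k [-> /x_letter[j kx]]; have [z1 [z2 [z12 fE _ _]]] := x_crossing kx.
by exists z1, z2; rewrite fE; split=> //; [left|right].
Qed.

Lemma image_arc p : image_of K p -> exists g e, [/\ gdir g, 0 <= e <= 1 & p = arc g e].
Proof.
case=> j [t <-]; have [m [e [eP _]]] := built_strandP j t.
rewrite /= => ->; have [|g' [e' [dg' e'P -> _ _]]] := @rightward_arc (germ_at j m) e.
  by lra.
by exists g', e'.
Qed.

Lemma image_book : image_of K `<=` @book R.
Proof.
move=> p /image_arc[g [e [_ eP ->]]]; exists (gpage g) => //; exact: arc_page.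
Qed.

Lemma letter_has_germ l : exists i d, has_germ l i d.
Proof.
case: l => i; [exists (i - 1), true|exists (i - 1), false|exists (i - 1), false|
  exists (i - 1), true|exists (i - 1), true]; by rewrite /has_germ /= eqxx.
Qed.

Lemma vert_germ (k : 'I_(size w)) : exists g : germ, gpt g = k.
Proof.
have [i [d h]] := letter_has_germ (letter_nth w k).
have ok : germ_ok (k, i, d) by exact: h.
by exists (Germ ok).
Qed.

Lemma image_axis p : (image_of K `&` @axis R) p <-> exists k : 'I_(size w), p = vert k.
Proof.
split=> [[/image_arc[g [e [dg eP ->]]] ax]|[k ->]].
  have [e0|[e1|e01]] : e = 0 \/ e = 1 \/ 0 < e < 1.
  - case/andP: eP; rewrite !le_eqVlt => /predU1P[->|e0] /predU1P[->|e1]; auto.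
    by rewrite e0 e1; auto.
  - by exists (gpt g); rewrite e0 arc0.
  - by exists (gpt (mate g)); rewrite e1 arc1.
  - by case: (arc_axis e01 ax).
split; last exact: axis_vert.
have [g gk] := vert_germ k.
have [z zg] : exists z, at_germ z g \/ at_germ z (turn g).
  case sg : (sel g); first by have [z] := at_germ_ex sg; exists z; left.
  have sg' : sel (turn g) by rewrite sel_turn sg.
  by have [z] := at_germ_ex sg'; exists z; right.
exists z.1, z.2; rewrite -gk.
by case: zg => /at_germ_fiber[].
Qed.

Lemma germ_arc k i d : has_germ (letter_nth w k) i d -> (k < size w)%N ->
  if d then arc_right K (vert k) i else arc_left K (vert k) i.
Proof.
move=> h kw; have ok : germ_ok (Ordinal kw, i, d) by exact: h.
have gd e : 0 < e < 1 / 2 -> _ := fun eP => @arc_dir (Germ ok) e eP.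
rewrite {1}/gdir {1}/gpage /= in gd.
case: d h ok gd => h ok gd; apply: (@arc_from_germ (Germ ok)) => e /gd[gp gx]; exact: conj gp gx.
Qed.

(** Within 1/4 of the point, a height in a page is below 1/2, whereas a tent passing over [k] has
    height at least 3/4 there. Only tents ending at [k] remain, and they lie in the two pages of the
    letter. *)
Lemma built_near_pages k j : (k < size w)%N -> letter_nth w k = LX j ->
  near_pages K (vert k) j.
Proof.
move=> kw kx; exists [set q : pt R | [/\ `|xco q - xco (vert k)| < 1 / 4,
    `|yco q - yco (vert k)| < 1 / 4 & `|zco q - zco (vert k)| < 1 / 4]].
  by apply: box_nbhs; lra.
move=> p [/image_arc[g [e [dg eP pE]]] [px py pz]].
have [xP aE] := @arc_tent g e dg eP; rewrite -pE in aE.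
have c := @gpt_mate_ltR g dg.
have pgP : page (gpage g) p by rewrite pE; exact: arc_page.
have germ_page (h : germ) : gpt h = k :> nat -> (gpage h == j - 1) || (gpage h == j + 1).
  by move=> hk; have := has_germ_page (germ_has h); rewrite hk kx.
have done_ : (gpage g == j - 1) || (gpage g == j + 1) -> (page (j - 1) `|` page (j + 1)) p.
  by case/orP => /eqP E; [left|right]; rewrite -E.
have xE : xco p = (gpt g)%:R + e * ((gpt (mate g))%:R - (gpt g)%:R) by rewrite aE.
have sE : page_sign (gpage g) p = tent (gpt g)%:R (gpt (mate g))%:R (xco p).
  by rewrite {1}aE page_sign_pt ?xE //; apply: tent_in.
rewrite -xE in xP.
have xk : xco (vert k) = k%:R by [].
have [y0 z0] : yco (vert k) = 0 /\ zco (vert k) = 0 by exact: axis_vert.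
move: px py pz; rewrite xk y0 z0 !subr0 !ltr_norml => px py pz.
have s_lt : page_sign (gpage g) p < 1 / 2.
  have : `|yco p| < 1 / 4 by rewrite ltr_norml.
  rewrite /page_sign; have := normr_ge0 (yco p); move: (`|_|) => ay.
  by case: ifP => _; [lra|case: ifP => _; lra].
clear kx pE aE xE.
case: (ltngtP (gpt g) k) => [gk|kg|/germ_page]; last exact: done_.
- case: (ltngtP k (gpt (mate g))) => [km|mk|mk].
  + exfalso.
    have h1 : (gpt g)%:R + 1 <= k%:R :> R by rewrite natr1 ler_nat.
    have h2 : k%:R + 1 <= (gpt (mate g))%:R :> R by rewrite natr1 ler_nat.
    by move: s_lt; rewrite sE /tent; case: (leP (xco p - _)); lra.
  + have h2 : (gpt (mate g))%:R + 1 <= k%:R :> R by rewrite natr1 ler_nat.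
    by exfalso; lra.
  + by apply: done_; rewrite -(gpage_mate Hw); apply: germ_page.
- have h1 : k%:R + 1 <= (gpt g)%:R :> R by rewrite natr1 ler_nat.
  by exfalso; lra.
Qed.

Lemma built_singular_knot : singular_knot K.
Proof.
split.
- exact: built_strand_periodic.
- exact: built_PL.
- exact: built_local_inj.
- apply: (@sub_finite_set _ _ [set vert (k : 'I_(size w)) | k in [set: 'I_(size w)]]).
    by move=> p /built_singular[k [-> _]]; exists k.
  exact/finite_image/finite_finset.
- move=> p /built_singular[k [-> /x_letter[j kx]]].
  have [z1 [z2 [_ fE bf cr]]] := x_crossing kx.
  exists z1, z2; split=> //; exists uvec, (pvec (j - 1)), (pvec (j + 1)).
  by split.
Qed.

(** Besides the arcs of page [i], the points of the axis lie in that page; they have integer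
    abscissa, where a tent is at least 1 strictly inside its base and at most 0 elsewhere, so the
    same gap persists. *)
Lemma image_tent i k k' p : matched w i k k' -> (image_of K `&` page i) p ->
  0 <= page_sign i p - tent k%:R k'%:R (xco p) \/
  page_sign i p - tent k%:R k'%:R (xco p) <= -1.
Proof.
move=> m [Ip ip]; have [g [e [dg eP pE]]] := image_arc Ip.
have [kk' k'w] : (k < k')%N /\ (k' < size w)%N by case: m => /andP[].
have [E|ne] := eqVneq (gpage g) i.
  have [xP aE] := @arc_tent g e dg eP; rewrite -pE in aE.
  have m' := mate_matched Hw dg; rewrite E in m' aE.
  have sE : page_sign i p = tent (gpt g)%:R (gpt (mate g))%:R (xco p).
    by rewrite {1}aE page_sign_pt ?aE //; apply: tent_in.
  have xE : xco p = (gpt g)%:R + e * ((gpt (mate g))%:R - (gpt g)%:R) by rewrite aE.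
  rewrite -xE in xP; rewrite sE.
  case: (matched_tent m m' xP) => [[-> ->]|[[t0 _]|t1]]; last by right.
    by left; rewrite subrr.
  by left.
have axp : axis p.
  by apply: pages_axis ne ip _; rewrite pE; exact: arc_page.
have [n pn] := (@image_axis p).1 (conj Ip axp).
rewrite (axis_page_sign _ axp) sub0r pn /= -[xco _]/(n%:R).
have kn : (k < n)%N -> (n < k')%N -> 1 <= tent k%:R k'%:R n%:R :> R.
  move=> kn nk'; have h1 : k%:R + 1 <= n%:R :> R by rewrite natr1 ler_nat.
  have h2 : n%:R + 1 <= k'%:R :> R by rewrite natr1 ler_nat.
  by rewrite /tent; case: (leP (_ - k%:R)) => h; lra.
case: (ltnP k n) => [{}/kn kn|nk].
  case: (ltnP n k') => [/kn|k'n]; first by right; lra.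
  by left; rewrite oppr_ge0; apply: tent_out; right; rewrite ler_nat.
by left; rewrite oppr_ge0; apply: tent_out; left; rewrite ler_nat.
Qed.

Lemma page_ptE i (p : pt R) : page i p -> p = page_pt i (xco p) (page_sign i p).
Proof.
case: p => [[x y] z]; move: i; apply: Z3P; rewrite /page /page_sign /page_pt /pagey /pagez /=;
  rewrite /xco /yco /zco /= => -[-> h]; rewrite ?normr0; congr ((_, _), _); lra.
Qed.

(** Were there two points at different heights over one abscissa, the height relative to the tent of
    the upper one would be 0 there and at most -1 at the lower one. On a connected set it would take
    the value -1/2, which the gap excludes. *)
Lemma built_components i p : (image_of K `&` page i) p ->
  {in connected_component (image_of K `&` page i) p &, injective (@xco R)}.
Proof.
move=> Kp q q'; rewrite !inE => cq cq' xqq.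
have Kq := connected_component_sub cq; have Kq' := connected_component_sub cq'.
have wlog_ (a b : pt R) : connected_component (image_of K `&` page i) p a ->
    connected_component (image_of K `&` page i) p b -> xco a = xco b ->
    page_sign i a < page_sign i b -> False.
  move=> ca cb xab sab; have Ka := connected_component_sub ca.
  have [Ib ib] := connected_component_sub cb.
  have a0 := page_sign_ge0 Ka.2.
  have [g [e [dg eP bE]]] := image_arc Ib.
  have nax : ~ axis b by move/(axis_page_sign i); lra.
  have gi : gpage g = i.
    apply/eqP; apply: contraT => gi; case: nax; apply: pages_axis gi ib _.
    by rewrite bE; exact: arc_page.
  have m := mate_matched Hw dg; rewrite gi in m.
  have [xP aE] := @arc_tent g e dg eP; rewrite -bE gi in aE.
  pose F (r : pt R) := page_sign i r - tent (gpt g)%:R (gpt (mate g))%:R (xco r).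
  have Fb : F b = 0.
    by rewrite /F {1}aE page_sign_pt ?tent_in // aE subrr.
  have Fa : F a <= -1.
    have : F a < 0 by move: Fb; rewrite /F xab; lra.
    by case: (image_tent m Ka); rewrite -/(F a); lra.
  have cF : continuous F.
    move=> r; apply: continuousB; first exact: page_sign_continuous.
    rewrite /tent; apply: continuous_min.
      by apply: continuousB; [exact: xco_continuous|exact: cst_continuous].
    by apply: continuousB; [exact: cst_continuous|exact: xco_continuous].
  have cc : connected (F @` connected_component (image_of K `&` page i) p).
    apply: connected_continuous_connected; first exact: component_connected.
    exact: continuous_subspaceT.
  have /connected_intervalP itv := cc.
  have [|r cr Fr] := itv (F a) (F b) (imageP F ca) (imageP F cb) (- (1 / 2)); first by lra.
  by have := image_tent m (connected_component_sub cr); rewrite -/(F r) Fr; lra.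
rewrite (page_ptE Kq.2) (page_ptE Kq'.2) xqq.
case: (ltgtP (page_sign i q) (page_sign i q')) => [lt|lt|->] //.
- by case: (wlog_ _ _ cq cq' xqq lt).
- by case: (wlog_ _ _ cq' cq (esym xqq) lt).
Qed.

Lemma built_embedded : three_page_embedded K.
Proof.
have fin : finite_set (image_of K `&` @axis R).
  apply: (@sub_finite_set _ _ [set vert (k : 'I_(size w)) | k in [set: 'I_(size w)]]).
    by move=> p /image_axis[k ->]; exists k.
  exact/finite_image/finite_finset.
split.
- by split; [exact: built_singular_knot|exact: image_book].
- by split=> // p /built_singular[k [-> _]]; exact: axis_vert.
- move=> p z axp nsp fz.
  have [k pk] : exists k : 'I_(size w), p = vert k.
    by apply/image_axis; split=> //; exists z.1, z.2; case: fz.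
  rewrite pk in fz; have [g [zg _]] := fiber_vert fz.
  exists (gpage (turn g)), (gpage g); split; first by apply/eqP; exact: gpage_turn.
  left; have ap h e : 0 < e < 1 / 2 -> page (gpage h) (arc h e).
    by move=> eP; apply: arc_page; lra.
  have := near_vertex zg (ap g) (ap (turn g)).
  by apply: filterS => e [].
- move=> p /built_singular[k [-> /x_letter[j kx]]]; exists j.
  have ga i d : has_germ (letter_nth w k) i d -> _ := fun h => germ_arc h (ltn_ord k).
  have L i h := ga i false h; have Rr i h := ga i true h.
  rewrite kx /has_germ /= in L Rr.
  split; first exact: built_near_pages.
  by split; [apply: L|apply: Rr|apply: L|apply: Rr]; rewrite eqxx ?orbT.
- exact: built_components.
Qed.

Lemma built_letter_at k : (k < size w)%N -> letter_at K (vert k) (letter_nth w k).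
Proof.
move=> kw; have ga i d : has_germ (letter_nth w k) i d -> _ := fun h => germ_arc h kw.
have L i h := ga i false h; have Rr i h := ga i true h.
have ns : ~~ is_x (letter_nth w k) -> ~ singular_point K (vert k).
  by move=> nx /built_singular[k' [/vert_inj <-]]; apply/negP.
have sg : is_x (letter_nth w k) -> singular_point K (vert k).
  by move=> kx; apply/built_singular; exists (Ordinal kw).
have np j := @built_near_pages k j kw.
rewrite /has_germ in L Rr; move: L Rr ns sg np.
case: (letter_nth w k) => j /= L Rr ns sg np; split; try (exact: ns);
  try (by apply: L; rewrite eqxx ?orbT); try (by apply: Rr; rewrite eqxx ?orbT).
- exact: sg.
- exact: np.
Qed.

Lemma built_encodes : encodes K w.
Proof.
exists [seq vert k | k <- iota 0 (size w)]; split.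
- rewrite sorted_map; have := iota_ltn_sorted 0 (size w).
  apply: sub_sorted => a b ab /=; by rewrite /relpre /= ltr_nat.
- apply/seteqP; split=> p /=.
    case/mapP => k; rewrite mem_iota add0n /= => kw ->.
    by apply/image_axis; exists (Ordinal kw).
  by case/image_axis => k ->; apply: map_f; rewrite mem_iota add0n /=.
- by rewrite size_map size_iota.
- move=> k kw; rewrite (nth_map 0%N) ?size_iota // nth_iota // add0n.
  exact: built_letter_at.
Qed.

(** The isotopy is constant, and rigidity holds because near a singular point the knot lies in two
    pages, which form a bent plane. *)
Lemma built_isotopic : isotopic K K.
Proof.
exists (fun _ p => p); split=> //.
- by apply: continuous_subspaceT => a; exact: cvg_snd.
- by move=> t _; split; [exact: PL_id|exists id; split=> //; exact: PL_id].
- exists id; first by exists id.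
  move=> j; exists id; split=> //.
  + by move=> t; exact: cvg_id.
  + by exists id.
  + by exists 1; [left|].
move=> p z1 z2 f1 f2 z12.
have [k [pk /x_letter[j kx]]] : exists k : 'I_(size w), p = vert k /\ is_x (letter_nth w k).
  by apply/built_singular; exists z1, z2.
subst p; have [U nU KU] := built_near_pages (ltn_ord k) kx.
exists U => // t _.
have [y1 [y2 [_ fE bf cr]]] := x_crossing kx.
exists uvec, (pvec (j - 1)), (pvec (j + 1)); split=> //.
  move=> _ [p Kp <-].
  have at_page i : page i p -> p = vert k + page_pt i (xco p - k%:R) (page_sign i p).
    by move=> ip; rewrite vert_add addrC subrK; exact: page_ptE.
  case: (KU _ Kp) => /[dup] ip /at_page pE.
    exists (xco p - k%:R, page_sign (j - 1) p) => //=.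
    by rewrite bent_chart_pages /= page_sign_ge0 // -pE.
  exists (xco p - k%:R, - page_sign (j + 1) p) => //=.
  rewrite bent_chart_pages /= oppr_ge0 opprK; case: ifP => [le|_]; last by rewrite -pE.
  (* At height 0 the chart uses its first half-plane; this is harmless because both pages contain
     the axis. *)
  have p0 : page_sign (j + 1) p = 0 by apply/le_anti; rewrite le page_sign_ge0.
  by rewrite [RHS]pE p0 oppr0 !(page_pt0 _ 0).
move: f1 f2 z12; rewrite fE => -[->|->] [->|->] z12.
- by case: z12.
- by left.
- by right.
- by case: z12.
Qed.

End Build.

Theorem theorem3 (R : realType) (g : SK) :
  (exists K : curves R, singular_knot K /\ corresponds g K) <->
  (forall h : SK, (g * h)%g = (h * g)%g).
Proof.
split=> [[K [_ [w [<- [L [eL wL _]]]]]]|gc].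
  exact: run_central (encodes_run eL wL).
have [w [wg rw]] := central_run gc.
exists (built R rw); split; first exact: built_singular_knot.
exists w; split=> //; exists (built R rw); split.
- exact: built_embedded.
- exact: built_encodes.
- exact: built_isotopic.
Qed.
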